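(* Let $\alpha>0$, $0<b<B$, $C'>0$, and let $\mathcal I_1,\mathcal I_2$ be two closed sets of $(0,\infty)$. Let $\xi$ be a positive constant, and set $M_n=\lfloor\log(n)/\xi\rfloor$ and $\beta_i=B-\frac{i(B-b)}{M_n}$ for $0\le i\le M_n$. There exists a sequence $(\rho_n(\beta_i))_{n,i}$ with $$\limsup_{n\to\infty}\ \sup_{0\le i\le\lfloor\log(n)/\xi\rfloor}\rho_n(\beta_i)\,\frac{n^{\beta_i/(2\beta_i+1)}}{\log(n)(\log\log n)^{3/2}}<\infty$$ such that, for the model $$\mathcal P_n=\bigcup_{\tau\in\mathcal I_1,\,C\in\mathcal I_2}\Big(\mathcal S(\tau,B,C,C')\cup\bigcup_{i=0}^{M_n-2}\tilde{\mathcal S}\big(\tau,\beta_{i+2},\beta_i,C,C',\rho_n(\beta_{i+2})\big)\Big),$$ there exists an estimate $\hat\beta$ of $\beta^*(F)$, based on $n$ i.i.d. observations from $F$, which satisfies $$\limsup_{n\to\infty}\ \sup_{F\in\mathcal P_n}\mathbb P_F\Big(|\hat\beta-\beta^*(F)|\ge 4\xi\frac{B-b}{\log(n)}\Big)\le\alpha .$$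
   Context: $\mathcal D$ denotes the set of càdlàg distribution functions of probability distributions on $\mathbb R^+$. For $\tau,\beta,C,C'>0$, $$\mathcal S(\tau,\beta,C,C')=\{F\in\mathcal D:\ \forall x \text{ with } F(x)\in(0,1],\ |1-F(x)-Cx^{-\tau}|\le C'x^{-\tau(\beta+1)}\}.$$ Here $\tau$ and $C$ are determined by $F$ since $1-F(x)\sim Cx^{-\tau}$. Distance: $\|F-F_0\|_{\infty,\tau}=\sup_{x:\,F(x)\in(0,1)}|x^\tau(1-F(x))-x^\tau(1-F_0(x))|$, and $\|F-\mathcal A\|_{\infty,\tau}=\inf_{F_0\in\mathcal A}\|F-F_0\|_{\infty,\tau}$ for a set $\mathcal A$ of distributions. For $\beta'<\beta$ and $\rho\ge0$, $$\tilde{\mathcal S}(\tau,\beta',\beta,C,C',\rho)=\{F\in\mathcal S(\tau,\beta',C,C'):\ \|F-\mathcal S(\tau,\beta,C,C')\|_{\infty,\tau}\ge\rho\}.$$ For a distribution $F\in\mathcal S(\tau,b,C,C')$, $$\beta^*(F)=\sup\{\beta\in[b,B]:\ F\in\mathcal S(\tau,\beta,C,C')\}.$$ An estimate $\hat\beta$ is a function of the observations $X_1,\dots,X_n$ that does not depend on the unknown $F$.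
   Formalization: The set I_2 is additionally assumed bounded above (without this the claim fails, e.g. for I_1={1}, I_2=[1,∞), α<1/2, with C growing as a power of n); closed sets of (0,∞) are read as closed subsets of the real line contained in (0,∞). *)

(* Defs.v *)
From HB Require Import structures.
From mathcomp Require Import all_boot all_order all_algebra.
From mathcomp Require Import all_classical all_reals all_analysis.

Set Implicit Arguments.
Unset Strict Implicit.
Unset Printing Implicit Defensive.

Import Order.TTheory GRing.Theory Num.Def Num.Theory.
Import numFieldNormedType.Exports.

Local Open Scope classical_set_scope.
Local Open Scope ring_scope.

Section sample_law.
Context d (T : measurableType d) (R : realType).

Definition tuple_cons n (x : T * n.-tuple T) : n.+1.-tuple T :=
  [the n.+1.-tuple T of x.1 :: x.2].

Lemma measurable_tuple_cons n : measurable_fun [set: T * n.-tuple T] (@tuple_cons n).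
Proof. exact: measurable_cons measurable_fst measurable_snd. Qed.

HB.instance Definition _ n :=
  isMeasurableFun.Build _ _ _ _ (@tuple_cons n) (@measurable_tuple_cons n).

(* The n-fold product measure of P, i.e., the law of an i.i.d. n-sample. *)
Fixpoint iid_law (P : probability T R) n : probability (n.-tuple T) R :=
  match n with
  | 0 => \d_ [tuple]
  | n'.+1 => distribution (P \x iid_law P n')%E (@tuple_cons n')
  end.

Lemma iid_law_box (P : probability T R) n (A : 'I_n -> set T) :
  (forall i, measurable (A i)) ->
  iid_law P n [set X | forall i, A i (tnth X i)] = (\prod_(i < n) P (A i))%E.
Proof.
elim: n A => [|n IH] A mA.
  rewrite big_ord0 /= diracE mem_set//.
  by case.
rewrite big_ord_recl -IH; last by move=> i; exact: mA.
have mB : measurable [set X : n.-tuple T | forall i, A (lift ord0 i) (tnth X i)].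
  rewrite [X in measurable X](_ : _ =
      \bigcap_(i in [set: 'I_n]) ((@tnth n T)^~ i @^-1` (A (lift ord0 i)))).
    apply: fin_bigcap_measurable; first exact: finite_finset.
    move=> i _; rewrite -[X in measurable X]setTI.
    exact: measurable_tnth.
  by apply/seteqP; split => X /= H i; [move=> _; exact: H|exact: (H i)].
rewrite /= /distribution /pushforward /=.
rewrite -product_measure1E//; congr (_ _).
apply/seteqP; split => -[x X] /=.
  by move=> H; split; [have := H ord0; rewrite tnth0|move=> i; have := H (lift ord0 i); rewrite tnthS].
move=> [H0 HS] i; case: (unliftP ord0 i) => [j|] ->.
  by rewrite tnthS; exact: HS.
by rewrite tnth0.
Qed.

End sample_law.

Section pareto_classes.
Context {R : realType}.

(* A distribution is represented by its càdlàg distribution function; the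
   probability it defines is lebesgue_stieltjes_measure F. *)
Definition distribution_function := cumulativeBounded (0 : R) (1 : R).

Implicit Types (F G : distribution_function) (tau beta b B C rho : R).

Definition on_nonneg_reals : set distribution_function :=
  [set F | forall x, x < 0 -> F x = 0].

(* F x = 0 for x < 0, so 0 < x only excludes x = 0, where x^(-tau) is
   meaningless and powR would return 0. *)
Definition pareto_class tau beta C (C' : R) : set distribution_function :=
  on_nonneg_reals `&`
  [set F | forall x, 0 < x -> 0 < F x <= 1 ->
    `|1 - F x - C * x `^ (- tau)| <= C' * x `^ (- (tau * (beta + 1)))].

Definition tail_dist tau F G : \bar R :=
  ereal_sup [set `|x `^ tau * (1 - F x) - x `^ tau * (1 - G x)|%:E
            | x in [set x | 0 < F x < 1]].

Definition tail_dist_set tau F (A : set distribution_function) : \bar R :=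
  ereal_inf [set tail_dist tau F G | G in A].

Definition separated_class tau (beta' : R) beta C (C' : R) rho :
    set distribution_function :=
  pareto_class tau beta' C C' `&`
  [set F | (rho%:E <= tail_dist_set tau F (pareto_class tau beta C C'))%E].

(* tau and C are quantified existentially because F determines them; see
   beta_starE for the form with the tau and C of F. *)
Definition beta_star b B (C' : R) F : R :=
  sup [set beta | b <= beta <= B /\
    exists tau C, [/\ 0 < tau, 0 < C & pareto_class tau beta C C' F]].

Definition nb_classes (xi : R) (n : nat) : nat := truncn (ln n%:R / xi).

Definition beta_grid b B (xi : R) (n i : nat) : R :=
  B - i%:R * (B - b) / (nb_classes xi n)%:R.

Definition model (I1 I2 : set R) b B (C' xi : R) (rho : nat -> R -> R)
    (n : nat) : set distribution_function :=
  let beta_ := beta_grid b B xi n in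
  \bigcup_(tau in I1) \bigcup_(C in I2)
    (pareto_class tau B C C' `|`
     \bigcup_(i in [set i | (i + 2 <= nb_classes xi n)%N])
       separated_class tau (beta_ (i + 2)%N) (beta_ i) C C'
         (rho n (beta_ (i + 2)%N))).

Definition sample_prob F n : probability (n.-tuple (measurableTypeR R)) R :=
  iid_law (lebesgue_stieltjes_measure F) n.

Lemma powRN_cvg0 (a : R) : 0 < a -> x `^ (- a) @[x --> +oo] --> (0 : R).
Proof.
move=> a0; apply/cvgrPdist_lt => e e0.
near=> x.
have x0 : 0 < x by near: x; exact: nbhs_pinfty_gt.
rewrite sub0r normrN ger0_norm ?powR_ge0// powRN.
rewrite -[e]invrK ltf_pV2 ?posrE ?invr_gt0 ?powR_gt0//.
have ex : e^-1 `^ a^-1 < x by near: x; exact: nbhs_pinfty_gt.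
have := @gt0_ltr_powR _ a a0 (e^-1 `^ a^-1) x.
rewrite !nnegrE powR_ge0 (ltW x0) => /(_ isT isT ex).
by rewrite -powRrM mulVf ?gt_eqF// powRr1 ?invr_ge0 ?ltW.
Unshelve. all: by end_near. Qed.

Lemma pareto_class_tail tau beta C C' F : 0 < tau -> 0 < beta ->
  pareto_class tau beta C C' F -> x `^ tau * (1 - F x) @[x --> +oo] --> C.
Proof.
move=> t0 b0 [_ FC].
have le1 x : F x <= 1.
  rewrite leNgt; apply/negP => Fx1.
  suff : \forall y \near (+oo : set_system R), False by move=> /filter_ex[].
  near=> y; suff : F y < F x.
    rewrite ltNge => /negP; apply; apply: cumulative_is_nondecreasing.
    by near: y; exact: nbhs_pinfty_ge (num_real _).
  by near: y; apply: (cvgr_lt 1) Fx1; exact: cumulativey.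
have tb0 : 0 < tau * beta by rewrite mulr_gt0.
have H : C' * x `^ (- (tau * beta)) @[x --> +oo] --> (0 : R).
  by rewrite -(mulr0 C'); apply: cvgMr; exact: powRN_cvg0.
apply/cvgrPdist_lt => e e0.
near=> x.
have x0 : 0 < x by near: x; exact: nbhs_pinfty_gt.
have Fx : 0 < F x.
  by near: x; apply: (cvgr_gt 1) ltr01; exact: cumulativey.
have := FC x x0; rewrite Fx le1 => /(_ isT) Hx.
have Hle : `|x `^ tau * (1 - F x) - C| <= C' * x `^ (- (tau * beta)).
  have xt : 0 < x `^ tau by rewrite powR_gt0.
  rewrite -[X in _ - X](_ : x `^ tau * (C * x `^ (- tau)) = C); last first.
    by rewrite powRN mulrCA divff ?mulr1// gt_eqF.
  rewrite -mulrBr normrM gtr0_norm// (le_trans (ler_wpM2l (ltW xt) Hx))//.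
  rewrite mulrCA -powRD; last by rewrite (gt_eqF x0)/= implybT.
  by rewrite mulrDr mulr1 opprD addrC addrNK.
rewrite distrC (le_lt_trans Hle)//.
apply: le_lt_trans (ler_norm _) _.
near: x; have /cvgrPdist_lt/(_ e e0) := H.
by apply: filterS => x; rewrite sub0r normrN.
Unshelve. all: by end_near. Qed.

Lemma pareto_class_inj tau1 beta1 C1 C1' tau2 beta2 C2 C2' F :
  0 < tau1 -> 0 < beta1 -> 0 < C1 -> 0 < tau2 -> 0 < beta2 -> 0 < C2 ->
  pareto_class tau1 beta1 C1 C1' F -> pareto_class tau2 beta2 C2 C2' F ->
  tau1 = tau2 /\ C1 = C2.
Proof.
wlog : tau1 beta1 C1 C1' tau2 beta2 C2 C2' / tau1 <= tau2.
  move=> W t1 b1 c1 t2 b2 c2 F1 F2.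
  have [/W H|/ltW/W H] := leP tau1 tau2; first exact: (H _ _ _ _ _ _ t1 b1 c1 t2 b2 c2 F1 F2).
  by have [-> ->] := H _ _ _ _ _ _ t2 b2 c2 t1 b1 c1 F2 F1.
move=> t12 t1 b1 c1 t2 b2 c2 F1 F2.
have T1 := pareto_class_tail t1 b1 F1.
have T2 := pareto_class_tail t2 b2 F2.
have tE : tau1 = tau2.
  apply/eqP; rewrite eq_le t12 /= leNgt; apply/negP => tlt.
  have : x `^ (- (tau2 - tau1)) * (x `^ tau2 * (1 - F x)) @[x --> +oo] --> 0 * C2.
    by apply: cvgM => //; apply: powRN_cvg0; rewrite subr_gt0.
  rewrite mul0r => T0.
  suff T1' : x `^ tau1 * (1 - F x) @[x --> +oo] --> (0 : R).
    by have := cvg_unique _ T1 T1' => C10; rewrite C10// ltxx in c1.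
  apply: cvg_trans T0; apply: near_eq_cvg; near=> x.
  have x0 : 0 < x by near: x; exact: nbhs_pinfty_gt.
  rewrite mulrA -powRD; last by rewrite (gt_eqF x0)/= implybT.
  by rewrite opprB addrNK.
by subst tau2; split=> //; exact: cvg_unique T1 T2.
Unshelve. all: by end_near. Qed.

Lemma beta_starE b B C' tau beta C F :
  0 < b -> 0 < tau -> 0 < beta -> 0 < C -> pareto_class tau beta C C' F ->
  beta_star b B C' F =
  sup [set beta | b <= beta <= B /\ pareto_class tau beta C C' F].
Proof.
move=> b0 t0 be0 C0 FC; congr sup; apply/seteqP; split => x /= [xb].
  move=> [t [c [t0' c0 Fc]]]; split=> //; move: Fc.
  have x0 : 0 < x by case/andP: xb => bx _; exact: lt_le_trans bx.
  by move=> Fc; have [-> ->] := pareto_class_inj t0 be0 C0 t0' x0 c0 FC Fc.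
by move=> Fc; split=> //; exists tau, C.
Qed.

End pareto_classes.

(* Main.v *)
(** A level [beta] is accepted when the empirical tail counts fit the envelope
    of some class [pareto_class tau beta C C'] with free parameters: on a fine
    grid up to a factor [log n], and much more precisely at two order statistics
    of rank about [n / T] and [2 n / T], [T = n^(1/(2 beta + 1))], for every
    smaller level. The estimate is the largest accepted level of the grid.

    Chernoff bounds make the true level accepted with high probability; the
    special order statistics are about [log n] in number, so that requiring them
    to be precise costs a factor [log (log n)] only. Two parameter pairs that fit
    the same two order statistics have tail exponents equal up to the relative
    error [rate * log (log n)] and constants equal up to [log n] times that. Hence
    fitting a higher level with other parameters would bring [F], at any point,
    within [log n * log (log n) * rate] of the envelope for its own [tau] and [C].

    On the other hand, clamping [F] to that envelope, and setting it to [0] where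
    [F x * x^tau] is small (there the class imposes nothing), shows that a
    separated [F] leaves the envelope by a multiple of [rho] at some point [w],
    where the empirical count is accurate. So the higher levels are rejected. *)
Require Import Defs.
From HB Require Import structures.
From mathcomp Require Import all_boot all_order all_algebra.
From mathcomp Require Import all_classical all_reals all_analysis.
From mathcomp Require Import measurable_realfun ring lra.

Set Implicit Arguments.
Unset Strict Implicit.
Unset Printing Implicit Defensive.

Import Order.TTheory GRing.Theory Num.Theory.
Import numFieldNormedType.Exports.

Local Open Scope classical_set_scope.
Local Open Scope ring_scope.

(** * Empirical tail counts *)

Section exceedance_count.
Context {R : realType}.
Implicit Types (F : @distribution_function R) (x q : R) (n : nat).

(** Since [tau] and [C] are unknown, a level can only be tested with free parameters, and a wrong
    pair may imitate a higher level; controlling this imitation is what costs the logarithms. At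
    [T = scale n beta] the bias [T^(-beta)] and the noise [sqrt (T / n)] both equal [rate n beta].
    With tolerance [ln (ln n) * rate] the Chernoff exponent is a multiple of [(ln (ln n))^2], whose
    exponential beats the number of levels, of order [ln n]. An error in the exponent is multiplied
    by [ln t <= ln n] when it is carried from the order statistics to a point of scale [t]: hence
    the factor [ln n] of [separation]. Its factor [(ln (ln n))^(3/2)] exceeds the [ln (ln n)] of the
    tolerance by a square root, which swallows all constants. The conditions at every smaller level
    make rejection possible: a candidate of index at most [i] is also tested at the order statistics
    of index [i + 2], where the true parameters fit with high probability, and the point that
    exhibits the separation lies below the scale of that index. *)

Definition exceed n (X : n.-tuple R) x : R := \sum_(k < n) (x < tnth X k)%R%:R.

Lemma exceed_ge0 n (X : n.-tuple R) x : 0 <= exceed X x.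
Proof. by apply: sumr_ge0 => i _; rewrite ler0n. Qed.

Lemma exceed_le n (X : n.-tuple R) x y : x <= y -> exceed X y <= exceed X x.
Proof.
move=> xy; apply: ler_sum => i _; rewrite ler_nat; case: ltP => //= yi.
by rewrite (le_lt_trans xy yi).
Qed.

Lemma exceed_max n (X : n.-tuple R) x : exceed X x <= n%:R.
Proof.
rewrite -[n in n%:R]card_ord -sumr_const; apply: ler_sum => i _.
by rewrite lern1 leq_b1.
Qed.

Lemma exceed_all n (X : n.-tuple R) x :
  (exceed X x = n%:R) <-> (forall i, x < tnth X i).
Proof.
split => [E i|H].
  apply/negPn/negP => xi; suff: exceed X x < n%:R by rewrite E ltxx.
  rewrite -[n in n%:R]card_ord -sumr_const.
  rewrite [ltLHS](bigD1 i)//= [ltRHS](bigD1 i)//= ltr_leD ?(negbTE xi)//.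
  by apply: ler_sum => j _; rewrite lern1 leq_b1.
rewrite /exceed (eq_bigr (fun=> 1)) ?sumr_const ?card_ord// => i _.
by rewrite H.
Qed.

(* The empirical count is right-continuous, hence locally constant. *)
Lemma exceed_near_right n (X : n.-tuple R) x :
  \forall y \near x^'+, exceed X y = exceed X x.
Proof.
have : \forall y \near x^'+, forall i : 'I_n, (y < tnth X i) = (x < tnth X i).
  apply: filter_forall => i; have [xi|ix] := ltP x (tnth X i).
    exact: nbhs_right_lt.
  have := nbhs_right_gt x; apply: filterS => y xy.
  by apply/negbTE; rewrite -leNgt (le_trans ix)// ltW.
by apply: filterS => y H; apply: eq_bigr => i _; rewrite H.
Qed.

Lemma measurable_exceed n x :
  measurable_fun [set: n.-tuple (measurableTypeR R)] (fun X => exceed X x).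
Proof.
apply: measurable_sum => i.
have -> : (fun X : n.-tuple (measurableTypeR R) => (x < tnth X i)%R%:R : R) =
  (\1_(`]x, +oo[%classic) : R -> R) \o (fun X => tnth X i).
  by apply/funext => X /=; rewrite indicE mem_setE in_itv/= andbT.
apply: measurableT_comp; last exact: measurable_tnth.
exact: measurable_indic.
Qed.

Lemma lsm_Nyc F x : lebesgue_stieltjes_measure F `]-oo, x]%classic = (F x)%:E.
Proof. by rewrite -cdf_lebesgue_stieltjes_id. Qed.

Lemma lsm_oy F x : lebesgue_stieltjes_measure F `]x, +oo[%classic = (1 - F x)%:E.
Proof.
rewrite -setCitvl probability_setC//.
by rewrite EFinB -lsm_Nyc.
Qed.

Lemma dfun_ge0 F x : 0 <= F x.
Proof. by rewrite -lee_fin -lsm_Nyc measure_ge0. Qed.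

Lemma dfun_le1 F x : F x <= 1.
Proof. by rewrite -lee_fin -lsm_Nyc probability_le1. Qed.

End exceedance_count.

Section iid_integral.
Context d (T : measurableType d) (R : realType) (P : probability T R).
Local Open Scope ereal_scope.

(** Independence in the form that Chernoff bounds use: it factors the Laplace transform of [exceed].
    The induction peels off the first coordinate with Tonelli, so the law of the count is never
    identified. *)
Lemma iid_law_integral_prod n (g : T -> R) : measurable_fun setT g ->
  (forall x, (0 <= g x)%R) ->
  \int[iid_law P n]_X (\prod_(k < n) g (tnth X k))%R%:E =
  (\int[P]_x (g x)%:E) ^+ n.
Proof.
move=> mg g0; elim: n => [|n IH].
  rewrite expe0.
  under eq_integral do rewrite big_ord0.
  by rewrite integral_cst//= diracT mul1e.
have mprod m : measurable_fun [set: m.-tuple T]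
    (fun X : m.-tuple T => (\prod_(k < m) g (tnth X k))%R).
  apply: measurable_prod => i _.
  by apply: measurableT_comp => //; exact: measurable_tnth.
rewrite expeS /= /distribution ge0_integral_pushforward//; last 2 first.
  by have /measurable_EFinP := mprod n.+1.
  by move=> X _; rewrite lee_fin prodr_ge0.
rewrite preimage_setT /comp.
under eq_integral => z _.
  rewrite big_ord_recl /=.
  rewrite (_ : tnth _ ord0 = z.1)//.
  under eq_bigr => i _ do rewrite tnthS.
  over.
rewrite fubini_tonelli1//=; last 2 first.
- have m2 := measurableT_comp (mprod n)
    (measurable_snd : measurable_fun [set: T * n.-tuple T] snd).
  have m1 := measurableT_comp mg
    (measurable_fst : measurable_fun [set: T * n.-tuple T] fst).
  by have /measurable_EFinP := measurable_funM m1 m2.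
- by move=> z; rewrite lee_fin mulr_ge0// prodr_ge0.
rewrite /fubini_F /=.
under eq_integral => x _.
  under eq_integral => y _ do rewrite EFinM.
  rewrite ge0_integralZl//; last first.
  - by rewrite lee_fin.
  - by move=> y _; rewrite lee_fin prodr_ge0.
  - by have /measurable_EFinP := mprod n.
  rewrite IH.
  over.
rewrite ge0_integralZr//.
- by have /measurable_EFinP := mg.
- by move=> y _; rewrite lee_fin.
- by rewrite -IH; apply: integral_ge0 => X _; rewrite lee_fin prodr_ge0.
Qed.

End iid_integral.

(** * Chernoff bounds for the counts *)

Section binomial_tails.
Context {R : realType}.
Implicit Types (F : @distribution_function R) (x q : R) (n : nat).

Lemma integral_expR_step F x (l : R) :
  (\int[lebesgue_stieltjes_measure F]_y
     (expR (l * (x < y)%R%:R))%:E)%E = (1 + (1 - F x) * (expR l - 1))%:E.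
Proof.
set mu := lebesgue_stieltjes_measure F.
pose A : set (measurableTypeR R) := `]x, +oo[%classic.
pose B : set (measurableTypeR R) := `]-oo, x]%classic.
have mA : measurable A by exact: measurable_itv.
have mB : measurable B by exact: measurable_itv.
under eq_integral => y _.
  rewrite (_ : expR _ = expR l * \1_A y + \1_B y); last first.
    rewrite !indicE !mem_setE !in_itv/= andbT.
    by case: ltP => _; rewrite ?mulr1 ?mulr0 ?expR0 ?addr0 ?add0r.
  rewrite EFinD EFinM.
  over.
have mfA : measurable_fun setT (EFin \o (\1_A : measurableTypeR R -> R)).
  exact/measurable_EFinP/measurable_indic.
have mfB : measurable_fun setT (EFin \o (\1_B : measurableTypeR R -> R)).
  exact/measurable_EFinP/measurable_indic.
rewrite ge0_integralD//; last exact: measurable_funeM.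
rewrite ge0_integralZl//.
rewrite !integral_indic// !setIT.
rewrite (_ : _ A = (1 - F x)%:E); last exact: lsm_oy.
rewrite (_ : _ B = (F x)%:E); last exact: lsm_Nyc.
rewrite -EFinM -EFinD; congr EFin.
by ring.
Qed.

(** Markov's inequality for [expR (l * exceed X x)], followed by [1 + y <= expR y]. The sign of [l]
    is left free, so that both tails come from this one bound. *)
Lemma binomial_exp_markov F n x (l a : R) :
  (sample_prob F n [set X | (l * a <= l * exceed X x)%R] <=
   (expR (n%:R * (1 - F x) * (expR l - 1) - l * a))%:E)%E.
Proof.
set P := lebesgue_stieltjes_measure F.
pose g (X : n.-tuple (measurableTypeR R)) : \bar R := (expR (l * exceed X x))%:E.
have mg : measurable_fun setT g.
  apply/measurable_EFinP; apply: measurableT_comp => //.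
  by apply: measurable_funM => //; exact: measurable_exceed.
have mg1 : measurable_fun setT
    (fun y : measurableTypeR R => expR (l * (x < y)%R%:R) : R).
  apply: measurableT_comp => //; apply: measurable_funM => //.
  rewrite (_ : (fun y => _) = \1_(`]x, +oo[%classic : set (measurableTypeR R))); last first.
    by apply/funext => y; rewrite indicE mem_setE in_itv/= andbT.
  exact: measurable_indic.
have Eg : (\int[sample_prob F n]_X g X)%E =
    ((1 + (1 - F x) * (expR l - 1)) ^+ n)%:E.
  under eq_integral => X _.
    rewrite /g /exceed mulr_sumr expR_sum.
    over.
  rewrite (iid_law_integral_prod P n mg1); last by move=> y; exact: expR_ge0.
  by rewrite integral_expR_step EFin_expe.
have := @le_integral_comp_abse _ _ _ (sample_prob F n) setT measurableT g
  (expR (l * a)) id (@measurable_id _ _ _) (fun r r0 => r0)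
  (fun _ _ _ _ => id) mg (expR_gt0 _).
rewrite setTI.
have -> : [set X | ((expR (l * a))%:E <= `|g X|)%E] =
    [set X | l * a <= l * exceed X x].
  apply/seteqP; split => X /=.
    by rewrite lee_fin ger0_norm ?expR_ge0// ler_expR.
  by rewrite lee_fin ger0_norm ?expR_ge0// ler_expR.
under eq_integral => X _ do rewrite gee0_abs ?lee_fin ?expR_ge0//.
rewrite Eg => H.
rewrite expRD expRN [X in (_ <= X%:E)%E]mulrC EFinM lee_pdivlMl ?expR_gt0//.
apply: le_trans H _; rewrite lee_fin.
rewrite -mulrA expRM_natl lerXn2r ?nnegrE ?expR_ge0 ?expR_ge1Dx//.
have := dfun_ge0 F x; have := dfun_le1 F x; have := expR_gt0 l.
by move: (F x) (expR l) => f e; nra.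
Qed.

(** From [expR t <= 1 / (1 - t)], since the right-hand side times [1 - t] is
    [1 + t^2 - 2 * t^3 >= 1]. The argument may be negative, as in the lower tail. *)
Lemma expR_le_quadratic (t : R) : t <= 1 / 2 -> expR t <= 1 + t + 2 * t ^+ 2.
Proof.
move=> t2; have t1 : 0 < 1 - t by lra.
have : expR (- t) >= 1 - t by have := expR_ge1Dx (- t).
rewrite expRN => H.
have : expR t <= (1 - t)^-1 by rewrite -[expR t]invrK lef_pV2// posrE ?invr_gt0 ?expR_gt0.
move=> /le_trans; apply; rewrite -div1r ler_pdivrMr//.
nra.
Qed.

Lemma measurable_exceed_ge n x (k : R) :
  measurable [set X : n.-tuple (measurableTypeR R) | k <= exceed X x].
Proof.
have := @measurable_exceed R n x measurableT _ (measurable_itv `[k, +oo[).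
rewrite setTI; congr measurable; apply/seteqP; split => X /=;
  by rewrite in_itv/= andbT.
Qed.

Lemma measurable_exceed_le n x (k : R) :
  measurable [set X : n.-tuple (measurableTypeR R) | exceed X x <= k].
Proof.
have := @measurable_exceed R n x measurableT _ (measurable_itv `]-oo, k]).
by rewrite setTI.
Qed.

Let measurable_exceedM n x (l a : R) :
  measurable [set X : n.-tuple (measurableTypeR R) | l * a <= l * exceed X x].
Proof.
have mf : measurable_fun setT (fun X : n.-tuple (measurableTypeR R) =>
    l * exceed X x).
  by apply: measurable_funM => //; exact: measurable_exceed.
have := mf measurableT _ (measurable_itv `[l * a, +oo[).
rewrite setTI; congr measurable; apply/seteqP; split => X /=;
  by rewrite in_itv/= andbT.
Qed.

(** [v] is any bound for the mean. The exponent [t = s / (4 * v)] minimises [2 * v * t^2 - t * s],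
    with value [- s^2 / (8 * v)]; [s <= v] keeps [t] in the range of the quadratic bound. *)
Lemma binomial_upper_tail F n x (k v s : R) :
  0 < v -> 0 <= s -> s <= v -> n%:R * (1 - F x) <= v ->
  n%:R * (1 - F x) + s <= k ->
  (sample_prob F n [set X | (k <= exceed X x)%R] <=
   (expR (- (s ^+ 2 / (8 * v))))%:E)%E.
Proof.
move=> v0 s0 sv pv ks; pose t := s / (4 * v).
have tE : t * (4 * v) = s by rewrite /t divfK//; lra.
have t0 : 0 <= t by rewrite divr_ge0//; lra.
apply: (@le_trans _ _ (sample_prob F n [set X | (t * k <= t * exceed X x)%R])).
  apply: le_measure; rewrite ?inE.
  - exact: measurable_exceed_ge.
  - exact: measurable_exceedM.
  - by move=> X /= kX; rewrite ler_wpM2l.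
apply: le_trans (binomial_exp_markov _ _ _ _ _) _.
rewrite lee_fin ler_expR.
have -> : s ^+ 2 / (8 * v) = 2 * v * t ^+ 2.
  by rewrite -tE; field; lra.
have t2 : t <= 1 / 2 by rewrite ler_pdivrMr; lra.
have Q := expR_le_quadratic t2.
have p0 : 0 <= n%:R * (1 - F x).
  by rewrite mulr_ge0// subr_ge0 dfun_le1.
move: (n%:R * (1 - F x)) p0 pv ks => p p0 pv ks.
have : p * (expR t - 1) <= p * (t + 2 * t ^+ 2) by apply: ler_wpM2l => //; lra.
have : p * t ^+ 2 <= v * t ^+ 2 by apply: ler_wpM2r => //; rewrite sqr_ge0.
have : t * (p + s) <= t * k by apply: ler_wpM2l.
nra.
Qed.

(** The bound involves [k + s], a lower bound of the mean, and not the mean itself: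
    [- t + 2 * t^2 <= 0] for [0 <= t <= 1 / 2], so a larger mean only helps. For negative [k] the
    event is empty. *)
Lemma binomial_lower_tail F n x (k s : R) :
  0 <= s -> 0 < k + s -> k + s <= n%:R * (1 - F x) ->
  (sample_prob F n [set X | (exceed X x <= k)%R] <=
   (expR (- (s ^+ 2 / (8 * (k + s)))))%:E)%E.
Proof.
move=> s0 v0 ks; have [k0|k0] := ltP k 0.
  rewrite (_ : [set X | _] = set0) ?measure0 ?lee_fin ?expR_ge0//.
  apply/seteqP; split => // X /= Xk; have := exceed_ge0 X x; lra.
set v := k + s in v0 ks *; pose t := s / (4 * v).
have tE : t * (4 * v) = s by rewrite /t divfK//; lra.
have t0 : 0 <= t by rewrite divr_ge0//; lra.
apply: (@le_trans _ _ (sample_prob F n [set X | (- t * k <= - t * exceed X x)%R])).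
  apply: le_measure; rewrite ?inE.
  - exact: measurable_exceed_le.
  - exact: measurable_exceedM.
  - by move=> X /= kX; rewrite !mulNr lerN2 ler_wpM2l.
apply: le_trans (binomial_exp_markov _ _ _ _ _) _.
rewrite lee_fin ler_expR.
have -> : s ^+ 2 / (8 * v) = 2 * v * t ^+ 2.
  by rewrite -tE; field; lra.
have sv : s <= 2 * v by rewrite /v; lra.
have t2 : t <= 1 / 2 by rewrite ler_pdivrMr; lra.
have /expR_le_quadratic Q : - t <= 1 / 2 by lra.
have kE : k = v - s by rewrite /v addrK.
move: (n%:R * (1 - F x)) ks => p ks.
have p0 : 0 <= p by lra.
have : p * (expR (- t) - 1) <= p * (- t + 2 * t ^+ 2).
  by apply: ler_wpM2l => //; rewrite sqrrN in Q; lra.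
have : p * (t - 2 * t ^+ 2) >= v * (t - 2 * t ^+ 2).
  apply: ler_wpM2r => //.
  have : 0 <= t * (1 - 2 * t) by rewrite mulr_ge0//; lra.
  by rewrite expr2; lra.
rewrite kE; nra.
Qed.

End binomial_tails.

(** * Threshold conditions on the counts *)

Section acceptance_conditions.
Context {R : realType}.
Implicit Types (F : @distribution_function R) (x q k p : R) (n : nat).

(* The alternative exceed X x = n is the empirical counterpart of F x = 0,
   where the class gives no constraint. *)
Definition upper_ok n (X : n.-tuple R) q k :=
  forall x, q <= x -> exceed X x = n%:R \/ exceed X x < k.

Definition lower_ok n (X : n.-tuple R) q k :=
  exceed X q = n%:R \/ k < exceed X q.

Lemma measurable_exceed_lt n x k :
  measurable [set X : n.-tuple (measurableTypeR R) | exceed X x < k].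
Proof.
have := @measurable_exceed R n x measurableT _ (measurable_itv `]-oo, k[).
by rewrite setTI.
Qed.

Lemma measurable_exceed_gt n x k :
  measurable [set X : n.-tuple (measurableTypeR R) | k < exceed X x].
Proof.
have := @measurable_exceed R n x measurableT _ (measurable_itv `]k, +oo[).
rewrite setTI; congr measurable; apply/seteqP; split => X /=;
  by rewrite in_itv/= andbT.
Qed.

Lemma measurable_exceed_eq n x k :
  measurable [set X : n.-tuple (measurableTypeR R) | exceed X x = k].
Proof.
have := @measurable_exceed R n x measurableT _ (measurable_set1 k).
by rewrite setTI.
Qed.

Lemma measurable_exceed_dev n x p k :
  measurable [set X : n.-tuple (measurableTypeR R) | k < `|exceed X x - p|].
Proof.
have mf : measurable_fun setT (fun X : n.-tuple (measurableTypeR R) =>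
    `|exceed X x - p|).
  apply: measurableT_comp => //; apply: measurable_funB => //.
  exact: measurable_exceed.
have := mf measurableT _ (measurable_itv `]k, +oo[).
rewrite setTI; congr measurable; apply/seteqP; split => X /=;
  by rewrite in_itv/= andbT.
Qed.

(** The count at [x] is also the count at rationals slightly above [x]. This turns an uncountable
    intersection into a countable one, hence measurability. *)
Lemma upper_ok_ratr n (X : n.-tuple R) q k :
  upper_ok X q k <-> (forall r : rat, q <= ratr r ->
    exceed X (ratr r) = n%:R \/ exceed X (ratr r) < k).
Proof.
split=> [H r /H//|H x qx].
have [e /= e0 He] := exceed_near_right X x.
have /rat_in_itvoo[r] : x < x + e by rewrite ltrDl.
rewrite in_itv/= => /andP[xr re].
rewrite -(He (ratr r))//=; first by apply: H; rewrite (le_trans qx)// ltW.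
by rewrite ltr0_norm ?subr_lt0//; lra.
Qed.

Lemma measurable_upper_ok n q k :
  measurable [set X : n.-tuple (measurableTypeR R) | upper_ok X q k].
Proof.
rewrite (_ : [set X | _] = ~` (\bigcup_(r : rat) ~` [set X | q <= ratr r ->
    exceed X (ratr r) = n%:R \/ exceed X (ratr r) < k])).
  apply: measurableC; apply: bigcupT_measurable_rat => r; apply: measurableC.
  have [qr|qr] := boolP (q <= ratr r).
    rewrite (_ : [set X | _] =
      ([set X | exceed X (ratr r) = n%:R] `|` [set X | exceed X (ratr r) < k])).
      by apply: measurableU; [exact: measurable_exceed_eq|exact: measurable_exceed_lt].
    by apply/seteqP; split => X /= H; [exact: H|move=> _].
  rewrite (_ : [set X | _] = setT)//.
  by apply/seteqP; split => X.
rewrite setC_bigcup; apply/seteqP; split => X /=.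
  by move=> /upper_ok_ratr H r _ /=; apply; exact: H.
by move=> H; apply/upper_ok_ratr => r; exact: contrapT (H r I).
Qed.

Lemma measurable_lower_ok n q k :
  measurable [set X : n.-tuple (measurableTypeR R) | lower_ok X q k].
Proof.
by apply: measurableU; [exact: measurable_exceed_eq|exact: measurable_exceed_gt].
Qed.

Lemma exceed_all_prob F n x :
  sample_prob F n [set X | exceed X x = n%:R] = ((1 - F x) ^+ n)%:E.
Proof.
have -> : [set X : n.-tuple (measurableTypeR R) | exceed X x = n%:R] =
    [set X | forall i, (`]x, +oo[%classic : set (measurableTypeR R)) (tnth X i)].
  apply/seteqP; split => X /=.
    by move/exceed_all => H i; rewrite in_itv/= H.
  by move=> H; apply/exceed_all => i; have := H i; rewrite in_itv/= andbT.
rewrite /sample_prob (iid_law_box (A := fun=> `]x, +oo[%classic)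
  (lebesgue_stieltjes_measure F))//.
transitivity (\prod_(i < n) (1 - F x)%:E)%E.
  by apply: eq_bigr => i _; exact: lsm_oy.
by rewrite prodEFin prodr_const card_ord.
Qed.

Lemma exceed_all_null1 F n x : F x = 0 ->
  sample_prob F n [set X | exceed X x != n%:R] = 0%E.
Proof.
move=> Fx; have -> : [set X : n.-tuple (measurableTypeR R) | exceed X x != n%:R] =
    ~` [set X | exceed X x = n%:R].
  by apply/seteqP; split => X /= /eqP.
rewrite probability_setC; last exact: measurable_exceed_eq.
by rewrite exceed_all_prob Fx subr0 expr1n subee.
Qed.

(** Left of the support all observations exceed [x] almost surely, for all such [x] at once: the
    room between [x] and [y] holds a rational, which leaves countably many null events. *)
Lemma exceed_all_null F n : (sample_prob F n).-negligible
  [set X | exists x y, [/\ x < y, F y = 0 & exceed X x != n%:R]].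
Proof.
pose Z (r : rat) : set (n.-tuple (measurableTypeR R)) :=
  if F (ratr r) == 0 then [set X | exceed X (ratr r) != n%:R] else set0.
(* The rationals are enumerated by [unpickle]; the default [0], for codes of no rational, only
   repeats a set of the family. *)
apply: (@negligibleS _ _ _ _ (\bigcup_k Z (odflt 0 (unpickle k)))).
  move=> X [x [y [/rat_in_itvoo[r]]]]; rewrite in_itv/= => /andP[xr ry] Fy Xx.
  exists (pickle r); first by [].
  rewrite /Z pickleK [odflt _ _]/=.
  have -> : F (ratr r) = 0.
    have rle : F (ratr r) <= F y.
      by apply: cumulative_is_nondecreasing; exact: ltW.
    by apply/eqP; rewrite eq_le dfun_ge0 andbT (le_trans rle)// Fy.
  rewrite eqxx/= lt_eqF// (le_lt_trans (exceed_le _ (ltW xr)))//.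
  by rewrite lt_neqAle Xx exceed_max.
apply: negligible_bigcup => k; rewrite /Z; case: eqP => [Fr|_]; last exact: negligible_set0.
apply/negligibleP; last exact: exceed_all_null1.
rewrite (_ : [set X | _] = ~` [set X | exceed X (ratr (odflt 0 (unpickle k))) = n%:R]).
  by apply: measurableC; exact: measurable_exceed_eq.
by apply/seteqP; split => X /= /eqP.
Qed.

(** Uniformity over [x >= q] costs nothing: with [z] the infimum of the points beyond [q] where [F]
    is positive, right continuity carries the bound [p] to [z], counts beyond [z] are at most the
    count at [z], and before [z] the function [F] vanishes, so that almost surely the count is
    [n]. *)
Lemma upper_ok_prob F n q (p v s k : R) :
  (forall x, q <= x -> 0 < F x -> 1 - F x <= p) ->
  0 < v -> 0 <= s -> s <= v -> n%:R * p <= v -> n%:R * p + s <= k ->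
  (sample_prob F n (~` [set X | upper_ok X q k]) <=
    (expR (- (s ^+ 2 / (8 * v))))%:E)%E.
Proof.
move=> Hp v0 s0 sv pv pk.
pose A := [set x | q <= x /\ 0 < F x]; pose z := inf A.
have A0 : A !=set0.
  have : \forall x \near (+oo : set_system R), q <= x /\ 0 < F x.
    apply: filterI; first exact: nbhs_pinfty_ge (num_real _).
    exact: (cvgr_gt 1 (cumulativey F)).
  by move=> /filter_ex[x Ax]; exists x.
have Alb : has_inf A by split => //; exists q => x [].
have zA y : z < y -> A y.
  move=> /(inf_lt A0)[x [qx Fx] xy]; split; first by rewrite (le_trans qx)// ltW.
  by rewrite (lt_le_trans Fx)//; apply: cumulative_is_nondecreasing; exact: ltW.
have zNA y : q <= y -> y < z -> F y = 0.
  move=> qy yz; apply/eqP; rewrite eq_le dfun_ge0 andbT leNgt; apply/negP => Fy.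
  by move: yz; rewrite ltNge => /negP; apply; apply: ge_inf => //; exact: Alb.2.
have zp : 1 - F z <= p.
  have cF := @cumulative_is_right_continuous _ _ _ F z.
  rewrite lerBlDr -lerBlDl; apply: (cvgr_to_ge cF).
  have := nbhs_right_gt z; apply: filterS => y /zA[qy Fy].
  by rewrite lerBlDr -lerBlDl Hp.
have [N [mN N0 HN]] := exceed_all_null F n.
pose E := [set X : n.-tuple (measurableTypeR R) | k <= exceed X z].
have mE : measurable E by exact: measurable_exceed_ge.
apply: (@le_trans _ _ (sample_prob F n (E `|` N))).
  apply: le_measure; rewrite ?inE.
  - by apply: measurableC; exact: measurable_upper_ok.
  - exact: measurableU.
  move=> X /=; rewrite /upper_ok => /existsNP[x] /not_implyP[qx] /not_orP[/eqP Nn].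
  move=> /negP; rewrite -leNgt => kN.
  have [zx|xz] := leP z x.
    by left; rewrite /E/= (le_trans kN)// exceed_le.
  right; apply: HN => /=; exists x, ((x + z) / 2); split => //; first by lra.
  by apply: zNA; lra.
apply: le_trans (measureU2 _ mE mN) _.
move: N0 => /= ->; rewrite adde0.
have nz : n%:R * (1 - F z) <= n%:R * p by rewrite ler_wpM2l.
apply: binomial_upper_tail => //; first exact: le_trans pv.
by apply: le_trans pk; rewrite lerD2r.
Qed.

(** If [F q = 0], the sample lies beyond [q] almost surely and the first alternative of [lower_ok]
    holds; otherwise this is the lower Chernoff bound. *)
Lemma lower_ok_prob F n q (p s k : R) :
  (0 < F q -> p <= 1 - F q) ->
  0 <= s -> 0 < k + s -> k + s <= n%:R * p ->
  (sample_prob F n (~` [set X | lower_ok X q k]) <=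
    (expR (- (s ^+ 2 / (8 * (k + s)))))%:E)%E.
Proof.
move=> Hp s0 ks0 ksp; have [Fq|Fq] := ltP 0 (F q).
  apply: (@le_trans _ _ (sample_prob F n [set X | (exceed X q <= k)%R])); last first.
    by apply: binomial_lower_tail => //; rewrite (le_trans ksp)// ler_wpM2l// Hp.
  apply: le_measure; rewrite ?inE.
  - by apply: measurableC; exact: measurable_lower_ok.
  - exact: measurable_exceed_le.
  by move=> X /=; rewrite /lower_ok => /not_orP[_] /negP; rewrite -leNgt.
have F0 : F q = 0 by apply/eqP; rewrite eq_le Fq dfun_ge0.
apply: (@le_trans _ _ 0%E); last by rewrite lee_fin expR_ge0.
rewrite -(exceed_all_null1 n F0); apply: le_measure; rewrite ?inE.
- by apply: measurableC; exact: measurable_lower_ok.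
- rewrite (_ : [set X | _] = ~` [set X | exceed X q = n%:R]).
    by apply: measurableC; exact: measurable_exceed_eq.
  by apply/seteqP; split => X /= /eqP.
- by move=> X /=; rewrite /lower_ok => /not_orP[/eqP].
Qed.

End acceptance_conditions.

(** * Projection on a Pareto class *)

Section limits.
Context {R : realType}.

Lemma exists_distribution_function (g : R -> R) :
  {homo g : x y / x <= y} -> (forall x, g y @[y --> x^'+] --> g x) ->
  g @ -oo --> (0 : R) -> g @ +oo --> (1 : R) ->
  exists F : @distribution_function R, F = g :> (R -> R).
Proof.
move=> nd rc ny y1.
pose G : @distribution_function R := HB.pack g
  (isCumulative.Build R _ R g nd rc) (isCumulativeBounded.Build R 0 1 g ny y1).
by exists G.
Qed.

Lemma cvg_minr {T} (D : set_system T) {FD : Filter D} (f g : T -> R) (a b : R) :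
  f @ D --> a -> g @ D --> b -> Num.min (f x) (g x) @[x --> D] --> Num.min a b.
Proof.
move=> fa gb; under eq_fun do rewrite minr_absE.
rewrite minr_absE; apply: cvgMr_tmp; apply: cvgB; first exact: cvgD.
by apply: cvg_norm; exact: cvgB.
Qed.

Lemma cvg_maxr {T} (D : set_system T) {FD : Filter D} (f g : T -> R) (a b : R) :
  f @ D --> a -> g @ D --> b -> Num.max (f x) (g x) @[x --> D] --> Num.max a b.
Proof.
move=> fa gb; under eq_fun do rewrite maxr_absE.
rewrite maxr_absE; apply: cvgMr_tmp; apply: cvgD; first exact: cvgD.
by apply: cvg_norm; exact: cvgB.
Qed.

Lemma continuous_powRl (s x : R) : 0 < x -> {for x, continuous (fun y => y `^ s)}.
Proof.
move=> x0; have H : expR (s * ln y) @[y --> x] --> expR (s * ln x).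
  apply: (@cvg_comp _ _ _ (fun y => s * ln y) expR); last exact: continuous_expR.
  by apply: cvgMl_tmp; exact: continuous_ln.
have E y : 0 < y -> y `^ s = expR (s * ln y) by move=> y0; rewrite /powR gt_eqF.
suff : y `^ s @[y --> x] --> x `^ s by [].
rewrite (E x)//; apply: cvg_trans H; apply: near_eq_cvg.
by have := lt_nbhsr x0; apply: filterS => y /E ->.
Qed.

(** Convexity of the power function, obtained from Young's inequality for [v / w] and [1] with
    conjugate exponents [a] and [a / (a - 1)]. *)
Lemma powR_tangent (v w a : R) : 1 < a -> 0 < v -> 0 < w ->
  w `^ a + a * w `^ (a - 1) * (v - w) <= v `^ a.
Proof.
move=> a1 v0 w0.
have a0 : 0 < a by lra.
have vw : 0 <= v / w by rewrite divr_ge0// ltW.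
have := @conjugate_powR R (v / w) 1 a (a / (a - 1)) vw ler01 a0.
have -> : (a / (a - 1))^-1 = 1 - a^-1 by field; lra.
have q0 : 0 < a / (a - 1) by rewrite divr_gt0//; lra.
move=> /(_ q0); rewrite addrC subrK => /(_ erefl).
rewrite powR1 /= mulr1 mul1r.
rewrite -[_ / a]mulrC => H.
have {}H : a * (v / w) <= (v / w) `^ a + a - 1.
  have : a * (v / w) <= a * (a^-1 * (v / w) `^ a + (1 - a^-1)) by rewrite ler_pM2l.
  by move=> /le_trans; apply; rewrite le_eqVlt; apply/orP; left; apply/eqP; field; lra.
have wa : w `^ a = w * w `^ (a - 1) by rewrite mulr_powRB1// ltW.
have vE : v `^ a = (v / w) `^ a * w `^ a.
  by rewrite -powRM ?divfK ?gt_eqF// ltW.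
have P := powR_gt0 a w0; have P1 := powR_gt0 (a - 1) w0.
have : (a * (v / w) - a + 1) * w `^ a <= (v / w) `^ a * w `^ a.
  by apply: ler_wpM2r; [exact: ltW|lra].
rewrite vE => /(le_trans _); apply.
rewrite le_eqVlt; apply/orP; left; apply/eqP.
by rewrite wa; field; lra.
Qed.

End limits.

(** * Monotone envelopes of the tail *)

Section envelope.
Context {R : realType}.
Context (C C' a : R).
Context (C0 : 0 < C) (C'0 : 0 < C') (a1 : 1 < a).

(* Envelopes of 1 - F as functions of v = x^(-tau). The lower one is made
   nondecreasing by freezing it past the maximiser of C v - C' v^a. *)
Let vm := (C / (C' * a)) `^ (a - 1)^-1.
Definition upper_env (v : R) := C * v + C' * v `^ a.
Definition lower_env (v : R) := C * Num.min v vm - C' * (Num.min v vm) `^ a.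

Let a0 : 0 < a. Proof. exact: lt_trans a1. Qed.
Let Ca : 0 < C / (C' * a). Proof. by rewrite divr_gt0// mulr_gt0. Qed.
Let vm0 : 0 < vm. Proof. exact: powR_gt0. Qed.

Let vmE : C' * (a * vm `^ (a - 1)) = C.
Proof.
rewrite /vm -powRrM mulVf ?subr_eq0 ?gt_eqF// powRr1 1?ltW// mulrA mulrC divfK//.
by rewrite gt_eqF// mulr_gt0.
Qed.

(** The graph lies below its tangent at [w]. By [vmE] the slope vanishes at [w = vm], which is
    therefore the maximiser, and it is nonnegative before [vm]. *)
Let concave (v w : R) : 0 < v -> 0 < w ->
  C * v - C' * v `^ a <= C * w - C' * w `^ a + (C - C' * (a * w `^ (a - 1))) * (v - w).
Proof.
move=> v0 w0; have := powR_tangent a1 v0 w0; rewrite -(ler_pM2l C'0).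
by lra.
Qed.

Lemma lower_env_le v w : 0 < v -> v <= w -> lower_env v <= lower_env w.
Proof.
move=> v0 vw; rewrite /lower_env.
have w0 : 0 < w by exact: lt_le_trans vw.
have mw0 : 0 < Num.min w vm by rewrite lt_min w0.
have mv0 : 0 < Num.min v vm by rewrite lt_min v0.
have mvw : Num.min v vm <= Num.min w vm by rewrite le_min !ge_min vw lexx orbT.
have mwm : Num.min w vm <= vm by rewrite ge_min lexx orbT.
apply: le_trans (concave mv0 mw0) _; rewrite gerDl mulr_ge0_le0 ?subr_le0//.
rewrite subr_ge0 -[leRHS]vmE ler_pM2l// ler_pM2l// ge0_ler_powR ?nnegrE ?(ltW mw0) ?(ltW vm0)//.
by rewrite subr_ge0 ltW.
Qed.

Lemma ge_lower_env v : 0 < v -> C * v - C' * v `^ a <= lower_env v.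
Proof.
move=> v0; rewrite /lower_env; case: (leP v vm) => // vmv.
by apply: le_trans (concave v0 vm0) _; rewrite vmE subrr mul0r addr0.
Qed.

Lemma lower_env_ge0 v : 0 < v -> 0 <= lower_env v.
Proof.
move=> v0; rewrite /lower_env.
have m0 : 0 < Num.min v vm by rewrite lt_min v0.
have mm : Num.min v vm <= vm by rewrite ge_min lexx orbT.
have := mulr_powRB1 (ltW m0) a0.
set m := Num.min v vm in m0 mm * => <-.
rewrite mulrCA [C * m]mulrC -mulrBr mulr_ge0 ?(ltW m0)// subr_ge0.
rewrite -[leRHS]vmE ler_pM2l//.
apply: (@le_trans _ _ (vm `^ (a - 1))).
  by apply: ge0_ler_powR => //; rewrite ?nnegrE ?subr_ge0; exact: ltW.
by rewrite ler_peMl ?powR_ge0// ltW.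
Qed.

Lemma upper_env_le v w : 0 < v -> v <= w -> upper_env v <= upper_env w.
Proof.
move=> v0 vw; rewrite /upper_env lerD// ler_pM2l//.
by rewrite ge0_ler_powR ?nnegrE ?(ltW a0) ?(ltW v0)// (le_trans (ltW v0)).
Qed.

Lemma lower_upper_env v : 0 < v -> lower_env v <= upper_env v.
Proof.
move=> v0; rewrite /lower_env /upper_env.
apply: (@le_trans _ _ (C * v)).
  by rewrite lerBlDr ler_wpDr ?mulr_ge0 ?powR_ge0 ?(ltW C'0)// ler_pM2l// ge_min lexx.
by rewrite lerDl mulr_ge0 ?powR_ge0 ?(ltW C'0).
Qed.

(** Freezing creates no new values: past [vm] the envelope repeats its value at [vm]. A bound known
    for the unfrozen curve at a farther point of the line can thus be used at the nearer one. *)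
Lemma lower_env_witness v : 0 < v ->
  exists w, [/\ 0 < w, w <= v & lower_env v = C * w - C' * w `^ a].
Proof.
move=> v0; exists (Num.min v vm); split=> //; last by rewrite ge_min lexx.
by rewrite lt_min v0.
Qed.

Lemma cvg_upper_env {T} (D : set_system T) {FD : Filter D} (f : T -> R) (v : R) :
  0 < v -> f @ D --> v -> upper_env (f x) @[x --> D] --> upper_env v.
Proof.
move=> v0 fv; apply: cvgD; apply: cvgMl_tmp => //.
apply: (@cvg_comp _ _ _ f (fun y => y `^ a) _ _ _ fv).
exact: continuous_powRl.
Qed.

Lemma cvg_lower_env {T} (D : set_system T) {FD : Filter D} (f : T -> R) (v : R) :
  0 < v -> f @ D --> v -> lower_env (f x) @[x --> D] --> lower_env v.
Proof.
move=> v0 fv; have mv : Num.min (f x) vm @[x --> D] --> Num.min v vm.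
  by apply: cvg_minr => //; exact: cvg_cst.
apply: cvgB; apply: cvgMl_tmp => //.
apply: (@cvg_comp _ _ _ (fun x => Num.min (f x) vm) (fun y => y `^ a) _ _ _ mv).
by apply: continuous_powRl; rewrite lt_min v0.
Qed.

End envelope.

Section projection.
Context {R : realType}.

(** [P] stands for [F x * x^tau]. As it is nondecreasing, the cut puts [0] on an initial part of the
    line only; its right continuity gives that of the cut. [A] and [B] matter only for positive
    [x]. *)
Lemma exists_clamped (F : @distribution_function R) (P A B : R -> R) (eta : R) :
  {homo P : x y / x <= y} -> (forall x, P y @[y --> x^'+] --> P x) ->
  (forall x, eta <= P x -> 0 < x) -> (\forall x \near +oo, eta <= P x) ->
  (forall x y, 0 < x -> x <= y -> A x <= A y) ->
  (forall x y, 0 < x -> x <= y -> B x <= B y) ->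
  (forall x, 0 < x -> A y @[y --> x^'+] --> A x) ->
  (forall x, 0 < x -> B y @[y --> x^'+] --> B x) ->
  (forall x, 0 < x -> A x <= B x) -> (forall x, 0 < x -> B x <= 1) ->
  A @ +oo --> (1 : R) ->
  exists G : @distribution_function R, forall x, G x =
    if P x < eta then 0 else Num.max 0 (Num.min (B x) (Num.max (A x) (F x))).
Proof.
move=> Pnd Prc P0 Py And Bnd Arc Brc AB B1 Ay.
pose g x := Num.max 0 (Num.min (B x) (Num.max (A x) (F x))).
pose h x := if P x < eta then 0 else g x.
have Fnd x y : x <= y -> F x <= F y by exact: cumulative_is_nondecreasing.
have g0 x : 0 <= g x by rewrite le_max lexx.
have h0 x : x <= 0 -> h x = 0.
  rewrite /h; case: ltP => // /P0 x0; rewrite leNgt x0//.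
have [||||G GE] := @exists_distribution_function R h; last first.
- by exists G => x; rewrite GE.
- apply: (@squeeze_cvgr _ _ _ _ A (cst 1)) => //; last exact: cvg_cst.
  apply: filterS Py => x Px; rewrite /h ltNge Px/= /g.
  have x0 := P0 _ Px; rewrite le_max le_min AB//= le_max lexx orbT/=.
  by rewrite ge_max ler01 ge_min B1.
- have : (fun=> 0 : R) @ (-oo : set_system R) --> (0 : R) by exact: cvg_cst.
  apply: cvg_trans; apply: near_eq_cvg.
  have : \forall x \near -oo, (x <= 0 :> R) by exact: nbhs_ninfty_le (num_real _).
  by apply: filterS => x /h0 ->.
- move=> x; have [Px|Px] := ltP (P x) eta.
    rewrite {2}/h Px.
    have : (fun=> 0 : R) @ (x^'+ : set_system R) --> (0 : R) by exact: cvg_cst.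
    apply: cvg_trans; apply: near_eq_cvg.
    have PN : \forall y \near x^'+, P y < eta by exact: (cvgr_lt _ (Prc x) _ Px).
    by apply: filterS PN => y Py'; rewrite /h Py'.
  have x0 := P0 _ Px.
  rewrite {2}/h ltNge Px/=.
  have : g y @[y --> x^'+] --> g x.
    apply: cvg_maxr; first exact: cvg_cst.
    apply: cvg_minr; first exact: Brc.
    apply: cvg_maxr; first exact: Arc.
    exact: cumulative_is_right_continuous.
  apply: cvg_trans; apply: near_eq_cvg.
  have := nbhs_right_gt x; apply: filterS => y xy.
  by rewrite /h ltNge (le_trans Px)// Pnd// ltW.
- move=> x y xy; rewrite /h; case: ltP => Px.
    by case: ltP.
  rewrite ltNge (le_trans Px (Pnd _ _ xy))/=.
  have x0 := P0 _ Px.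
  have M : Num.max (A x) (F x) <= Num.max (A y) (F y).
    by rewrite ge_max !le_max (And _ _ x0 xy) (Fnd _ _ xy) !orbT.
  have m : Num.min (B x) (Num.max (A x) (F x)) <= Num.min (B y) (Num.max (A y) (F y)).
    by rewrite le_min !ge_min (Bnd _ _ x0 xy) M !orbT.
  by rewrite /g ge_max !le_max lexx m orbT.
Qed.

(** Clamping [F] between the monotone envelopes gives [G]. Where the cut is inactive, [F] leaves the
    envelopes by at most [eta * y^(-tau)], which the weight [y^tau] turns into [eta]. *)
Lemma exists_class_near (F : @distribution_function R) (tau beta C C' eta : R) :
  0 < tau -> 0 < beta -> 0 < C -> 0 < C' -> 0 < eta -> on_nonneg_reals F ->
  (forall y, 0 < y -> eta <= F y * y `^ tau ->
    `|1 - F y - C * y `^ (- tau)| <=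
      C' * y `^ (- (tau * (beta + 1))) + eta * y `^ (- tau)) ->
  exists G, pareto_class tau beta C C' G /\ (tail_dist tau F G <= eta%:E)%E.
Proof.
move=> t0 b0 C0 C'0 e0 F0 H; pose a := beta + 1.
have a1 : 1 < a by rewrite /a ltrDr.
pose v y : R := y `^ (- tau).
have v0 y : 0 < y -> 0 < v y by exact: powR_gt0.
have vlt x y : 0 < x -> x < y -> v y < v x.
  move=> x0 xy; have y0 : 0 < y by exact: lt_trans xy.
  rewrite /v !powRN ltf_pV2 ?posrE ?powR_gt0//.
  by apply: gt0_ltr_powR; rewrite ?nnegrE ?ltW.
have vle x y : 0 < x -> x <= y -> v y <= v x.
  by move=> x0; rewrite le_eqVlt => /orP[/eqP ->//|xy]; apply/ltW/vlt.
have va y : y `^ (- (tau * (beta + 1))) = (v y) `^ a by rewrite -mulNr powRrM.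
have vt y : 0 < y -> v y * y `^ tau = 1.
  by move=> y0; rewrite /v powRN mulVf// gt_eqF// powR_gt0.
have vc x : 0 < x -> v y @[y --> x^'+] --> v x.
  move=> x0; apply: cvg_within_filter; exact: continuous_powRl.
have Fnd x y : x <= y -> F x <= F y by exact: cumulative_is_nondecreasing.
pose P x := F x * x `^ tau.
have Pnd x y : x <= y -> P x <= P y.
  move=> xy; have [x0|x0] := ltP x 0.
    by rewrite /P F0// mul0r mulr_ge0 ?dfun_ge0 ?powR_ge0.
  rewrite /P ler_pM ?dfun_ge0 ?powR_ge0 ?Fnd//.
  by rewrite ge0_ler_powR ?nnegrE ?(ltW t0)// (le_trans x0).
have Pgt0 x : eta <= P x -> 0 < x.
  rewrite ltNge; apply: contraPN; rewrite le_eqVlt => /orP[/eqP ->|x0].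
    by rewrite /P powR0 ?gt_eqF// mulr0 => /(lt_le_trans e0); rewrite ltxx.
  by rewrite /P F0// mul0r => /(lt_le_trans e0); rewrite ltxx.
have Frc x : F y @[y --> x^'+] --> F x by exact: cumulative_is_right_continuous.
have Prc x : P y @[y --> x^'+] --> P x.
  have [x0|x0|x0] := ltgtP x 0.
  - rewrite {2}/P F0// mul0r.
    have : (fun=> 0 : R) @ (x^'+ : set_system R) --> (0 : R) by exact: cvg_cst.
    apply: cvg_trans; apply: near_eq_cvg.
    by have := nbhs_right_lt x0; apply: filterS => y y0; rewrite /P F0// mul0r.
  - by apply: cvgM => //; apply: cvg_within_filter; exact: continuous_powRl.
  - rewrite x0 /P powR0 ?gt_eqF//; apply: cvgM; first exact: Frc.
    exact: powR_cvg0.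
have Py : \forall x \near +oo, eta <= P x.
  have F2 : \forall x \near +oo, 1 / 2 < F x.
    by apply: (cvgr_gt 1 (cumulativey F)); lra.
  have v2 : \forall x \near +oo, v x < (2 * eta)^-1.
    by apply: (cvgr_lt 0 (powRN_cvg0 t0)); rewrite invr_gt0 mulr_gt0.
  have x0 : \forall x \near +oo, (0 < x :> R) by exact: nbhs_pinfty_gt (num_real _).
  apply: filterS3 F2 v2 x0 => x Fx vx x0.
  have : 2 * eta < x `^ tau.
    move: vx; rewrite /v powRN ltf_pV2 ?posrE ?powR_gt0//.
    by rewrite mulr_gt0.
  by rewrite /P; nra.
have [U [UE Ule Ucv]] : exists U : R -> R,
    [/\ forall x, 0 < x -> U x = upper_env C C' a (v x),
        forall x y, 0 < x -> x <= y -> U y <= U x &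
        forall x, 0 < x -> U y @[y --> x^'+] --> U x].
  exists (fun x => upper_env C C' a (v x)); split=> [x _|x y x0 xy|x x0]; first reflexivity.
    exact: (upper_env_le C0 C'0 a1 (v0 _ (lt_le_trans x0 xy)) (vle _ _ x0 xy)).
  exact: (cvg_upper_env (v0 _ x0) (vc _ x0)).
have [L [LE Lle Lcv]] : exists L : R -> R,
    [/\ forall x, 0 < x -> L x = lower_env C C' a (v x),
        forall x y, 0 < x -> x <= y -> L y <= L x &
        forall x, 0 < x -> L y @[y --> x^'+] --> L x].
  exists (fun x => lower_env C C' a (v x)); split=> [x _|x y x0 xy|x x0]; first reflexivity.
    exact: (lower_env_le C0 C'0 a1 (v0 _ (lt_le_trans x0 xy)) (vle _ _ x0 xy)).
  exact: (cvg_lower_env C0 C'0 a1 (v0 _ x0) (vc _ x0)).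
have LU x : 0 < x -> L x <= U x.
  by move=> x0; rewrite LE// UE//; exact: (lower_upper_env a C0 C'0 (v0 _ x0)).
have L0 x : 0 < x -> 0 <= L x.
  by move=> x0; rewrite LE//; exact: (lower_env_ge0 C0 C'0 a1 (v0 _ x0)).
have Uy : U @ +oo --> (0 : R).
  have : C * v x + C' * x `^ (- (tau * a)) @[x --> +oo] --> (C * 0 + C' * 0 : R).
    by apply: cvgD; apply: cvgMl_tmp; apply: powRN_cvg0 => //; rewrite mulr_gt0// /a; lra.
  rewrite !mulr0 addr0; apply: cvg_trans; apply: near_eq_cvg.
  have : \forall x \near +oo, (0 < x :> R) by exact: nbhs_pinfty_gt (num_real _).
  by apply: filterS => x x0; rewrite UE// /upper_env va.
have Fe y : eta <= P y -> 1 - U y - eta * v y <= F y /\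
    F y <= 1 - L y + eta * v y.
  move=> Py'; have y0 := Pgt0 _ Py'; split.
    have := H _ y0 Py'; rewrite va ler_norml => /andP[_].
    by rewrite UE// /upper_env -/(v y); lra.
  have [w [w0 wv LwE]] := lower_env_witness C0 C'0 a1 (v0 _ y0).
  pose z := w `^ (- tau^-1).
  have z0 : 0 < z by exact: powR_gt0.
  have vz : v z = w.
    by rewrite /v /z -powRrM mulrNN mulVf ?gt_eqF// powRr1// ltW.
  have yz : y <= z.
    rewrite leNgt; apply/negP => zy; have := vlt _ _ z0 zy.
    by rewrite vz ltNge wv.
  have Pz : eta <= P z by apply: le_trans Py' _; exact: Pnd.
  have := H _ z0 Pz; rewrite va ler_norml -/(v z) vz => /andP[+ _].
  have : eta * w <= eta * v y by rewrite ler_pM2l.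
  have := Fnd _ _ yz.
  rewrite LE// LwE; lra.
have [] := @exists_clamped F P (fun x => 1 - U x) (fun x => 1 - L x) eta => //.
- by move=> x y x0 xy; rewrite lerB// Ule.
- by move=> x y x0 xy; rewrite lerB// Lle.
- by move=> x x0; apply: cvgB; [exact: cvg_cst|exact: Ucv].
- by move=> x x0; apply: cvgB; [exact: cvg_cst|exact: Lcv].
- by move=> x x0; rewrite lerB// LU.
- by move=> x x0; rewrite gerBl L0.
- by rewrite -[X in _ --> X]subr0; apply: cvgB => //; exact: cvg_cst.
move=> G GE.
exists G; split.
  split=> [x x0|x x0 Gx].
    rewrite GE; case: ltP => // /Pgt0; rewrite ltNge ltW//.
  have Px : eta <= P x.
    by rewrite leNgt; apply/negP => Px; move: Gx; rewrite GE Px ltxx.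
  move: Gx; rewrite GE (ltNge (P x)) Px/= va => Gx.
  (* Positivity of [G x] discards the outer maximum with [0], so [1 - G x] lies between [L x] and
     [U x], and [L x] dominates the unfrozen lower bound. *)
  have := ge_lower_env C0 C'0 a1 (v0 _ x0); rewrite -LE// -/(v x) => LL.
  have := UE _ x0; rewrite /upper_env => UU.
  have := LU _ x0.
  move: Gx LL UU; rewrite ler_norml.
  move: (L x) (U x) (F x) (C * v x) (C' * v x `^ a) => l u f c d; clear.
  rewrite !maxEle !minEle; do ! case: ifP; lra.
apply: ge_ereal_sup => _ [x /= Fx <-]; rewrite lee_fin GE.
(* Where the cut applies [G x = 0], and the weighted difference is [x^tau * F x < eta]. *)
case: ltP => Px.
  have P0 : 0 <= P x by rewrite mulr_ge0 ?dfun_ge0 ?powR_ge0.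
  rewrite ler_norml; move: Px P0; rewrite /P [F x * _]mulrC; lra.
have x0 := Pgt0 _ Px.
rewrite -mulrBr normrM ger0_norm ?powR_ge0//.
have [F1 F2] := Fe _ Px.
have Hx : `|1 - F x - (1 - Num.max 0 (Num.min (1 - L x) (Num.max (1 - U x) (F x))))| <= eta * v x.
  move: (LU _ x0) (dfun_ge0 F x) F1 F2 (L0 _ x0); have := mulr_gt0 e0 (v0 _ x0).
  rewrite ler_norml.
  move: (L x) (U x) (F x) (eta * v x) => l u f e; clear.
  rewrite !maxEle !minEle; do ! case: ifP; lra.
by have := ler_wpM2l (powR_ge0 x tau) Hx; rewrite mulrCA [_ * v x]mulrC vt// mulr1.
Qed.

End projection.

(** * Consequences of separation *)

Section separation.
Context {R : realType}.
Implicit Types (F : @distribution_function R) (tau beta b B C rho : R).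

Lemma powR_inv_exp tau beta (y : R) : y `^ (- (tau * (beta + 1))) =
  (y `^ tau) `^ (- (beta + 1)).
Proof. by rewrite -powRrM mulrN. Qed.

Lemma powRN1D (t beta : R) : 0 < t -> t * t `^ (- (beta + 1)) = t `^ (- beta).
Proof.
move=> t0; rewrite -[X in X * _ = _]powRr1 ?ltW// -powRD; last by rewrite (gt_eqF t0) implybT.
by congr (_ `^ _); ring.
Qed.

Lemma scaled_norm (t u C : R) : 0 < t -> `|t * u - C| = t * `|u - C * t^-1|.
Proof.
move=> t0; rewrite -[X in _ = X * _](gtr0_norm t0) -normrM mulrBr mulrCA.
by rewrite divff ?gt_eqF// mulr1.
Qed.

Lemma pareto_class_scaled tau beta C (C' : R) F y : pareto_class tau beta C C' F ->
  0 < y -> 0 < F y ->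
  `|y `^ tau * (1 - F y) - C| <= C' * (y `^ tau) `^ (- beta).
Proof.
move=> [_ H] y0 Fy; have := H y y0; rewrite Fy dfun_le1 => /(_ isT).
have t0 : 0 < y `^ tau by exact: powR_gt0.
rewrite powR_inv_exp powRN -(powRN1D beta t0) scaled_norm// mulrCA.
by rewrite ler_pM2l.
Qed.

(** Only an inequality: the supremum is [-oo] when [F] takes no value strictly between [0] and
    [1]. *)
Lemma tail_dist_self tau F : (tail_dist tau F F <= 0)%E.
Proof. by apply: ge_ereal_sup => _ [x _ <-]; rewrite subrr normr0. Qed.

(** Otherwise the projection with [eta = rho / 2] would give a member of the smoother class closer
    than [rho]. The bound [1 < t] comes for free: for [t <= 1] the envelope of level [beta'] is the
    tighter one, and it already holds. *)
Lemma separated_witness tau beta' beta C (C' : R) rho F :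
  0 < tau -> 0 < beta -> beta' <= beta -> 0 < C -> 0 < C' -> 0 < rho ->
  separated_class tau beta' beta C C' rho F ->
  exists w t, [/\ 0 < w, t = w `^ tau, 1 < t, rho / 2 <= F w * t &
    C' * t `^ (- beta) + rho / 2 < `|t * (1 - F w) - C|].
Proof.
move=> t0 be0 bb C0 C'0 rho0 [FC /= Frho]; apply: contrapT => W.
have F0 : on_nonneg_reals F := FC.1.
have e0 : 0 < rho / 2 by lra.
have [y y0 Py|G [GC GF]] := exists_class_near t0 be0 C0 C'0 e0 F0.
  have Fy : 0 < F y.
    by rewrite -(pmulr_lgt0 _ (powR_gt0 tau y0)) (lt_le_trans e0).
  apply/negPn/negP => Wy; apply: W; exists y, (y `^ tau).
  have ty0 : 0 < y `^ tau by exact: powR_gt0.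
  have Wy' : C' * (y `^ tau) `^ (- beta) + rho / 2 < `|y `^ tau * (1 - F y) - C|.
    move: Wy; rewrite powR_inv_exp powRN -(powRN1D beta ty0).
    rewrite scaled_norm// -ltNge -(ltr_pM2l ty0) mulrDr mulrCA.
    by rewrite [_ * (rho / 2 * _)]mulrCA divff ?gt_eqF// mulr1.
  split => //.
  rewrite ltNge; apply/negP => t1.
  have := pareto_class_scaled FC y0 Fy; apply/negP; rewrite -ltNge.
  apply: le_lt_trans Wy'; rewrite ler_wpDr ?(ltW e0)// ler_pM2l//.
  by apply: ger_powR; rewrite ?t1 ?ty0 ?lerN2.
have : (rho%:E <= (rho / 2)%:E)%E.
  apply: le_trans Frho (le_trans _ GF).
  by apply: ereal_inf_lbound; exists G.
by rewrite lee_fin; lra.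
Qed.

(** The classes are not nested near the origin. If [F] had a level [x > beta], its envelope would
    imply that of [beta] where [y^tau > 1], and the envelope of [beta'] would do so where
    [y^tau <= 1]; then [F] would be in the class of [beta], against the separation. *)
Lemma beta_star_separated b B tau beta' beta C (C' : R) rho F :
  0 < b -> b <= beta' -> beta' <= beta -> beta <= B ->
  0 < tau -> 0 < C -> 0 < C' -> 0 < rho ->
  separated_class tau beta' beta C C' rho F ->
  beta' <= beta_star b B C' F <= beta.
Proof.
move=> b0 bb' bb bB t0 C0 C'0 rho0 [FC /= Frho].
have be'0 : 0 < beta' by exact: lt_le_trans bb'.
rewrite (beta_starE B b0 t0 be'0 C0 FC).
set S := [set _ | _].
have S0 : S beta' by split => //; rewrite bb' (le_trans bb).
have Sub : ubound S beta.
  move=> x [_ Fx]; rewrite leNgt; apply/negP => bx.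
  have Fb : pareto_class tau beta C C' F.
    split=> [|y y0 Fy]; first exact: FC.1.
    have [y1|y1] := leP (y `^ tau) 1.
      apply: le_trans (FC.2 _ y0 Fy) _; rewrite ler_pM2l// !powR_inv_exp.
      by apply: ger_powR; rewrite ?y1 ?powR_gt0// lerN2 lerD2r.
    apply: le_trans (Fx.2 _ y0 Fy) _; rewrite ler_pM2l// !powR_inv_exp.
    by apply: ler_powR; rewrite ?(ltW y1)// lerN2 lerD2r ltW.
  have : (rho%:E <= 0)%E.
    apply: le_trans Frho (le_trans _ (tail_dist_self tau F)).
    by apply: ereal_inf_lbound; exists F.
  by rewrite lee_fin leNgt rho0.
apply/andP; split.
  by apply: ub_le_sup => //; exists beta.
by apply: ge_sup => //; exists beta'.
Qed.

Lemma beta_star_top b B tau C (C' : R) F :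
  0 < b -> b <= B -> 0 < tau -> 0 < C -> pareto_class tau B C C' F ->
  beta_star b B C' F = B.
Proof.
move=> b0 bB t0 C0 FC.
rewrite (beta_starE B b0 t0 (lt_le_trans b0 bB) C0 FC).
set S := [set _ | _].
have S0 : S B by split => //; rewrite bB lexx.
have Sub : ubound S B by move=> x [/andP[_ ->]].
apply/eqP; rewrite eq_le; apply/andP; split.
  by apply: ge_sup => //; exists B.
by apply: ub_le_sup => //; exists B.
Qed.

End separation.

(** * Comparison of two fitting parameter pairs *)

Section compatibility.
Context {R : realType}.
Implicit Types (tau C T eps beta s w : R) (n : nat).

(** [sqrt (n / s)] is the order of the standard deviation of the count at [x = s^(1 / tau)], where
    [1 - F x] is about [C / s]; the factor [ln n] makes polynomially many points reliable at
    once. *)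
Definition deviation n s : R := ln n%:R * Num.sqrt (n%:R / s).

(* Localises the order statistics of rank n / T and 2 n / T. *)
Definition special_ok n (X : n.-tuple R) tau C T eps := forall a : R,
  a = 1 \/ a = 2 ->
  upper_ok X ((C * T * (1 + eps) / a) `^ tau^-1) (a * (n%:R / T)) /\
  lower_ok X ((C * T * (1 - eps) / a) `^ tau^-1) (a * (n%:R / T)).

(** A point is given by [s], the value of [x^tau], so that one grid serves all candidate
    exponents. *)
Definition grid_ok n (X : n.-tuple R) tau C beta (C' : R) s :=
  upper_ok X (s `^ tau^-1)
    (n%:R * (C / s + C' * s `^ (- (beta + 1))) + deviation n s) /\
  lower_ok X (s `^ tau^-1)
    (n%:R * (C / s - C' * s `^ (- (beta + 1))) - deviation n s).

(** The two conditions bracket the order statistic of rank [k]. The escape [exceed X q = n] is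
    closed off because some observation is at most [w]. *)
Lemma lower_upper_lt n (X : n.-tuple R) w q q' k : lower_ok X q k -> upper_ok X q' k ->
  exceed X w != n%:R -> w <= q \/ w <= q' -> q < q'.
Proof.
move=> lo up wn wq; rewrite ltNge; apply/negP => qq.
have {}wq : w <= q by case: wq => // /le_trans; exact.
have qn : exceed X q <> n%:R.
  move=> qn; have := exceed_le X wq; rewrite qn => nw.
  by move: wn; rewrite eq_le exceed_max nw.
case: lo => // kq; case: (up q qq) => // qk.
by have := lt_trans kq qk; rewrite ltxx.
Qed.

Lemma ln1B_ge (e : R) : 0 <= e <= 1 / 2 -> - (2 * e) <= ln (1 - e).
Proof.
move=> /andP[e0 e1]; rewrite -ler_expR lnK ?posrE; last lra.
rewrite expRN -[leRHS]invrK lef_pV2 ?posrE ?expR_gt0 ?invr_gt0; try lra.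
apply: le_trans (expR_ge1Dx _); rewrite -div1r ler_pdivrMr; nra.
Qed.

Lemma ln1D_le (e : R) : 0 <= e -> ln (1 + e) <= e.
Proof.
by move=> e0; rewrite -ler_expR lnK ?posrE ?expR_ge1Dx//; lra.
Qed.

Lemma ln2_ge : 1 / 2 <= ln (2 : R).
Proof.
rewrite -ler_expR lnK ?posrE//.
by have := @expR_le_quadratic R _ (lexx (1 / 2)); lra.
Qed.

(** A line through two points: [r * A] is close to [A'] and [r * (A - l)] to [A' - l], so
    subtraction leaves a bound on [(r - 1) * l], and [l >= 1 / 2] one on [r - 1]. It is used with
    [l = ln 2], the log ratio of the two ranks. *)
Lemma log_ratio (A A' r h l : R) : 0 < r -> 0 <= h <= 1 / 20 -> 1 / 2 <= l ->
  r * (A - h) < A' + h -> A' - h < r * (A + h) ->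
  r * (A - l - h) < A' - l + h -> A' - l - h < r * (A - l + h) ->
  `|r - 1| <= 12 * h /\ `|A' - r * A| <= 3 * h.
Proof.
move=> r0 /andP[h0 h1] l1 H1 H2 H3 H4.
have E1 : r * (l - 2 * h) < l + 2 * h by nra.
have E2 : l - 2 * h < r * (l + 2 * h) by nra.
have r2 : r <= 2.
  rewrite leNgt; apply/negP => r2.
  have : 2 * (l - 2 * h) < r * (l - 2 * h) by rewrite ltr_pM2r//; lra.
  by lra.
have rh : r * h <= 2 * h by apply: ler_wpM2r.
split; last by rewrite ler_norml; apply/andP; split; nra.
rewrite ler_norml; apply/andP; split; rewrite leNgt; apply/negP => H.
  have : (12 * h) * l < (1 - r) * l by rewrite ltr_pM2r; lra.
  have : (12 * h) * (1 / 2) <= (12 * h) * l by apply: ler_wpM2l; lra.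
  lra.
have : (12 * h) * l < (r - 1) * l by rewrite ltr_pM2r; lra.
have : (12 * h) * (1 / 2) <= (12 * h) * l by apply: ler_wpM2l; lra.
lra.
Qed.

(* Both parameters are read off the same two order statistics. *)
Lemma special_ok_close n (X : n.-tuple R) w tau C tau' C1 T eps :
  0 < tau -> 0 < C -> 0 < tau' -> 0 < C1 -> 0 < T -> 0 <= eps <= 1 / 40 ->
  0 < w -> w `^ tau <= C * T / 4 -> exceed X w != n%:R ->
  special_ok X tau C T eps -> special_ok X tau' C1 T eps ->
  `|tau' / tau - 1| <= 24 * eps /\
  `|ln (C1 * T) - tau' / tau * ln (C * T)| <= 6 * eps.
Proof.
move=> t0 C0 t'0 C10 T0 /andP[e0 e1] w0 wT wn S S'.
have qlt c tau0 C2 a : 0 < tau0 -> 0 < C2 -> 0 < c -> a = 1 \/ a = 2 ->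
    ln ((C2 * T * c / a) `^ tau0^-1) =
    tau0^-1 * (ln (C2 * T) + ln c - ln a).
  move=> tau0_gt0 C20 c0 a12; have a0 : 0 < a by case: a12 => ->; lra.
  by rewrite ln_powR ln_div ?posrE ?mulr_gt0// lnM ?posrE ?mulr_gt0.
(* The quarter in [w^tau <= C * T / 4] places [w] before every quantile compared below: the factor
   is at least [1 / 2] and the divisor at most [2]. *)
have wq c a : 1 / 2 <= c -> a = 1 \/ a = 2 -> w <= (C * T * c / a) `^ tau^-1.
  move=> c2 a12; have a0 : 0 < a by case: a12 => ->; lra.
  have -> : w = (w `^ tau) `^ tau^-1.
    by rewrite -powRrM mulfV ?gt_eqF// powRr1// ltW.
  have CT : 0 < C * T by rewrite mulr_gt0.
  apply: ge0_ler_powR; rewrite ?nnegrE ?powR_ge0 ?invr_ge0 ?(ltW t0)//.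
    by rewrite divr_ge0 ?mulr_ge0 ?(ltW CT) ?(ltW a0)//; lra.
  apply: le_trans wT _; rewrite ler_pdivlMr//.
  by case: a12 => ->; nra.
have key a : a = 1 \/ a = 2 ->
    tau' / tau * (ln (C * T) - ln a - 2 * eps) < ln (C1 * T) - ln a + 2 * eps /\
    ln (C1 * T) - ln a - 2 * eps < tau' / tau * (ln (C * T) - ln a + 2 * eps).
  move=> a12; have [up lo] := S a a12; have [up' lo'] := S' a a12.
  have a0 : 0 < a by case: a12 => ->; lra.
  have := ln1D_le e0; have /ln1B_ge : 0 <= eps <= 1 / 2 by apply/andP; lra.
  have c1 : 1 / 2 <= 1 - eps by lra.
  have c2 : 1 / 2 <= 1 + eps by lra.
  have lt1 := lower_upper_lt lo up' wn (or_introl (wq _ _ c1 a12)).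
  have lt2 := lower_upper_lt lo' up wn (or_intror (wq _ _ c2 a12)).
  have c1' : 0 < 1 - eps by lra.
  have c2' : 0 < 1 + eps by lra.
  have qp c tau0 C2 : 0 < C2 -> 0 < c -> 0 < (C2 * T * c / a) `^ tau0^-1.
    by move=> C20 c0; rewrite powR_gt0// divr_gt0// !mulr_gt0.
  move: lt1; rewrite -ltr_ln ?posrE ?qp// !qlt// => lt1.
  move: lt2; rewrite -ltr_ln ?posrE ?qp// !qlt// => lt2.
  move: lt1; rewrite -(ltr_pM2l t'0) !mulrA divff ?gt_eqF// mul1r => lt1.
  move: lt2; rewrite -(ltr_pM2l t'0) !mulrA divff ?gt_eqF// mul1r => lt2 L1 L2.
  have r0 : 0 < tau' / tau by rewrite divr_gt0.
  split.
    have : tau' / tau * (ln (C * T) - ln a - 2 * eps) <=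
        tau' / tau * (ln (C * T) + ln (1 - eps) - ln a) by rewrite ler_pM2l//; lra.
    lra.
  have : tau' / tau * (ln (C * T) + ln (1 + eps) - ln a) <=
      tau' / tau * (ln (C * T) - ln a + 2 * eps) by rewrite ler_pM2l//; lra.
  lra.
have [H1 H2] := key 1 (or_introl erefl).
have [H3 H4] := key 2 (or_intror erefl).
rewrite ln1 !subr0 in H1 H2.
have r0 : 0 < tau' / tau by rewrite divr_gt0.
have h1 : 0 <= 2 * eps <= 1 / 20 by apply/andP; split; lra.
have [R1 R2] := log_ratio r0 h1 ln2_ge H1 H2 H3 H4.
split; [apply: le_trans R1 _|apply: le_trans R2 _]; lra.
Qed.

End compatibility.

(** * From two order statistics to the rest of the tail *)

Section grid.
Context {R : realType}.
Implicit Types (tau C T eps beta s w : R) (n : nat).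

Lemma expR_le_half (e : R) : 0 <= e <= 1 / 2 -> expR e <= 1 + 2 * e.
Proof.
move=> /andP[e0 e1]; have := expR_le_quadratic e1.
have : e ^+ 2 <= e * (1 / 2) by rewrite expr2 ler_wpM2l.
lra.
Qed.

(** Transfer from the scale [s] that a competing pair assigns to a point to its true scale [t]:
    errors in logarithms become relative errors of every term of [grid_ok]. *)
Lemma near_scale n C C1 t s beta eta :
  0 < C -> 0 < C1 -> 0 < t -> 0 < s -> 0 < beta -> 0 <= eta <= 1 / 2 ->
  `|ln C1 - ln s - (ln C - ln t)| <= eta ->
  (beta + 1) * `|ln s - ln t| <= eta ->
  [/\ C1 / s <= (1 + 2 * eta) * (C / t), (1 - eta) * (C / t) <= C1 / s,
      s `^ (- (beta + 1)) <= (1 + 2 * eta) * t `^ (- (beta + 1)) &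
      deviation n s <= 2 * deviation n t].
Proof.
move=> C0 C10 t0 s0 b0 eta1 D1 D2; have /andP[e0 e2] := eta1.
have E1 := expR_le_half eta1.
have CE : C1 / s = expR (ln C1 - ln s) by rewrite expRB !lnK.
have CE' : C / t = expR (ln C - ln t) by rewrite expRB !lnK.
have dn : `|ln s - ln t| <= eta.
  by apply: le_trans D2; rewrite ler_peMl//; lra.
move: D1; rewrite ler_norml => /andP[D1 D1'].
split.
- rewrite CE CE'; apply: (@le_trans _ _ (expR (eta + (ln C - ln t)))).
    by rewrite ler_expR; lra.
  by rewrite [leLHS]expRD ler_wpM2r// expR_ge0.
- rewrite CE CE'; apply: (@le_trans _ _ (expR (- eta + (ln C - ln t)))).
    by rewrite [leRHS]expRD ler_wpM2r ?expR_ge0// expR_ge1Dx.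
  by rewrite ler_expR; lra.
- have E x : 0 < x -> x `^ (- (beta + 1)) = expR (- (beta + 1) * ln x).
    by move=> x0; rewrite /powR gt_eqF.
  rewrite !E//; apply: (@le_trans _ _ (expR (eta + (- (beta + 1)) * ln t))).
    rewrite ler_expR -lerBlDr -mulrBr mulNr -mulrN.
    apply: le_trans D2; rewrite ler_pM2l; last lra.
    by rewrite -normrN ler_norm.
  by rewrite [leLHS]expRD ler_wpM2r// expR_ge0.
rewrite /deviation mulrCA; have [->|n0] := eqVneq n 0%N.
  by rewrite ln0// !mul0r.
have L0 : 0 <= ln (n%:R : R) by rewrite ln_ge0// ler1n lt0n.
rewrite ler_wpM2l//.
have -> : (2 : R) = Num.sqrt (2 ^+ 2) by rewrite sqrtr_sqr gtr0_norm.
rewrite -sqrtrM ?sqr_ge0// ler_sqrt; last first.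
  by rewrite mulr_ge0 ?sqr_ge0 ?divr_ge0 ?(ltW t0).
rewrite ler_pdivrMr//.
have -> : 2 ^+ 2 * (n%:R / t) * s = n%:R * (4 * s / t) by field; lra.
rewrite ler_peMr// ler_pdivlMr// mul1r.
have : t <= s * (1 + 2 * eta).
  move: dn; rewrite ler_norml => /andP[dn _].
  apply: (@le_trans _ _ (expR (ln s + eta))).
    by rewrite -{1}(lnK (t0 : t \in Num.pos)) ler_expR; lra.
  by rewrite expRD lnK// ler_pM2l.
have : s * (1 + 2 * eta) <= s * 4 by rewrite ler_pM2l//; lra.
lra.
Qed.

Lemma ln_shift_le (s e : R) : 1 <= s -> 0 <= e -> ln (s + e) <= ln s + e.
Proof.
move=> s1 e0; have s0 : 0 < s by exact: lt_le_trans s1.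
apply: (@le_trans _ _ (ln (s * (1 + e)))).
  rewrite ler_ln ?posrE; [|lra|by rewrite mulr_gt0//; lra].
  by rewrite mulrDr mulr1 lerD2l ler_peMl.
by rewrite lnM ?posrE; [rewrite lerD2l ln1D_le| |lra].
Qed.

(** A competing pair that fits forces [F] near the envelope of its own [C] at level [beta]. Grid
    points are at least [1], so a level [betaj >= beta] only tightens the envelope. Of the three
    deviations, one comes from [w] and two from the neighbouring grid point. *)
Lemma special_grid_bound n (X : n.-tuple R) w t u tau C tau' C1 T eps beta betaj B (C' eta : R) :
  (0 < n)%N -> 0 < tau -> 0 < C -> 0 < tau' -> 0 < C1 -> 0 < C' ->
  0 < beta -> beta <= betaj -> beta <= B ->
  0 <= eps <= 1 / 40 -> `|ln C| <= ln n%:R -> 1 <= ln (n%:R : R) ->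
  0 <= ln T <= ln n%:R -> 0 < T ->
  54 * (B + 1) * (eps * ln n%:R) + (B + 1) / n%:R <= eta -> eta <= 1 / 2 ->
  0 < w -> t = w `^ tau -> 1 < t -> t <= T -> t <= C * T / 4 ->
  exceed X w != n%:R -> `|exceed X w - n%:R * u| <= deviation n t ->
  special_ok X tau C T eps -> special_ok X tau' C1 T eps ->
  (forall m : nat, 1 + m%:R / n%:R <= 3 * T ->
    grid_ok X tau' C1 betaj C' (1 + m%:R / n%:R)) ->
  `|t * u - C| <= C' * t `^ (- beta) + 2 * eta * (C + C') + 3 * (t / n%:R * deviation n t).
Proof.
move=> n0 ta0 C0 ta'0 C10 C'0 b0 bbj bB eps1 lnC L1 lnT T0 etaE eta2.
move=> w0 tE t1 tT tCT wn wu S S' G.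
have n0' : 0 < n%:R :> R by rewrite ltr0n.
have t0 : 0 < t by lra.
have [r1 AA] : `|tau' / tau - 1| <= 24 * eps /\
    `|ln (C1 * T) - tau' / tau * ln (C * T)| <= 6 * eps.
  by apply: (special_ok_close ta0 C0 ta'0 C10 T0 eps1 w0 _ wn S S'); rewrite -tE.
pose r := tau' / tau; rewrite -/r in r1 AA.
(* The scale of [w] in the eyes of the competing exponent; its logarithm is [r] times that of
   [t]. *)
pose t' := w `^ tau'.
have t'0 : 0 < t' by exact: powR_gt0.
have yt' : ln t' = r * ln t.
  by rewrite /t' tE !ln_powR /r mulrA divfK// gt_eqF.
have r0 : 0 < r by rewrite divr_gt0.
have y0 : 0 < ln t by rewrite ln_gt0.
have yT : ln t <= ln T by rewrite ler_ln.
have t'1 : 1 < t'.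
  by rewrite -ltr_ln ?posrE// ln1 yt' mulr_gt0.
move: AA; rewrite !lnM ?posrE// => AA.
set L := ln n%:R in L1 lnC lnT etaE *.
case/andP: lnT => T1 TL; case/andP: eps1 => eps0 eps1.
set eL := eps * L in etaE *.
have eL0 : 0 <= eL by rewrite mulr_ge0//; lra.
have B0 : 0 < B by lra.
have epseL : eps <= eL by rewrite /eL ler_peMr.
have in0 : 0 < n%:R^-1 :> R by rewrite invr_gt0.
(* [54 = 6 + 48]: the error [6 * eps] relating the constants, and the error [24 * eps] of the
   exponent multiplied by at most [2 * L]. *)
have D1 : `|ln C1 - ln t' - (ln C - ln t)| <= 54 * eL.
  have -> : ln C1 - ln t' - (ln C - ln t) =
      (ln C1 + ln T - r * (ln C + ln T)) + (r - 1) * (ln C + (ln T - ln t)).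
    by rewrite yt'; ring.
  apply: le_trans (ler_normD _ _) _; rewrite normrM.
  have H : `|ln C + (ln T - ln t)| <= 2 * L.
    apply: le_trans (ler_normD _ _) _; rewrite [X in _ + X]ger0_norm;
      clear -y0 yT TL lnC; lra.
  have : `|r - 1| * `|ln C + (ln T - ln t)| <= 24 * eps * (2 * L).
    by apply: ler_pM.
  have -> : 24 * eps * (2 * L) = 48 * eL by rewrite /eL; ring.
  by clear -AA epseL; lra.
have D2 : `|ln t' - ln t| <= 24 * eL.
  have -> : ln t' - ln t = (r - 1) * ln t by rewrite yt'; ring.
  rewrite normrM (gtr0_norm y0).
  have : `|r - 1| * ln t <= 24 * eps * L by apply: ler_pM => //; [exact: ltW|exact: le_trans TL].
  by rewrite /eL; clear; lra.
have eta0 : 0 <= eta.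
  apply: le_trans etaE; rewrite addr_ge0// ?mulr_ge0 ?divr_ge0//; clear -B0 eps0 eL0 L1; lra.
have near s : 0 < s -> `|ln s - ln t'| <= n%:R^-1 ->
    [/\ C1 / s <= (1 + 2 * eta) * (C / t), (1 - eta) * (C / t) <= C1 / s,
      s `^ (- (beta + 1)) <= (1 + 2 * eta) * t `^ (- (beta + 1)) &
      deviation n s <= 2 * deviation n t].
  move=> s0 ss; apply: near_scale => //; first by apply/andP.
    have -> : ln C1 - ln s - (ln C - ln t) =
      ln C1 - ln t' - (ln C - ln t) - (ln s - ln t') by ring.
    apply: le_trans (ler_normB _ _) _.
    have : 54 * eL <= 54 * (B + 1) * eL by rewrite ler_wpM2r//; clear -B0; lra.
    have : n%:R^-1 <= (B + 1) / n%:R :> R by rewrite ler_peMl// ?ltW//; clear -B0; lra.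
    by clear -etaE ss D1; lra.
  have -> : ln s - ln t = (ln s - ln t') + (ln t' - ln t) by ring.
  apply: (@le_trans _ _ ((B + 1) * (n%:R^-1 + 24 * eL))).
    apply: ler_pM; rewrite ?normr_ge0//; [clear -b0; lra|clear -bB; lra|].
    by apply: le_trans (ler_normD _ _) _; clear -ss D2; lra.
  have : 0 <= (B + 1) * eL by rewrite mulr_ge0//; clear -B0; lra.
  by rewrite mulrDr; clear -etaE; lra.
(* As the grid spacing is at most [1 <= T], both grid neighbours of [t'] stay within [3 * T], where
   [G] applies. *)
have t'T : t' <= 2 * T.
  have : ln t' <= ln T + 1 / 2.
    have : 24 * eL <= 54 * (B + 1) * eL.
      by rewrite ler_wpM2r//; clear -B0; lra.
    have : 0 <= (B + 1) / n%:R by rewrite divr_ge0//; clear -B0; lra.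
    by move: D2; rewrite ler_norml => /andP[_]; clear -etaE eta2 yT; lra.
  rewrite -ler_expR lnK// expRD lnK// => /le_trans; apply.
  rewrite mulrC ler_pM2r//.
  have : expR (1 / 2 : R) <= 1 + 2 * (1 / 2).
    by apply: expR_le_half; clear; apply/andP; lra.
  clear; lra.
have T1' : 1 <= T by rewrite -ler_ln ?posrE ?ln1.
have n1 : n%:R^-1 <= 1 :> R by rewrite invf_le1// ler1n.
have bj s : 1 <= s -> s `^ (- (betaj + 1)) <= s `^ (- (beta + 1)).
  by move=> s1; apply: ler_powR => //; rewrite lerN2 lerD2r.
have lnD s : 1 <= s -> ln (s + n%:R^-1) <= ln s + n%:R^-1.
  by move=> s1; apply: ln_shift_le => //; exact: ltW.
pose m := Num.truncn ((t' - 1) * n%:R).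
have tm0 : 0 <= (t' - 1) * n%:R.
  by rewrite mulr_ge0// subr_ge0 ltW.
have /andP[m1 m2] : m%:R <= (t' - 1) * n%:R < m.+1%:R.
  by rewrite /m truncn_itv.
have m1' : 1 + m%:R / n%:R <= t'.
  by rewrite -lerBrDl ler_pdivrMr.
have m2' : t' < 1 + m.+1%:R / n%:R.
  by rewrite -ltrBlDl ltr_pdivlMr.
have mS : 1 + m.+1%:R / n%:R = 1 + m%:R / n%:R + n%:R^-1 :> R.
  by rewrite -natr1 mulrDl mul1r addrA.
have mn0 : 0 <= m%:R / n%:R :> R by rewrite divr_ge0.
have CC : C' * t `^ (- (beta + 1)) * t = C' * t `^ (- beta).
  by rewrite -mulrA [_ * t]mulrC powRN1D.
have tb1 : t `^ (- beta) <= 1.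
  by rewrite -(powRr0 t); apply: ler_powR; [exact: ltW|rewrite oppr_le0 ltW].
have tn0 : 0 < t / n%:R by rewrite divr_gt0.
have dev0 : 0 <= deviation n t by rewrite /deviation mulr_ge0 ?sqrtr_ge0// (le_trans ler01).
have wq s : 0 <= s -> s <= t' -> s `^ tau'^-1 <= w.
  move=> s0 st; have -> : w = t' `^ tau'^-1.
    by rewrite /t' -powRrM mulfV ?gt_eqF// powRr1// ltW.
  by apply: ge0_ler_powR; rewrite ?nnegrE ?invr_ge0 ?(ltW ta'0) ?(ltW t'0).
have wq' s : t' <= s -> w <= s `^ tau'^-1.
  move=> ts; have -> : w = t' `^ tau'^-1.
    by rewrite /t' -powRrM mulfV ?gt_eqF// powRr1// ltW.
  apply: ge0_ler_powR; rewrite ?nnegrE ?invr_ge0 ?(ltW ta'0) ?(ltW t'0)//.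
  by rewrite (le_trans _ ts)// ltW.
move: wu; rewrite ler_norml => /andP[wu1 wu2].
rewrite ler_norml; apply/andP; split.
  (* The grid point just above [t']: its [lower_ok] bounds the count at [w] from below, by
     monotonicity of the counts. *)
  pose s := 1 + m.+1%:R / n%:R : R.
  have s1 : 1 <= s by rewrite /s lerDl divr_ge0.
  have s0 : 0 < s by exact: lt_le_trans s1.
  have [|K1 K2 K3 K4] := near s s0.
    have lts : ln t' <= ln s by rewrite ler_ln ?posrE// ltW.
    rewrite ger0_norm ?subr_ge0// lerBlDr addrC; apply: le_trans (lnD _ (ltW t'1)).
    have st : s <= t' + n%:R^-1 by rewrite /s mS lerD2r.
    by rewrite ler_ln// posrE; exact: addr_gt0.
  have [_ lo] : grid_ok X tau' C1 betaj C' s.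
    apply: G; rewrite mS; apply: le_trans (lerD m1' n1) _.
    by clear -t'T T1'; lra.
  have Nw : exceed X (s `^ tau'^-1) <= exceed X w.
    by apply/exceed_le/wq'; exact: ltW.
  have {lo} : n%:R * (C1 / s - C' * s `^ (- (betaj + 1))) - deviation n s
      < exceed X w.
    case: lo => [nn|lo]; last exact: lt_le_trans Nw.
    by move: wn; rewrite eq_le exceed_max -nn Nw.
  have /(ler_wpM2l (ltW C'0)) Bj := le_trans (bj s s1) K3.
  move=> lo; have {}lo : n%:R * ((1 - eta) * (C / t) -
      C' * ((1 + 2 * eta) * t `^ (- (beta + 1)))) - 2 * deviation n t <=
      n%:R * u + deviation n t.
    have : n%:R * ((1 - eta) * (C / t) -
      C' * ((1 + 2 * eta) * t `^ (- (beta + 1)))) <=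
      n%:R * (C1 / s - C' * s `^ (- (betaj + 1))) by rewrite ler_pM2l// lerB.
    clear -lo wu2 K4; lra.
  have := ler_wpM2l (ltW tn0) lo.
  have -> : t / n%:R * (n%:R * ((1 - eta) * (C / t) -
      C' * ((1 + 2 * eta) * t `^ (- (beta + 1)))) - 2 * deviation n t) =
    (1 - eta) * C - (1 + 2 * eta) * (C' * t `^ (- beta)) -
      2 * (t / n%:R * deviation n t).
    by rewrite -CC; field; clear -t0 n0'; lra.
  have -> : t / n%:R * (n%:R * u + deviation n t) =
      t * u + t / n%:R * deviation n t.
    by field; clear -t0 n0'; lra.
  have : eta * (C' * t `^ (- beta)) <= eta * C'.
    by rewrite ler_wpM2l// ler_piMr// ltW.
  have : 0 <= eta * C by rewrite mulr_ge0// ltW.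
  clear; lra.
(* The grid point at or just below [t']: its [upper_ok] covers [w] itself. *)
pose s := 1 + m%:R / n%:R : R.
have s1 : 1 <= s by rewrite /s lerDl.
have s0 : 0 < s by exact: lt_le_trans s1.
have [|K1 K2 K3 K4] := near s s0.
  have lts : ln s <= ln t' by rewrite ler_ln ?posrE.
  rewrite ler0_norm ?subr_le0// opprB lerBlDr addrC.
  apply: le_trans (lnD _ s1).
  have st : t' <= s + n%:R^-1 by rewrite /s -mS; exact: ltW.
  by rewrite ler_ln// posrE; exact: addr_gt0.
have [up _] : grid_ok X tau' C1 betaj C' s.
  by apply: G; apply: le_trans m1' _; clear -t'T T1'; lra.
have {up} : exceed X w < n%:R * (C1 / s + C' * s `^ (- (betaj + 1))) + deviation n s.
  case: (up w) => // [|nn]; first by apply: wq => //; exact: ltW.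
  by move: wn; rewrite nn eqxx.
have /(ler_wpM2l (ltW C'0)) Bj := le_trans (bj s s1) K3.
move=> up; have {}up : n%:R * u - deviation n t <= n%:R * ((1 + 2 * eta) * (C / t) +
    C' * ((1 + 2 * eta) * t `^ (- (beta + 1)))) + 2 * deviation n t.
  have : n%:R * (C1 / s + C' * s `^ (- (betaj + 1))) <=
    n%:R * ((1 + 2 * eta) * (C / t) +
    C' * ((1 + 2 * eta) * t `^ (- (beta + 1)))) by rewrite ler_pM2l// lerD.
  clear -up wu1 K4; lra.
have := ler_wpM2l (ltW tn0) up.
have -> : t / n%:R * (n%:R * ((1 + 2 * eta) * (C / t) +
    C' * ((1 + 2 * eta) * t `^ (- (beta + 1)))) + 2 * deviation n t) =
  (1 + 2 * eta) * C + (1 + 2 * eta) * (C' * t `^ (- beta)) +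
    2 * (t / n%:R * deviation n t).
  by rewrite -CC; field; clear -t0 n0'; lra.
have -> : t / n%:R * (n%:R * u - deviation n t) =
    t * u - t / n%:R * deviation n t.
    by field; clear -t0 n0'; lra.
have : eta * (C' * t `^ (- beta)) <= eta * C'.
  by rewrite ler_wpM2l// ler_piMr// ltW.
clear; lra.
Qed.

End grid.

(** * The estimator *)

Section rational_parameters.
Context {R : realType}.
Implicit Types (tau C T eps beta s w q k : R) (n : nat).

Lemma upper_okW n (X : n.-tuple R) q q' k k' : q <= q' -> k <= k' ->
  upper_ok X q k -> upper_ok X q' k'.
Proof.
move=> qq kk H x qx; case: (H x (le_trans qq qx)) => [|xk]; [by left|right].
exact: lt_le_trans kk.
Qed.

(** Counts are continuous from the right only, hence the approach from above; the strict inequality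
    in [lower_ok] then survives a small change of the threshold. *)
Lemma lower_ok_near {I : Type} (D : set_system I) {FD : Filter D} n (X : n.-tuple R)
    (q k : I -> R) q0 k0 :
  q @ D --> q0 -> (\forall t \near D, q0 <= q t) -> k @ D --> k0 ->
  lower_ok X q0 k0 -> \forall t \near D, lower_ok X (q t) (k t).
Proof.
move=> cq qq ck L; have [e /= e0 He] := exceed_near_right X q0.
have qe : \forall t \near D, q t < q0 + e by apply: (cvgr_lt _ cq); rewrite ltrDl.
have E : \forall t \near D, exceed X (q t) = exceed X q0.
  apply: filterS2 qq qe => t; rewrite le_eqVlt => /orP[/eqP -> //|qt qe].
  by apply: He => //=; rewrite ltr0_norm ?subr_lt0// opprB ltrBlDl.
case: L => [L|L].
  by apply: filterS E => t Et; left; rewrite Et.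
have kn : \forall t \near D, k t < exceed X q0 by exact: (cvgr_lt _ ck).
by apply: filterS2 E kn => t Et kt; right; rewrite Et.
Qed.

Lemma near_forall_lt {I : Type} (D : set_system I) {FD : Filter D} (Q : nat -> I -> Prop)
    (P : nat -> Prop) N :
  (forall l, P l -> (l < N)%N) -> (forall l, P l -> \forall t \near D, Q l t) ->
  \forall t \near D, forall l, P l -> Q l t.
Proof.
move=> PN PQ.
have : \forall t \near D, forall l : 'I_N, P l -> Q l t.
  apply: filter_forall => l; have [/PQ|Pl] := pselect (P l).
    by apply: filterS => t Qt _.
  by apply: nearW => t /Pl.
by apply: filterS => t H l Pl; exact: (H (Ordinal (PN l Pl)) Pl).
Qed.

Lemma special_ok_near {D : set_system R} {FD : Filter D} n (X : n.-tuple R)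
    (tau C : R -> R) tau0 C0 T eps :
  (forall c a, 1 - eps <= c -> a = 1 \/ a = 2 ->
    (C t * T * c / a) `^ (tau t)^-1 @[t --> D] --> (C0 * T * c / a) `^ tau0^-1) ->
  (forall c a, 1 - eps <= c -> a = 1 \/ a = 2 ->
    \forall t \near D, (C0 * T * c / a) `^ tau0^-1 <= (C t * T * c / a) `^ (tau t)^-1) ->
  0 <= eps < 1 -> special_ok X tau0 C0 T eps ->
  \forall t \near D, special_ok X (tau t) (C t) T eps.
Proof.
move=> Hc Hn /andP[e0 e1] S.
have H a : a = 1 \/ a = 2 -> \forall t \near D,
    upper_ok X ((C t * T * (1 + eps) / a) `^ (tau t)^-1) (a * (n%:R / T)) /\
    lower_ok X ((C t * T * (1 - eps) / a) `^ (tau t)^-1) (a * (n%:R / T)).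
  move=> a12; have [up lo] := S a a12; apply: filterI.
    have u1 : 1 - eps <= 1 + eps by lra.
    have := Hn (1 + eps) a u1 a12; apply: filterS => t qt.
    exact: (upper_okW qt (lexx _) up).
  apply: (@lower_ok_near _ D _ n X _ (fun=> a * (n%:R / T)) _ _ _ _ _ lo).
  - exact: Hc.
  - exact: Hn.
  - exact: cvg_cst.
apply: filterS2 (H 1 (or_introl erefl)) (H 2 (or_intror erefl)) => t H1 H2 a.
by case=> ->.
Qed.

Lemma grid_ok_near {D : set_system R} {FD : Filter D} n (X : n.-tuple R)
    (tau C : R -> R) tau0 C0 beta (C' : R) s : 0 < s ->
  s `^ (tau t)^-1 @[t --> D] --> s `^ tau0^-1 -> C @ D --> C0 ->
  (\forall t \near D, s `^ tau0^-1 <= s `^ (tau t)^-1) ->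
  (\forall t \near D, C0 <= C t) ->
  grid_ok X tau0 C0 beta C' s ->
  \forall t \near D, grid_ok X (tau t) (C t) beta C' s.
Proof.
move=> s0 cs cC ns nC [up lo]; apply: filterI.
  apply: filterS2 ns nC => t st Ct; apply: (upper_okW st _ up).
  by rewrite lerD2r ler_wpM2l// lerD2r ler_wpM2r// invr_ge0 ltW.
apply: (@lower_ok_near _ D _ n X _ _ _ _ cs ns _ lo).
apply: cvgB; last exact: cvg_cst.
apply: cvgMl_tmp; apply: cvgB; last exact: cvg_cst.
exact: cvgMr_tmp.
Qed.

Lemma rat_at_right (x : R) (P : R -> Prop) : (\forall y \near x^'+, P y) ->
  exists r : rat, x < ratr r /\ P (ratr r).
Proof.
move=> [e /= e0 He]; have /rat_in_itvoo[r] : x < x + e by rewrite ltrDl.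
rewrite in_itv/= => /andP[xr re]; exists r; split => //.
by apply: He => //=; rewrite ltr0_norm ?subr_lt0// opprB ltrBlDl.
Qed.

Lemma rat_at_left (x : R) (P : R -> Prop) : (\forall y \near x^'-, P y) ->
  exists r : rat, ratr r < x /\ P (ratr r).
Proof.
move=> [e /= e0 He]; have /rat_in_itvoo[r] : x - e < x by rewrite gtrBl.
rewrite in_itv/= => /andP[xr re]; exists r; split => //.
by apply: He => //=; rewrite gtr0_norm ?subr_gt0// ltrBlDl -ltrBlDr.
Qed.

(* Raising C and lowering tau relaxes the upper conditions and, the counts
   being right-continuous, preserves the lower ones. *)
Lemma fits_rational n (X : n.-tuple R) tau C beta (C' : R)
    (PT PS : nat -> Prop) (T eps s : nat -> R) N :
  0 < tau -> 0 < C ->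
  (forall l, PT l -> (l < N)%N) -> (forall m, PS m -> (m < N)%N) ->
  (forall l, PT l -> [/\ 0 < T l, 0 <= eps l < 1 & 1 <= C * T l * (1 - eps l) / 2]) ->
  (forall m, PS m -> 1 <= s m) ->
  (forall l, PT l -> special_ok X tau C (T l) (eps l)) ->
  (forall m, PS m -> grid_ok X tau C beta C' (s m)) ->
  exists r1 r2 : rat, [/\ 0 < ratr r1 :> R, 0 < ratr r2 :> R,
    forall l, PT l -> special_ok X (ratr r1) (ratr r2) (T l) (eps l) &
    forall m, PS m -> grid_ok X (ratr r1) (ratr r2) beta C' (s m)].
Proof.
move=> t0 C0 PTN PSN HT Hs S G.
have nC : \forall c \near C^'+, C <= c.
  by have := nbhs_right_gt C; apply: filterS => c /ltW.
have cC : (fun c : R => c) @ (C^'+ : set_system R) --> C.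
  by apply: cvg_within_filter; exact: cvg_id.
(* Two stages: the constant is raised to a rational, then the exponent is lowered with that rational
   constant in place. *)
have [r2 [Cr2 [S2 G2]]] : exists r2 : rat, C < ratr r2 /\
    ((forall l, PT l -> special_ok X tau (ratr r2) (T l) (eps l)) /\
     (forall m, PS m -> grid_ok X tau (ratr r2) beta C' (s m))).
  apply: (@rat_at_right C (fun c =>
    (forall l, PT l -> special_ok X tau c (T l) (eps l)) /\
    (forall m, PS m -> grid_ok X tau c beta C' (s m)))).
  suff [HA HB] : (\forall c \near C^'+, forall l, PT l -> special_ok X tau c (T l) (eps l)) /\
      (\forall c \near C^'+, forall m, PS m -> grid_ok X tau c beta C' (s m)).
    by apply: filterS2 HA HB => c.
  split; [apply: (near_forall_lt (Q := fun l c => special_ok X tau c (T l) (eps l)) PTN)|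
    apply: (near_forall_lt (Q := fun m c => grid_ok X tau c beta C' (s m)) PSN)].
    move=> l Pl; have [Tl0 el Cl] := HT l Pl.
    apply: (special_ok_near (tau := fun=> tau) (C := fun c => c) _ _ el (S l Pl)).
      move=> c a ec a12; have c0 : 0 < c by case/andP: el; lra.
      have a0 : 0 < a by case: a12 => ->; lra.
      apply: (@cvg_comp _ _ _ (fun t => t * T l * c / a) (fun y => y `^ tau^-1)).
        by do 3 apply: cvgMr_tmp; exact: cC.
      have q0 : 0 < C * T l * c / a by rewrite divr_gt0 ?mulr_gt0.
      exact: (continuous_powRl (s := tau^-1) q0).
    move=> c a ec a12; apply: filterS nC => t Ct.
    have a0 : 0 < a by case: a12 => ->; lra.
    have c0 : 0 < c by case/andP: el; lra.
    apply: ge0_ler_powR; rewrite ?nnegrE ?invr_ge0 ?(ltW t0)//.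
    - by rewrite divr_ge0 ?mulr_ge0// ltW.
    - by rewrite divr_ge0 ?mulr_ge0 ?(ltW a0) ?(ltW c0) ?(ltW Tl0)// (le_trans (ltW C0)).
    - by rewrite ler_pM2r ?invr_gt0// !ler_pM2r.
  move=> m Pm; apply: (grid_ok_near (tau := fun=> tau) (C := fun c => c) _ _ _ _ nC (G m Pm)) => //.
  - exact: lt_le_trans (Hs m Pm).
  - exact: cvg_cst.
  - exact: nearW.
have r20 : 0 < ratr r2 :> R by exact: lt_trans Cr2.
have cs s0 : 1 <= s0 -> s0 `^ t^-1 @[t --> tau^'-] --> s0 `^ tau^-1.
  move=> s1; have E t : s0 `^ t^-1 = expR (t^-1 * ln s0).
    by rewrite /powR gt_eqF// (lt_le_trans ltr01).
  under eq_fun do rewrite E.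
  rewrite E; apply: (@cvg_comp _ _ _ (fun t => t^-1 * ln s0) expR); last exact: continuous_expR.
  apply: cvgMr_tmp; apply: cvg_within_filter; apply: cvgV; first by rewrite gt_eqF.
  exact: cvg_id.
have tpos : \forall t \near tau^'-, 0 < t by exact: nbhs_left_gt.
have ns s0 : 1 <= s0 -> \forall t \near tau^'-, s0 `^ tau^-1 <= s0 `^ t^-1.
  move=> s1; have := nbhs_left_lt tau; apply: filterS2 tpos => t t0' tt.
  by apply: ler_powR => //; rewrite lef_pV2 ?posrE// ltW.
have [r1 [r1t [r10 [S1 G1]]]] : exists r1 : rat, ratr r1 < tau /\
    (0 < ratr r1 :> R /\
    ((forall l, PT l -> special_ok X (ratr r1) (ratr r2) (T l) (eps l)) /\
     (forall m, PS m -> grid_ok X (ratr r1) (ratr r2) beta C' (s m)))).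
  apply: (@rat_at_left tau (fun t => 0 < t /\
    ((forall l, PT l -> special_ok X t (ratr r2) (T l) (eps l)) /\
    (forall m, PS m -> grid_ok X t (ratr r2) beta C' (s m))))).
  suff [HA HB] : (\forall t \near tau^'-, forall l, PT l ->
        special_ok X t (ratr r2) (T l) (eps l)) /\
      (\forall t \near tau^'-, forall m, PS m -> grid_ok X t (ratr r2) beta C' (s m)).
    by apply: filterS3 tpos HA HB => t.
  split; [apply: (near_forall_lt (Q := fun l t => special_ok X t (ratr r2) (T l) (eps l)) PTN)|
    apply: (near_forall_lt (Q := fun m t => grid_ok X t (ratr r2) beta C' (s m)) PSN)].
    move=> l Pl; have [Tl0 el Cl] := HT l Pl.
    (* Lowering [tau] raises [y^(1 / tau)] only for [y >= 1]; this is the purpose of the last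
       condition in [HT]. *)
    have big c a : 1 - eps l <= c -> a = 1 \/ a = 2 -> 1 <= ratr r2 * T l * c / a.
      move=> ec a12; apply: le_trans Cl _; case/andP: el => e0 e1.
      have CT : 0 < C * T l by rewrite mulr_gt0.
      have CT' : C * T l <= ratr r2 * T l by rewrite ler_pM2r// ltW.
      have CTc : C * T l * (1 - eps l) <= ratr r2 * T l * c.
        by apply: ler_pM => //; [exact: ltW|lra].
      have : 0 <= C * T l * (1 - eps l) by rewrite mulr_ge0 ?(ltW CT)//; lra.
      by case: a12 => ->; lra.
    apply: (special_ok_near (tau := fun t => t) (C := fun=> ratr r2) _ _ el (S2 l Pl)).
      by move=> c a ec a12; apply: cs; exact: big.
    by move=> c a ec a12; apply: ns; exact: big.
  move=> m Pm; apply: (grid_ok_near (tau := fun t => t) (C := fun=> ratr r2) _ _ _ _ _ (G2 m Pm)).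
  - exact: lt_le_trans (Hs m Pm).
  - exact: cs (Hs m Pm).
  - exact: cvg_cst.
  - exact: ns (Hs m Pm).
  - exact: nearW.
by exists r1, r2; split.
Qed.

End rational_parameters.

(** * Selection of the first accepted index *)

Section selection.
Context d (T : measurableType d) (R : realType).
Implicit Types (A : nat -> set T) (f : nat -> R).

(** The search is written with indicators, so that measurability is plain arithmetic. [N] bounds the
    number of tests; if all fail, the value is [f] at the next index. *)
Fixpoint first_hit A f (N k : nat) (X : T) : R :=
  if N is N'.+1 then
    \1_(A k) X * f k + (1 - \1_(A k) X) * first_hit A f N' k.+1 X
  else f k.

Lemma measurable_first_hit A f N k : (forall j, measurable (A j)) ->
  measurable_fun setT (first_hit A f N k).
Proof.
move=> mA; elim: N k => [|N IH] k /=; first exact: measurable_cst.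
have mI : measurable_fun setT (\1_(A k) : T -> R) by exact: measurable_indic.
apply: measurable_funD; apply: measurable_funM => //.
exact: measurable_funB.
Qed.

Lemma first_hitP A f N k X j1 j0 : (k <= j1)%N -> (j1 <= j0)%N -> (j0 < k + N)%N ->
  A j0 X -> (forall j, (k <= j < j1)%N -> ~ A j X) ->
  exists j, (j1 <= j <= j0)%N /\ first_hit A f N k X = f j.
Proof.
elim: N k j1 => [|N IH] k j1 k1 j10 j0N Aj0 NA /=.
  by move: j0N; rewrite addn0 ltnNge (leq_trans k1).
have [Ak|nAk] := pselect (A k X).
  exists k; rewrite indicE mem_set// mul1r subrr mul0r addr0; split=> //.
  rewrite (leq_trans k1 j10) andbT leqNgt; apply/negP => kj1.
  by apply: (NA k) => //; rewrite leqnn.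
rewrite indicE memNset// mul0r add0r subr0 mul1r.
have kj0 : (k < j0)%N.
  rewrite ltn_neqAle (leq_trans k1 j10) andbT; apply/eqP => kj; apply: nAk.
  by rewrite kj.
have [kj1|] := ltnP k j1.
  apply: IH => //; first by rewrite addSnnS.
  by move=> j /andP[kj jj1]; apply: NA; rewrite jj1 (ltnW kj).
move=> j1k; have j1E : j1 = k by apply/eqP; rewrite eqn_leq j1k k1.
have [||j|j [/andP[kj jj0] E]] := IH k.+1 k.+1 (leqnn _) kj0; rewrite ?addSnnS//.
  by move=> /andP[/leq_trans/[apply]]; rewrite ltnn.
by exists j; rewrite j1E (ltnW kj) jj0.
Qed.

End selection.

Section estimator.
Context {R : realType}.
Implicit Types (n : nat) (b B xi beta tau C T eps : R).

(** The value of [T] that balances the bias [T^(-beta)] against the noise [sqrt (T / n)]; [rate] is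
    their common value, as [rate_scale] and [scale_div] show. *)
Definition scale n beta : R := n%:R `^ (2 * beta + 1)^-1.

Definition rate n beta : R := n%:R `^ (- (beta / (2 * beta + 1))).

Definition tolerance n beta : R := ln (ln n%:R) * rate n beta.

(** Grid indices run against the levels: [l >= j] means a smaller level. The grid reaches beyond
    three times every scale in use, the largest being [scale n b], and has at most [5 * n^2]
    points. *)
Definition fits b B (C' : R) xi n j tau C (X : n.-tuple R) :=
  (forall l, (j <= l <= nb_classes xi n)%N ->
    special_ok X tau C (scale n (beta_grid b B xi n l))
      (tolerance n (beta_grid b B xi n l))) /\
  (forall m : nat, 1 + m%:R / n%:R <= 4 * scale n b ->
    grid_ok X tau C (beta_grid b B xi n j) C' (1 + m%:R / n%:R)).

Definition accepted b B (C' : R) xi n j : set (n.-tuple (measurableTypeR R)) :=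
  [set X | exists r1 r2 : rat, [/\ 0 < ratr r1 :> R, 0 < ratr r2 :> R &
    fits b B C' xi j (ratr r1) (ratr r2) X]].

(** As the levels decrease with the index, the first accepted index gives the largest accepted
    level. The indices [0] to [M], with [M] the number of classes, are tested. *)
Definition beta_hat b B (C' : R) xi n : n.-tuple (measurableTypeR R) -> R :=
  first_hit (@accepted b B C' xi n) (beta_grid b B xi n) (nb_classes xi n).+1 0.

Lemma measurable_forall_nat d (T : measurableType d) (P : nat -> Prop)
    (Q : nat -> set T) :
  (forall l, measurable (Q l)) -> measurable [set X | forall l, P l -> Q l X].
Proof.
move=> mQ; rewrite (_ : [set X | _] = \bigcap_(l in [set: nat])
    (if pselect (P l) then Q l else setT)).
  apply: bigcapT_measurable => l.
  by case: pselect => p; [exact: mQ|exact: measurableT].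
apply/seteqP; split => X /= H l.
  by move=> _; case: pselect => //; exact: H.
by move=> Pl; have := H l I; case: pselect.
Qed.

Lemma measurable_special_ok n tau C T eps :
  measurable [set X : n.-tuple (measurableTypeR R) | special_ok X tau C T eps].
Proof.
pose S a : set (n.-tuple (measurableTypeR R)) :=
  [set X | upper_ok X ((C * T * (1 + eps) / a) `^ tau^-1) (a * (n%:R / T))] `&`
  [set X | lower_ok X ((C * T * (1 - eps) / a) `^ tau^-1) (a * (n%:R / T))].
have mS a : measurable (S a).
  by apply: measurableI; [exact: measurable_upper_ok|exact: measurable_lower_ok].
rewrite (_ : [set X | _] = S 1 `&` S 2); first exact: measurableI.
apply/seteqP; split => X.
  by move=> H; split; apply: H; [left|right].
by move=> [H1 H2] a [] ->.
Qed.

Lemma measurable_accepted b B (C' : R) xi n j : measurable (@accepted b B C' xi n j).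
Proof.
rewrite (_ : accepted _ _ _ _ _ = \bigcup_(r1 : rat) \bigcup_(r2 : rat)
  (if (0 < ratr r1 :> R) && (0 < ratr r2 :> R) then
     [set X | fits b B C' xi j (ratr r1) (ratr r2) X] else set0)).
  apply: bigcupT_measurable_rat => r1; apply: bigcupT_measurable_rat => r2.
  case: ifP => // _; apply: measurableI.
    apply: (@measurable_forall_nat _ _ (fun l => (j <= l <= nb_classes xi n)%N)
      (fun l => [set X : n.-tuple (measurableTypeR R) | special_ok X (ratr r1) (ratr r2)
        (scale n (beta_grid b B xi n l)) (tolerance n (beta_grid b B xi n l))])).
    by move=> l; exact: measurable_special_ok.
  apply: (@measurable_forall_nat _ _ (fun m => is_true (1 + m%:R / n%:R <= 4 * scale n b))
    (fun m => [set X : n.-tuple (measurableTypeR R) | grid_ok X (ratr r1) (ratr r2)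
      (beta_grid b B xi n j) C' (1 + m%:R / n%:R)])).
  by move=> m; apply: measurableI; [exact: measurable_upper_ok|exact: measurable_lower_ok].
apply/seteqP; split => X /=.
  by move=> [r1 [r2 [r10 r20 H]]]; exists r1 => //; exists r2 => //; rewrite r10 r20.
by move=> [r1 _ [r2 _]]; case: ifP => //= /andP[r10 r20] H; exists r1, r2.
Qed.

Lemma measurable_beta_hat b B (C' : R) xi n :
  measurable_fun setT (@beta_hat b B C' xi n).
Proof. by apply: measurable_first_hit => j; exact: measurable_accepted. Qed.

End estimator.

(** * Acceptance of the true level *)

Section acceptance_probability.
Context {R : realType}.
Implicit Types (F : @distribution_function R) (tau C T eps beta s q : R) (n : nat).

Lemma prob_forall_nat d (T : measurableType d) (P : probability T R)
    (I : nat -> Prop) (Q : nat -> set T) (N : nat) (e : R) :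
  0 <= e -> (forall l, measurable (Q l)) -> (forall l, I l -> (l < N)%N) ->
  (forall l, I l -> (P (~` Q l) <= e%:E)%E) ->
  (P (~` [set X | forall l, I l -> Q l X]) <= (N%:R * e)%:E)%E.
Proof.
move=> e0 mQ; elim: N I => [|N IH] I IN Pe.
  rewrite (_ : ~` _ = set0) ?measure0 ?mul0r//.
  by apply/seteqP; split => // X /=; apply => l /IN.
pose J l := I l /\ (l < N)%N.
have mJ (K : nat -> Prop) : measurable [set X | forall l, K l -> Q l X].
  exact: measurable_forall_nat.
have H1 := IH J (fun l Jl => Jl.2) (fun l Jl => Pe l Jl.1).
have [IN'|IN'] := pselect (I N).
  apply: (@le_trans _ _ (P (~` [set X | forall l, J l -> Q l X] `|` ~` Q N))).
    apply: le_measure; rewrite ?inE.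
    - by apply: measurableC; exact: mJ.
    - by apply: measurableU; apply: measurableC; [exact: mJ|exact: mQ].
    move=> X /= /existsNP[l /not_implyP[Il nQ]].
    have := IN l Il; rewrite ltnS leq_eqVlt => /orP[/eqP lN|lN].
      by right; rewrite -lN.
    by left => H; apply: nQ; exact: H.
  apply: le_trans (measureU2 _ _ _) _; [by apply: measurableC|by apply: measurableC|].
  rewrite -natr1 mulrDl mul1r EFinD; apply: leeD => //; exact: Pe.
apply: (@le_trans _ _ (N%:R * e)%:E); last by rewrite lee_fin ler_wpM2r// ler_nat.
apply: IH => // l Il; have := IN l Il; rewrite ltnS leq_eqVlt => /orP[/eqP lN|//].
by rewrite -lN in IN'.
Qed.

Lemma pareto_class_bounds tau beta C (C' : R) F s x :
  0 < tau -> 0 < beta -> 0 < C -> 0 < C' -> 0 < s -> pareto_class tau beta C C' F ->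
  s `^ tau^-1 <= x -> 0 < F x -> 1 - F x <= C / s + C' * s `^ (- (beta + 1)).
Proof.
move=> t0 b0 C0 C'0 s0 FC sx Fx.
have q0 : 0 < s `^ tau^-1 by exact: powR_gt0.
have x0 : 0 < x by exact: lt_le_trans sx.
have sxt : s <= x `^ tau.
  have -> : s = (s `^ tau^-1) `^ tau.
    by rewrite -powRrM mulVf ?gt_eqF// powRr1// ltW.
  by apply: ge0_ler_powR; rewrite ?nnegrE ?(ltW t0) ?(ltW q0) ?(ltW x0).
have xt0 : 0 < x `^ tau by exact: powR_gt0.
have := FC.2 x x0; rewrite Fx dfun_le1 => /(_ isT).
rewrite powR_inv_exp powRN ler_norml => /andP[_ H].
have H1 : C * (x `^ tau)^-1 <= C / s by rewrite ler_pM2l// lef_pV2.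
have H2 : C' * (x `^ tau) `^ (- (beta + 1)) <= C' * s `^ (- (beta + 1)).
  rewrite ler_pM2l// !powRN lef_pV2 ?posrE ?powR_gt0//.
  apply: ge0_ler_powR; rewrite ?nnegrE ?(ltW s0) ?(ltW xt0)//; lra.
lra.
Qed.

Lemma pareto_class_lower tau beta C (C' : R) F s :
  0 < tau -> 0 < s -> pareto_class tau beta C C' F -> 0 < F (s `^ tau^-1) ->
  C / s - C' * s `^ (- (beta + 1)) <= 1 - F (s `^ tau^-1).
Proof.
move=> t0 s0 FC Fx.
have q0 : 0 < s `^ tau^-1 by exact: powR_gt0.
have := FC.2 _ q0; rewrite Fx dfun_le1 => /(_ isT).
have -> : s `^ tau^-1 `^ (- tau) = s^-1.
  by rewrite -powRrM mulrN mulVf ?gt_eqF// powR_inv1// ltW.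
have -> : s `^ tau^-1 `^ (- (tau * (beta + 1))) = s `^ (- (beta + 1)).
  rewrite powR_inv_exp; congr (_ `^ _).
  by rewrite -powRrM mulVf ?gt_eqF// powRr1// ltW.
by rewrite ler_norml => /andP[H _]; lra.
Qed.

(** Moving the quantile by a factor [1 + eps] or [1 - eps] changes the mean count by about [eps]
    relatively. The bias takes a quarter of it; the margin left is at least [k * eps / 4] above and
    [k * eps / 2] below, and both Chernoff exponents are at least [k * eps^2 / 128]. The factor [4]
    counts two ranks and two sides. *)
Lemma special_prob tau beta C (C' : R) F n T eps :
  (0 < n)%N -> 0 < tau -> 0 < beta -> 0 < C -> 0 < C' -> 0 < T -> 0 < eps <= 1 / 2 ->
  pareto_class tau beta C C' F ->
  (forall s, C * T / 4 <= s -> C' * s `^ (- beta) <= C * (eps / 4)) ->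
  (sample_prob F n (~` [set X | special_ok X tau C T eps]) <=
   (4 * expR (- (n%:R / T * eps ^+ 2 / 128)))%:E)%E.
Proof.
move=> n0 t0 b0 C0 C'0 T0 /andP[e0 e1] FC Hs.
have n0' : 0 < n%:R :> R by rewrite ltr0n.
set E := expR _.
have E0 : 0 <= E by exact: expR_ge0.
have up a : a = 1 \/ a = 2 -> (sample_prob F n
    (~` [set X | upper_ok X ((C * T * (1 + eps) / a) `^ tau^-1) (a * (n%:R / T))]) <= E%:E)%E.
  move=> a12; have a0 : 0 < a by case: a12 => ->; lra.
  set s := C * T * (1 + eps) / a; set k := a * (n%:R / T).
  have s0 : 0 < s by rewrite /s divr_gt0 ?mulr_gt0//; lra.
  have k0 : 0 < k by rewrite mulr_gt0 ?divr_gt0.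
  have Ts : C * T / 4 <= s.
    rewrite /s; have : 0 < C * T by rewrite mulr_gt0.
    by case: a12 => -> ?; nra.
  have np : n%:R * (C / s + C' * s `^ (- (beta + 1))) + k * (eps / 4) <= k.
    have -> : n%:R * (C / s + C' * s `^ (- (beta + 1))) =
        n%:R / s * (C + C' * s `^ (- beta)).
      by rewrite -(powRN1D beta s0); field; lra.
    have ns : n%:R / s = k / (C * (1 + eps)).
      by rewrite /s /k; field; do ! (apply/andP; split); lra.
    have H : n%:R / s * (C + C' * s `^ (- beta)) <= n%:R / s * (C + C * (eps / 4)).
      apply: ler_wpM2l; first by rewrite divr_ge0 ?ltW.
      by rewrite lerD2l; exact: Hs.
    apply: (@le_trans _ _ (n%:R / s * (C + C * (eps / 4)) + k * (eps / 4))).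
      by rewrite lerD2r.
    have -> : n%:R / s * (C + C * (eps / 4)) + k * (eps / 4) =
       k * ((1 + eps / 4) / (1 + eps) + eps / 4).
      by rewrite ns; field; do ! (apply/andP; split); lra.
    rewrite ler_piMr ?(ltW k0)// -lerBrDr ler_pdivrMr; last lra.
    by nra.
  have p0 : 0 <= n%:R * (C / s + C' * s `^ (- (beta + 1))).
    apply: mulr_ge0 => //; apply: addr_ge0; first by apply: divr_ge0; exact: ltW.
    by apply: mulr_ge0; [exact: ltW|exact: powR_ge0].
  have ke0 : 0 <= k * (eps / 4) by rewrite mulr_ge0 ?ltW//; lra.
  have H := @upper_ok_prob R F n (s `^ tau^-1) _ k (k * (eps / 4)) k
    (fun x sx Fx => pareto_class_bounds t0 b0 C0 C'0 s0 FC sx Fx) k0 ke0.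
  apply: le_trans (H _ _ np) _; [lra|lra|].
  rewrite lee_fin ler_expR lerN2.
  have -> : (k * (eps / 4)) ^+ 2 / (8 * k) = k * eps ^+ 2 / 128 by field; lra.
  rewrite ler_pM2r// ler_pM2r ?exprn_gt0// /k ler_peMl ?divr_ge0 ?(ltW T0)//.
  by case: a12 => ->; lra.
have lo a : a = 1 \/ a = 2 -> (sample_prob F n
    (~` [set X | lower_ok X ((C * T * (1 - eps) / a) `^ tau^-1) (a * (n%:R / T))]) <= E%:E)%E.
  move=> a12; have a0 : 0 < a by case: a12 => ->; lra.
  set s := C * T * (1 - eps) / a; set k := a * (n%:R / T).
  have s0 : 0 < s by rewrite /s divr_gt0 ?mulr_gt0//; lra.
  have k0 : 0 < k by rewrite mulr_gt0 ?divr_gt0.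
  have Ts : C * T / 4 <= s.
    rewrite /s; have : 0 < C * T by rewrite mulr_gt0.
    by case: a12 => -> ?; nra.
  have np : k + k * (eps / 2) <= n%:R * (C / s - C' * s `^ (- (beta + 1))).
    have -> : n%:R * (C / s - C' * s `^ (- (beta + 1))) =
        n%:R / s * (C - C' * s `^ (- beta)).
      by rewrite -(powRN1D beta s0); field; lra.
    have ns : n%:R / s = k / (C * (1 - eps)).
      by rewrite /s /k; field; do ! (apply/andP; split); lra.
    have H : n%:R / s * (C - C * (eps / 4)) <= n%:R / s * (C - C' * s `^ (- beta)).
      apply: ler_wpM2l; first by rewrite divr_ge0 ?ltW.
      by apply: lerB => //; exact: Hs.
    apply: le_trans H.
    have -> : n%:R / s * (C - C * (eps / 4)) = k * ((1 - eps / 4) / (1 - eps)).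
      by rewrite ns; field; do ! (apply/andP; split); lra.
    rewrite -[X in X + _]mulr1 -mulrDr ler_pM2l// ler_pdivlMr; last lra.
    by nra.
  have ke0 : 0 <= k * (eps / 2) by rewrite mulr_ge0 ?ltW//; lra.
  have H := @lower_ok_prob R F n (s `^ tau^-1) _ (k * (eps / 2)) k
    (pareto_class_lower t0 s0 FC) ke0.
  apply: le_trans (H _ np) _; first lra.
  rewrite lee_fin ler_expR lerN2.
  have -> : (k * (eps / 2)) ^+ 2 / (8 * (k + k * (eps / 2))) =
    k * eps ^+ 2 / (32 * (1 + eps / 2)) by field; do ! (apply/andP; split); lra.
  apply: (@le_trans _ _ (k * eps ^+ 2 / 128)).
    rewrite ler_pM2r// ler_pM2r ?exprn_gt0// /k ler_peMl ?divr_ge0 ?(ltW T0)//.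
    by case: a12 => ->; lra.
  apply: ler_wpM2l; first by rewrite mulr_ge0 ?sqr_ge0 ?(ltW k0).
  by rewrite lef_pV2 ?posrE; lra.
pose U a : set (n.-tuple (measurableTypeR R)) :=
  ~` [set X | upper_ok X ((C * T * (1 + eps) / a) `^ tau^-1) (a * (n%:R / T))].
pose L a : set (n.-tuple (measurableTypeR R)) :=
  ~` [set X | lower_ok X ((C * T * (1 - eps) / a) `^ tau^-1) (a * (n%:R / T))].
have mU a : measurable (U a) by apply: measurableC; exact: measurable_upper_ok.
have mL a : measurable (L a) by apply: measurableC; exact: measurable_lower_ok.
have UL a : a = 1 \/ a = 2 -> (sample_prob F n (U a `|` L a) <= (2 * E)%:E)%E.
  move=> a12; apply: le_trans (measureU2 _ (mU a) (mL a)) _.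
  have -> : 2 * E = E + E by ring.
  by rewrite EFinD leeD ?up ?lo.
have mUL a : measurable (U a `|` L a) by exact: measurableU.
have sub : ~` [set X : n.-tuple (measurableTypeR R) | special_ok X tau C T eps] `<=`
    (U 1 `|` L 1) `|` (U 2 `|` L 2).
  move=> X /= nS; apply: contrapT => /not_orP[H1 H2]; apply: nS => a [] ->.
    by move/not_orP : H1 => [/contrapT ? /contrapT ?].
  by move/not_orP : H2 => [/contrapT ? /contrapT ?].
apply: (@le_trans _ _ (sample_prob F n ((U 1 `|` L 1) `|` (U 2 `|` L 2)))).
  rewrite le_measure ?inE//; last exact: measurableU.
  pose V a : set (n.-tuple (measurableTypeR R)) := ~` U a `&` ~` L a.
  rewrite (_ : ~` _ = ~` (V 1 `&` V 2)).
    by apply: measurableC; apply: measurableI; apply: measurableI;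
      apply: measurableC.
  congr (~` _); rewrite /V /U /L !setCK; apply/seteqP; split => X /=.
    by move=> H; split; apply: H; [left|right].
  by move=> [H1 H2] a [] ->.
apply: le_trans (measureU2 _ (mUL 1) (mUL 2)) _.
have -> : 4 * E = 2 * E + 2 * E by ring.
by rewrite EFinD leeD ?UL//; [left|right].
Qed.

Lemma deviation_prob F n x (v : R) : (0 < n)%N -> 0 < v -> n%:R * (1 - F x) <= v ->
  forall dv : R, 0 < dv -> dv <= v ->
  (sample_prob F n [set X | (dv < `|exceed X x - n%:R * (1 - F x)|)%R] <=
   (2 * expR (- (dv ^+ 2 / (8 * v))))%:E)%E.
Proof.
move=> n0 v0 nv dv dv0 dvv; set p := n%:R * (1 - F x) in nv *.
have p0 : 0 <= p by rewrite mulr_ge0// subr_ge0 dfun_le1.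
pose A := [set X : n.-tuple (measurableTypeR R) | p + dv <= exceed X x].
pose B := [set X : n.-tuple (measurableTypeR R) | exceed X x <= p - dv].
have PA := binomial_upper_tail v0 (ltW dv0) dvv nv (lexx (p + dv)).
have PB : (sample_prob F n B <= (expR (- (dv ^+ 2 / (8 * v))))%:E)%E.
  have [pE|pN] := eqVneq p 0.
    rewrite (_ : B = set0) ?measure0 ?lee_fin ?expR_ge0//.
    apply/seteqP; split => // X /=; rewrite /B/= pE => Xd.
    by have := exceed_ge0 X x; lra.
  have pdE : p - dv + dv = p by ring.
  have pp : 0 < p by rewrite lt_neqAle eq_sym pN.
  have := @binomial_lower_tail R F n x (p - dv) dv (ltW dv0).
  rewrite pdE => /(_ pp (lexx _)) /le_trans; apply.
  rewrite lee_fin ler_expR lerN2 ler_wpM2l ?sqr_ge0// lef_pV2 ?posrE.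
  - by rewrite ler_pM2l.
  - by rewrite mulr_gt0.
  - by rewrite mulr_gt0.
have mA : measurable A by exact: measurable_exceed_ge.
have mB : measurable B by exact: measurable_exceed_le.
apply: (@le_trans _ _ (sample_prob F n (A `|` B))).
  rewrite le_measure ?inE//; [exact: measurable_exceed_dev|exact: measurableU|].
  move=> X /=; rewrite ltr_normr => /orP[H|H]; [left|right]; rewrite /A/B/=; lra.
apply: le_trans (measureU2 _ mA mB) _.
have -> : forall e : R, 2 * e = e + e by move=> e; ring.
by rewrite EFinD leeD.
Qed.

(** Since [s >= 1] the mean is at most [(C + C') * n / s], and [ln n^2 <= n / s] gives
    [deviation n s <= n / s]. In the exponent [n / s] cancels, so the bound does not depend on the
    grid point. *)
Lemma grid_prob tau beta C (C' : R) F n s K :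
  (0 < n)%N -> 0 < tau -> 0 < beta -> 0 < C -> 0 < C' -> 1 <= s ->
  C + C' + 1 <= K -> 0 < ln (n%:R : R) -> ln n%:R ^+ 2 <= n%:R / s ->
  pareto_class tau beta C C' F ->
  (sample_prob F n (~` [set X | grid_ok X tau C beta C' s]) <=
   (2 * expR (- (ln n%:R ^+ 2 / (8 * K))))%:E)%E.
Proof.
move=> n0 t0 b0 C0 C'0 s1 CK L0 Ls FC.
have n0' : 0 < n%:R :> R by rewrite ltr0n.
have s0 : 0 < s by exact: lt_le_trans s1.
have ns0 : 0 < n%:R / s by rewrite divr_gt0.
have K0 : 0 < K by lra.
set dv := deviation n s.
have dv0 : 0 < dv by rewrite mulr_gt0 ?sqrtr_gt0.
have dv2 : dv ^+ 2 = ln n%:R ^+ 2 * (n%:R / s).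
  by rewrite exprMn sqr_sqrtr// ltW.
have dvn : dv <= n%:R / s.
  have Lx : ln n%:R <= Num.sqrt (n%:R / s).
    by rewrite -[leLHS](gtr0_norm L0) -sqrtr_sqr ler_sqrt// ltW.
  apply: (@le_trans _ _ (Num.sqrt (n%:R / s) * Num.sqrt (n%:R / s))).
    by rewrite /dv /deviation ler_wpM2r ?sqrtr_ge0.
  by rewrite -expr2 sqr_sqrtr ?(ltW ns0).
have sb : s `^ (- (beta + 1)) <= s^-1.
  rewrite -powR_inv1 ?(ltW s0)//; apply: ler_powR => //; lra.
have p1 : n%:R * (C / s + C' * s `^ (- (beta + 1))) <= (C + C') * (n%:R / s).
  have -> : (C + C') * (n%:R / s) = n%:R * (C / s + C' * s^-1) by ring.
  by rewrite ler_pM2l// lerD2l ler_pM2l.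
set E := expR _.
have EE v : 0 < v -> v <= K * (n%:R / s) -> expR (- (dv ^+ 2 / (8 * v))) <= E.
  move=> v0 vK; rewrite ler_expR lerN2 dv2.
  move: (n%:R / s) ns0 vK => x x0 vK.
  have -> : ln n%:R ^+ 2 / (8 * K) = ln n%:R ^+ 2 * x / (8 * (K * x)).
    by field; rewrite !gt_eqF.
  apply: ler_wpM2l; first by rewrite mulr_ge0 ?sqr_ge0 ?(ltW x0).
  by rewrite lef_pV2 ?posrE ?mulr_gt0// ler_pM2l.
have up : (sample_prob F n (~` [set X | upper_ok X (s `^ tau^-1)
    (n%:R * (C / s + C' * s `^ (- (beta + 1))) + dv)]) <= E%:E)%E.
  set p := C / s + _; set k := n%:R * p + dv.
  have p0 : 0 <= n%:R * p.
    apply: mulr_ge0 => //; apply: addr_ge0; first by apply: divr_ge0; exact: ltW.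
    by apply: mulr_ge0; [exact: ltW|exact: powR_ge0].
  have k0 : 0 < k by rewrite ltr_wpDl.
  have H := @upper_ok_prob R F n (s `^ tau^-1) _ k dv k
    (fun x sx Fx => pareto_class_bounds t0 b0 C0 C'0 s0 FC sx Fx) k0 (ltW dv0).
  apply: le_trans (H _ _ (lexx _)) _; [by rewrite lerDr|by rewrite lerDl ltW|].
  rewrite lee_fin EE//; apply: (@le_trans _ _ ((C + C' + 1) * (n%:R / s))).
    by rewrite mulrDl mul1r lerD.
  by rewrite ler_pM2r.
have lo : (sample_prob F n (~` [set X | lower_ok X (s `^ tau^-1)
    (n%:R * (C / s - C' * s `^ (- (beta + 1))) - dv)]) <= E%:E)%E.
  set p := C / s - _.
  (* A negative threshold makes the lower condition automatic. *)
  have [pdv|pdv] := ltP (n%:R * p) dv.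
    rewrite (_ : ~` _ = set0) ?measure0 ?lee_fin ?expR_ge0//.
    apply/seteqP; split => // X /=; apply; right.
    by rewrite (lt_le_trans _ (exceed_ge0 _ _))// subr_lt0.
  have pE : n%:R * p - dv + dv = n%:R * p by ring.
  have pp : 0 < n%:R * p by exact: lt_le_trans pdv.
  have := @lower_ok_prob R F n (s `^ tau^-1) _ dv (n%:R * p - dv)
    (pareto_class_lower t0 s0 FC) (ltW dv0).
  rewrite pE => /(_ pp (lexx _)) /le_trans; apply.
  rewrite lee_fin EE//; apply: (@le_trans _ _ ((C + C' + 1) * (n%:R / s))).
    apply: le_trans (_ : C * (n%:R / s) <= _); last by rewrite ler_pM2r//; lra.
    rewrite [leRHS]mulrCA ler_pM2l// gerBl mulr_ge0 ?powR_ge0// ltW//.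
  by rewrite ler_pM2r.
set U : set (n.-tuple (measurableTypeR R)) := ~` _ in up.
set L : set (n.-tuple (measurableTypeR R)) := ~` _ in lo.
have mU : measurable U by apply: measurableC; exact: measurable_upper_ok.
have mL : measurable L by apply: measurableC; exact: measurable_lower_ok.
apply: (@le_trans _ _ (sample_prob F n (U `|` L))).
  rewrite le_measure ?inE//; [|exact: measurableU|].
    by apply: measurableC; apply: measurableI;
      [exact: measurable_upper_ok|exact: measurable_lower_ok].
  by move=> X /=; rewrite /grid_ok not_andP.
apply: le_trans (measureU2 _ mU mL) _.
 have -> : 2 * E = E + E by ring.
by rewrite EFinD leeD.
Qed.

End acceptance_probability.

(** * Scales, rates and the size of the sample *)

Section rates.
Context {R : realType}.
Implicit Types (n : nat) (b B xi beta tau C : R).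

Section scale_rate.
Context (n : nat) (n0 : (0 < n)%N).
Let n0' : 0 < n%:R :> R. Proof. by rewrite ltr0n. Qed.
Let n1 : 1 <= n%:R :> R. Proof. by rewrite ler1n. Qed.

Lemma scale_gt0 beta : 0 < scale n beta.
Proof. exact: powR_gt0. Qed.

Lemma rate_gt0 beta : 0 < rate n beta.
Proof. exact: powR_gt0. Qed.

Lemma scale_ge1 beta : 0 < beta -> 1 <= scale n beta.
Proof.
move=> b0; rewrite -(powRr0 n%:R); apply: ler_powR => //.
by rewrite invr_ge0; lra.
Qed.

Lemma rate_scale beta : 0 < beta -> scale n beta `^ (- beta) = rate n beta.
Proof. by move=> b0; rewrite -powRrM; congr (_ `^ _); field; lra. Qed.

Lemma scale_div beta : 0 < beta -> scale n beta / n%:R = rate n beta ^+ 2.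
Proof.
move=> b0; rewrite -powR_mulrn ?powR_ge0// -powRrM.
rewrite -[X in _ / X](powRr1 (ltW n0')) -powRB; last first.
  by rewrite (gt_eqF n0') implybT.
by congr (_ `^ _); field; lra.
Qed.

Lemma rate_le b beta : 0 < b -> b <= beta -> rate n beta <= rate n b.
Proof.
move=> b0 bb; apply: ler_powR => //; rewrite lerN2.
rewrite ler_pdivrMr; last lra.
rewrite mulrAC ler_pdivlMr; last lra.
by lra.
Qed.

Lemma scale_le b beta : 0 < b -> b <= beta -> scale n beta <= scale n b.
Proof.
by move=> b0 bb; apply: ler_powR => //; rewrite lef_pV2 ?posrE; lra.
Qed.

Lemma rate_le1 beta : 0 < beta -> rate n beta <= 1.
Proof.
move=> b0; rewrite -(powRr0 n%:R); apply: ler_powR => //.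
by rewrite oppr_le0 divr_ge0//; lra.
Qed.

Lemma invn_le_rate beta : 0 < beta -> n%:R^-1 <= rate n beta.
Proof.
move=> b0; rewrite -powR_inv1 ?(ltW n0')//; apply: ler_powR => //.
rewrite lerN2 ler_pdivrMr; lra.
Qed.

Lemma ln_scale beta : 0 < beta -> 0 <= ln (scale n beta) <= ln n%:R.
Proof.
move=> b0; have L0 : 0 <= ln (n%:R : R) by exact: ln_ge0.
rewrite ln_powR; apply/andP; split; first by rewrite mulr_ge0// invr_ge0; lra.
by rewrite ler_piMl// invf_le1; lra.
Qed.

End scale_rate.

Lemma beta_grid_bounds b B xi n i : b < B -> (0 < nb_classes xi n)%N ->
  (i <= nb_classes xi n)%N -> b <= beta_grid b B xi n i <= B.
Proof.
move=> bB M0 iM; rewrite /beta_grid.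
have M0' : 0 < (nb_classes xi n)%:R :> R by rewrite ltr0n.
have H : i%:R * (B - b) / (nb_classes xi n)%:R <= B - b.
  by rewrite ler_pdivrMr// mulrC ler_pM2l ?subr_gt0// ler_nat.
have H0 : 0 <= i%:R * (B - b) / (nb_classes xi n)%:R.
  by rewrite divr_ge0 ?mulr_ge0 ?subr_ge0// ltW.
by apply/andP; split; lra.
Qed.

Lemma beta_grid_le b B xi n i j : b < B -> (i <= j)%N ->
  beta_grid b B xi n j <= beta_grid b B xi n i.
Proof.
move=> bB ij; rewrite /beta_grid lerB// ler_wpM2r ?invr_ge0//.
by rewrite ler_pM2r ?subr_gt0// ler_nat.
Qed.

(* How large n has to be, uniformly over the model; here l = ln (ln n). *)
Record large_enough (alpha b B C' xi c0 c1 : R) (n : nat) : Prop := LargeEnough {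
  large_n : (0 < n)%N;
  large_ln : 1 <= ln (n%:R : R);
  large_lnln : 256 <= ln (ln (n%:R : R));
  large_eps : ln (ln n%:R) * rate n b <= 1 / 40;
  large_bias : 4 * C' * (Num.min 1 (c0 / 4)) `^ (- B) <= c0 * ln (ln n%:R);
  large_scale : 4 <= c0 * scale n B;
  large_grid : 4 * ln n%:R ^+ 2 * rate n b ^+ 2 <= 1;
  large_lnc0 : - ln n%:R <= ln c0;
  large_lnc1 : ln c1 <= ln n%:R;
  large_eta : (54 * (B + 1) * (ln (ln n%:R) * ln n%:R) + (B + 1)) * rate n b <= 1 / 2;
  large_gap : 2 * (110 * (B + 1) * (c1 + C') + 3) * ln (ln n%:R) <=
    ln (ln n%:R) `^ (3 / 2);
  large_cut : 2 * C' * (Num.min 1 (c0 / 4)) `^ (- B) <=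
    ln n%:R * ln (ln n%:R) `^ (3 / 2);
  large_xi : 2 * xi <= ln n%:R;
  large_dev : 32 * (c1 + C' + 1) <= ln n%:R;
  large_alpha : 4 / xi + 17 <= alpha * ln n%:R }.

(** With [g = min 1 (c0 / 4)], [s >= g * T] for every admissible [C], and [g <= 1] allows the
    exponent [B] in place of [beta]: the bias bound is uniform over the model. *)
Lemma bias_bound (B c0 beta beta' C T s c : R) :
  0 < c0 -> c0 <= C -> 0 < beta' -> beta' <= beta -> beta <= B -> 1 <= T ->
  0 <= c -> C * T / 4 <= s ->
  c * s `^ (- beta) <= c * (Num.min 1 (c0 / 4)) `^ (- B) * T `^ (- beta').
Proof.
move=> c00 cC b'0 bb bB T1 cc Ts; rewrite -mulrA ler_wpM2l//.
have b0 : 0 < beta by exact: lt_le_trans bb.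
set g := Num.min 1 (c0 / 4).
have g0 : 0 < g by rewrite lt_min ltr01 divr_gt0.
have g1 : g <= 1 by rewrite ge_min lexx.
have gc : g <= c0 / 4 by rewrite ge_min lexx orbT.
have T0 : 0 < T by exact: lt_le_trans T1.
have gTs : g * T <= s.
  apply: le_trans Ts; rewrite mulrAC ler_pM2r//.
  by apply: le_trans gc _; rewrite ler_pM2r.
apply: (@le_trans _ _ ((g * T) `^ (- beta))).
  rewrite !powRN lef_pV2 ?posrE ?powR_gt0 ?mulr_gt0//.
    apply: ge0_ler_powR; rewrite ?nnegrE ?(ltW b0) ?mulr_ge0 ?(ltW g0) ?(ltW T0)//.
    by rewrite (le_trans _ gTs)// mulr_ge0 ?ltW.
  by rewrite (lt_le_trans _ gTs)// mulr_gt0.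
rewrite powRM ?(ltW g0) ?(ltW T0)//; apply: ler_pM; rewrite ?powR_ge0//.
  by apply: ger_powR; rewrite ?g0 ?g1// lerN2.
by apply: ler_powR; rewrite ?T1// lerN2.
Qed.

End rates.

Section acceptance_and_rejection.
Context {R : realType}.
Context (alpha b B C' xi c0 c1 : R) (n : nat).
Context (b0 : 0 < b) (bB : b < B) (C'0 : 0 < C') (xi0 : 0 < xi) (c00 : 0 < c0).
Context (H : large_enough alpha b B C' xi c0 c1 n).
Implicit Types (F : @distribution_function R) (tau C beta s : R).

Local Notation L := (ln (n%:R : R)).
Local Notation l := (ln (ln (n%:R : R))).
Local Notation M := (nb_classes xi n).
Local Notation beta_ := (beta_grid b B xi n).

Let n0 : (0 < n)%N := large_n H.
Let n0' : 0 < n%:R :> R. Proof. by rewrite ltr0n n0. Qed.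
Let L0 : 0 < L. Proof. exact: lt_le_trans (large_ln H). Qed.
Let l0 : 0 < l. Proof. by apply: lt_le_trans (large_lnln H); rewrite ltr0n. Qed.
Let B0 : 0 < B. Proof. exact: lt_trans bB. Qed.

(** Rounding down loses less than half once [L / xi >= 2]. This factor [2], times the two grid steps
    of error, gives the constant [4 * xi] of the theorem. *)
Lemma nb_classes_gt : L / (2 * xi) < M%:R.
Proof.
have Lx : 0 <= L / xi by rewrite divr_ge0 ?(ltW L0) ?(ltW xi0).
have /andP[_] := truncn_itv Lx; rewrite -/(nb_classes xi n) -natr1.
have -> : L / xi = 2 * (L / (2 * xi)) by field; rewrite gt_eqF.
have : 1 <= L / (2 * xi) by rewrite ler_pdivlMr ?mulr_gt0// mul1r (large_xi H).
lra.
Qed.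

Lemma nb_classes_gt0 : (0 < M)%N.
Proof.
rewrite -(ltr0n R); apply: lt_trans nb_classes_gt.
by rewrite divr_gt0 ?mulr_gt0.
Qed.

Lemma nb_classes_le : M%:R <= L / xi.
Proof.
have Lx : 0 <= L / xi by rewrite divr_ge0 ?ltW.
by have /andP[] := truncn_itv Lx.
Qed.

Let bet i : (i <= M)%N -> b <= beta_ i <= B.
Proof. exact: beta_grid_bounds bB nb_classes_gt0. Qed.

Lemma tolerance_bounds beta : b <= beta -> 0 < tolerance n beta <= 1 / 40.
Proof.
move=> bb; rewrite mulr_gt0 ?rate_gt0//=.
by apply: le_trans (large_eps H); rewrite ler_pM2l// rate_le.
Qed.

Lemma scale_le_n beta : 0 < beta -> scale n beta <= n%:R.
Proof.
move=> be0; rewrite -[leRHS](powRr1 (ltW n0')); apply: ler_powR; first by rewrite ler1n.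
by rewrite invf_le1; lra.
Qed.

Lemma grid_size (m : nat) : 1 + m%:R / n%:R <= 4 * scale n b :> R -> (m < 5 * n ^ 2)%N.
Proof.
move=> mS; have : m%:R / n%:R <= 4 * n%:R :> R.
  by have := scale_le_n b0; lra.
rewrite ler_pdivrMr// -mulrA -natrM -natrM ler_nat => mn.
apply: leq_ltn_trans mn _; rewrite -mulnn ltn_pmul2r ?muln_gt0 ?n0//.
Qed.

Lemma measurable_specials j tau C :
  measurable [set X : n.-tuple (measurableTypeR R) | forall i, (j <= i <= M)%N ->
    special_ok X tau C (scale n (beta_ i)) (tolerance n (beta_ i))].
Proof.
apply: (@measurable_forall_nat _ _ (fun i => (j <= i <= M)%N)
  (fun i => [set X : n.-tuple (measurableTypeR R) | special_ok X tau C
        (scale n (beta_ i)) (tolerance n (beta_ i))])) => i.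
exact: measurable_special_ok.
Qed.

Lemma measurable_grids j tau C :
  measurable [set X : n.-tuple (measurableTypeR R) | forall m : nat,
    1 + m%:R / n%:R <= 4 * scale n b ->
    grid_ok X tau C (beta_ j) C' (1 + m%:R / n%:R)].
Proof.
apply: (@measurable_forall_nat _ _ (fun m => is_true (1 + m%:R / n%:R <= 4 * scale n b))
    (fun m => [set X : n.-tuple (measurableTypeR R) | grid_ok X tau C
      (beta_ j) C' (1 + m%:R / n%:R)])) => m.
by apply: measurableI; [exact: measurable_upper_ok|exact: measurable_lower_ok].
Qed.

Lemma sqr_ln_le_div s : 0 < s -> s <= 4 * scale n b -> L ^+ 2 <= n%:R / s.
Proof.
move=> s0 sS; have S0 := scale_gt0 n0 b.
apply: (@le_trans _ _ (n%:R / (4 * scale n b))); last first.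
  by rewrite ler_pM2l// lef_pV2 ?posrE ?mulr_gt0.
rewrite ler_pdivlMr ?mulr_gt0//.
have := large_grid H; rewrite -(scale_div n0 b0) mulrA ler_pdivrMr// mul1r.
by have -> : L ^+ 2 * (4 * scale n b) = 4 * L ^+ 2 * scale n b by ring.
Qed.

(** The true [tau] and [C] pass all tests. At a smaller level [beta_ i] the bias is a constant times
    [rate n (beta_ i)], absorbed by the [ln (ln n)] in the tolerance; [n / T = rate^(-2)] then
    reduces the Chernoff exponent to [l^2 / 128]. *)
Lemma fitting_prob F tau C j : 0 < tau -> c0 <= C -> C <= c1 -> (j <= M)%N ->
  pareto_class tau (beta_ j) C C' F ->
  let A := [set X : n.-tuple (measurableTypeR R) | forall i, (j <= i <= M)%N ->
    special_ok X tau C (scale n (beta_ i)) (tolerance n (beta_ i))] in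
  let G := [set X : n.-tuple (measurableTypeR R) | forall m : nat,
    1 + m%:R / n%:R <= 4 * scale n b ->
    grid_ok X tau C (beta_ j) C' (1 + m%:R / n%:R)] in
  (sample_prob F n (~` A `|` ~` G) <=
   (M.+1%:R * (4 * expR (- (l ^+ 2 / 128))) +
    (5 * n ^ 2)%:R * (2 * expR (- (L ^+ 2 / (8 * (c1 + C' + 1))))))%:E)%E.
Proof.
move=> t0 c0C Cc1 jM FC; cbv zeta.
have C0 : 0 < C by exact: lt_le_trans c0C.
have /andP[bj Bj] := bet jM.
have bj0 : 0 < beta_ j by exact: lt_le_trans bj.
apply: le_trans (measureU2 _ _ _) _.
- by apply: measurableC; exact: measurable_specials.
- by apply: measurableC; exact: measurable_grids.
rewrite EFinD leeD//.
  apply: (@prob_forall_nat R _ _ (sample_prob F n) (fun i => (j <= i <= M)%N)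
    (fun i => [set X | special_ok X tau C (scale n (beta_ i)) (tolerance n (beta_ i))])).
  - by rewrite mulr_ge0// expR_ge0.
  - by move=> i; exact: measurable_special_ok.
  - by move=> i /andP[_].
  move=> i /andP[ji iM]; have /andP[bi Bi] := bet iM.
  have bi0 : 0 < beta_ i by exact: lt_le_trans bi.
  have /andP[e0 e1] := tolerance_bounds bi.
  have e2 : 0 < tolerance n (beta_ i) <= 1 / 2 by rewrite e0/=; lra.
  have S0 := scale_gt0 n0 (beta_ i).
  apply: le_trans (special_prob n0 t0 bj0 C0 C'0 S0 e2 FC _) _.
    move=> s sS; have := bias_bound c00 c0C bi0 (beta_grid_le xi n bB ji) Bj
      (scale_ge1 n0 bi0) (ltW C'0) sS.
    rewrite (rate_scale n bi0) => /le_trans; apply.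
    have r0 : 0 < rate n (beta_ i) by exact: powR_gt0.
    have -> : C * (tolerance n (beta_ i) / 4) = C * l / 4 * rate n (beta_ i).
      by rewrite /tolerance; ring.
    rewrite ler_pM2r//; have := large_bias H.
    have : c0 * l <= C * l by rewrite ler_pM2r.
    lra.
  rewrite lee_fin ler_pM2l// ler_expR lerN2 ler_pM2r//.
  rewrite /tolerance exprMn -(scale_div n0 bi0).
  have -> : n%:R / scale n (beta_ i) * (l ^+ 2 * (scale n (beta_ i) / n%:R)) = l ^+ 2.
    by field; rewrite !gt_eqF.
  by [].
apply: (@prob_forall_nat R _ _ (sample_prob F n)
    (fun m => is_true (1 + m%:R / n%:R <= 4 * scale n b))
    (fun m => [set X | grid_ok X tau C (beta_ j) C' (1 + m%:R / n%:R)])).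
- by rewrite mulr_ge0// expR_ge0.
- by move=> m; apply: measurableI; [exact: measurable_upper_ok|exact: measurable_lower_ok].
- exact: grid_size.
move=> m mS.
have s1 : 1 <= 1 + m%:R / n%:R :> R by rewrite lerDl divr_ge0.
apply: (grid_prob n0 t0 bj0 C0 C'0 s1 _ L0 _ FC).
  by rewrite !lerD2r.
by apply: sqr_ln_le_div => //; exact: lt_le_trans s1.
Qed.

Lemma fitting_accepted tau C j (X : n.-tuple R) : 0 < tau -> c0 <= C -> (j <= M)%N ->
  (forall i, (j <= i <= M)%N ->
    special_ok X tau C (scale n (beta_ i)) (tolerance n (beta_ i))) ->
  (forall m : nat, 1 + m%:R / n%:R <= 4 * scale n b ->
    grid_ok X tau C (beta_ j) C' (1 + m%:R / n%:R)) ->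
  accepted b B C' xi j X.
Proof.
move=> t0 c0C jM S G; have C0 : 0 < C by exact: lt_le_trans c0C.
have HT i : (j <= i <= M)%N -> [/\ 0 < scale n (beta_ i),
    0 <= tolerance n (beta_ i) < 1 &
    1 <= C * scale n (beta_ i) * (1 - tolerance n (beta_ i)) / 2].
  move=> /andP[ji iM]; have /andP[bi Bi] := bet iM.
  have /andP[e0 e1] := tolerance_bounds bi.
  split; [exact: scale_gt0|by rewrite (ltW e0)/=; lra|].
  have S1 : scale n B <= scale n (beta_ i).
    by apply: scale_le => //; exact: lt_le_trans bi.
  have S0 := scale_gt0 n0 B.
  have : c0 * scale n B <= C * scale n (beta_ i) by apply: ler_pM => //; exact: ltW.
  have := large_scale H.
  move: (C * scale n (beta_ i)) (c0 * scale n B) (tolerance n (beta_ i)) e0 e1.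
  by move=> u v e e0 e1 v4 vu; rewrite ler_pdivlMr//; nra.
have Hs (m : nat) : 1 + m%:R / n%:R <= 4 * scale n b -> 1 <= 1 + m%:R / n%:R :> R.
  by move=> _; rewrite lerDl divr_ge0.
have [r1 [r2 [r10 r20 S' G']]] := @fits_rational R n X tau C (beta_ j) C'
  (fun i => (j <= i <= M)%N) (fun m => is_true (1 + m%:R / n%:R <= 4 * scale n b))
  (fun i => scale n (beta_ i)) (fun i => tolerance n (beta_ i))
  (fun m => 1 + m%:R / n%:R) (M.+1 + 5 * n ^ 2) t0 C0
  (fun i ji => leq_trans (proj2 (andP ji) : (i < M.+1)%N) (leq_addr _ _))
  (fun m mS => leq_trans (grid_size mS) (leq_addl _ _)) HT Hs S G.
by exists r1, r2.
Qed.

End acceptance_and_rejection.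

(** * Rejection of the higher levels *)

(** The sequence [rho] of the theorem. It exceeds the error [ln n * ln (ln n) * rate] of a competing
    fit by a square root of [ln (ln n)]. *)
Definition separation {R : realType} (n : nat) (beta : R) : R :=
  ln n%:R * ln (ln n%:R) `^ (3 / 2) * rate n beta.

Section error_bound.
Context {R : realType}.
Context (alpha b B C' xi c0 c1 : R) (n : nat).
Context (b0 : 0 < b) (bB : b < B) (C'0 : 0 < C') (xi0 : 0 < xi) (c00 : 0 < c0).
Context (H : large_enough alpha b B C' xi c0 c1 n).
Implicit Types (F : @distribution_function R) (tau C beta s t w : R).

Local Notation L := (ln (n%:R : R)).
Local Notation l := (ln (ln (n%:R : R))).
Local Notation M := (nb_classes xi n).
Local Notation beta_ := (beta_grid b B xi n).

Let n0 : (0 < n)%N := large_n H.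
Let n0' : 0 < n%:R :> R. Proof. by rewrite ltr0n n0. Qed.
Let L0 : 0 < L. Proof. exact: lt_le_trans (large_ln H). Qed.
Let l0 : 0 < l. Proof. by apply: lt_le_trans (large_lnln H); rewrite ltr0n. Qed.
Let B0 : 0 < B. Proof. exact: lt_trans bB. Qed.

Lemma separation_gt0 beta : 0 < separation n beta.
Proof. by rewrite /separation !mulr_gt0 ?powR_gt0. Qed.

(** * The point that exhibits the separation *)

Section witness.
Context (F : @distribution_function R) (tau C : R) (w t beta beta' : R).
Context (t0 : 0 < tau) (c0C : c0 <= C) (Cc1 : C <= c1).
Context (bb' : b <= beta') (bb : beta' <= beta) (bB' : beta <= B).
Context (FC : pareto_class tau beta' C C' F).
Context (w0 : 0 < w) (tE : t = w `^ tau) (t1 : 1 < t).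
Context (Fw : separation n beta' / 2 <= F w * t).
Context (W : C' * t `^ (- beta) + separation n beta' / 2 < `|t * (1 - F w) - C|).

Let C0 : 0 < C. Proof. exact: lt_le_trans c0C. Qed.
Let b'0 : 0 < beta'. Proof. exact: lt_le_trans bb'. Qed.
Let t_gt0 : 0 < t. Proof. exact: lt_trans t1. Qed.
Let T := scale n beta'.
Let T0 : 0 < T. Proof. exact: scale_gt0. Qed.
Let d := rate n beta'.
Let d0 : 0 < d. Proof. exact: rate_gt0. Qed.

Let Fw0 : 0 < F w.
Proof.
rewrite -(pmulr_lgt0 _ t_gt0); apply: lt_le_trans Fw.
by rewrite divr_gt0// separation_gt0.
Qed.

Let scaled : `|t * (1 - F w) - C| <= C' * t `^ (- beta').
Proof. by rewrite tE; exact: pareto_class_scaled FC w0 Fw0. Qed.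

(** Beyond this scale the envelope of [beta'] has shrunk to at most half the separation, while the
    witness exceeds that half. The factor [c0 / 4] yields [t <= C * T / 4], as the comparison of
    parameters demands. *)
Lemma witness_scale : t <= Num.min 1 (c0 / 4) * T.
Proof.
set g := Num.min 1 (c0 / 4).
have g0 : 0 < g by rewrite lt_min ltr01 divr_gt0.
have g1 : g <= 1 by rewrite ge_min lexx.
rewrite leNgt; apply/negP => gt.
have gT0 : 0 < g * T by rewrite mulr_gt0.
have H1 : t `^ (- beta') <= g `^ (- B) * d.
  apply: (@le_trans _ _ ((g * T) `^ (- beta'))).
    rewrite !powRN lef_pV2 ?posrE ?powR_gt0//.
    by apply: ge0_ler_powR; rewrite ?nnegrE; exact: ltW.
  rewrite powRM ?(ltW g0) ?(ltW T0)// (rate_scale n b'0) ler_pM2r//.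
  by apply: ger_powR; rewrite ?g0 ?g1// lerN2 (le_trans bb).
have H2 : C' * t `^ (- beta') <= C' * (g `^ (- B) * d) by rewrite ler_pM2l.
have H3 : 0 <= C' * t `^ (- beta) by rewrite mulr_ge0 ?powR_ge0// ltW.
have := le_lt_trans (lerD H3 (lexx (separation n beta' / 2))) (lt_le_trans W (le_trans scaled H2)).
rewrite add0r /separation -/d.
have -> : C' * (g `^ (- B) * d) = 2 * C' * g `^ (- B) * d / 2 by field.
rewrite ltr_pM2r ?invr_gt0// ltr_pM2r// ltNge => /negP; apply.
exact: large_cut H.
Qed.

Lemma witness_le_scale : t <= T.
Proof.
apply: le_trans witness_scale _; rewrite ler_piMl ?(ltW T0)//.
by rewrite ge_min lexx.
Qed.

Let tS : t <= 4 * scale n b.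
Proof.
apply: le_trans witness_le_scale _.
apply: (@le_trans _ _ (scale n b)); first by apply: scale_le.
by rewrite ler_peMl ?ler1n// ltW// scale_gt0.
Qed.

Let div_rate : n%:R / T = d ^- 2.
Proof.
by rewrite -[LHS]invrK invf_div (scale_div n0 b'0).
Qed.

Let lnln32 : 2 <= l `^ (3 / 2).
Proof.
have l1 := large_lnln H.
rewrite (@le_trans _ _ l)//; first lra.
by apply: le1r_powR; lra.
Qed.

(** The lower bound on [F w * t], with [t <= T], makes [n * F w] at least [L]: some observation
    falls at or before [w], and the escape clause of the conditions is closed off. *)
Lemma witness_all_prob :
  (sample_prob F n [set X | exceed X w = n%:R] <= (expR (- L))%:E)%E.
Proof.
rewrite exceed_all_prob lee_fin.
apply: (@le_trans _ _ (expR (- F w) ^+ n)).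
  rewrite lerXn2r ?nnegrE ?expR_ge0 ?subr_ge0 ?dfun_le1//.
  exact: expR_ge1Dx.
rewrite -expRM_natl ler_expR mulrN lerN2.
have H1 : separation n beta' / 2 <= F w * T.
  by apply: le_trans Fw _; rewrite ler_pM2l// witness_le_scale.
have H2 : n%:R / T * (separation n beta' / 2) <= n%:R * F w.
  have -> : n%:R * F w = n%:R / T * (F w * T) by field; rewrite gt_eqF.
  by rewrite ler_pM2l// divr_gt0.
apply: le_trans H2; rewrite div_rate /separation -/d.
have -> : d ^- 2 * (L * l `^ (3 / 2) * d / 2) = L * (l `^ (3 / 2) / 2) / d.
  by field; rewrite gt_eqF.
rewrite ler_pdivlMr// ler_pM2l//.
apply: (@le_trans _ _ 1); first exact: rate_le1.
by rewrite ler_pdivlMr// mul1r.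
Qed.

Lemma witness_deviation_prob :
  (sample_prob F n [set X | (deviation n t < `|exceed X w - n%:R * (1 - F w)|)%R] <=
   (2 * expR (- (L ^+ 2 / (8 * (c1 + C' + 1)))))%:E)%E.
Proof.
have nt0 : 0 < n%:R / t by rewrite divr_gt0.
have K0 : 0 < c1 + C' + 1 by move: (lt_le_trans C0 Cc1) C'0; lra.
set v := (c1 + C' + 1) * (n%:R / t).
have v0 : 0 < v by rewrite mulr_gt0.
have Ls := sqr_ln_le_div b0 H t_gt0 tS.
have Lx : L <= Num.sqrt (n%:R / t).
  by rewrite -[leLHS](gtr0_norm L0) -sqrtr_sqr ler_sqrt// ltW.
have dv2 : deviation n t ^+ 2 = L ^+ 2 * (n%:R / t).
  by rewrite exprMn sqr_sqrtr// ltW.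
have dv0 : 0 < deviation n t by rewrite mulr_gt0 ?sqrtr_gt0.
have dvn : deviation n t <= n%:R / t.
  apply: (@le_trans _ _ (Num.sqrt (n%:R / t) * Num.sqrt (n%:R / t))).
    by rewrite /deviation ler_wpM2r ?sqrtr_ge0.
  by rewrite -expr2 sqr_sqrtr ?(ltW nt0).
have nF : n%:R * (1 - F w) <= v.
  have tb1 : t `^ (- beta') <= 1.
    by rewrite -(powRr0 t); apply: ler_powR; [exact: ltW|rewrite oppr_le0 ltW].
  have tF : t * (1 - F w) <= c1 + C' + 1.
    move: scaled; rewrite ler_norml => /andP[_].
    have : C' * t `^ (- beta') <= C' by rewrite ler_piMr// ltW.
    move: Cc1; lra.
  have -> : n%:R * (1 - F w) = t * (1 - F w) * (n%:R / t).
    by field; rewrite gt_eqF.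
  by rewrite ler_pM2r.
have dvv : deviation n t <= v.
  apply: le_trans dvn _; rewrite ler_peMl ?(ltW nt0)//.
  by move: (lt_le_trans C0 Cc1) C'0; lra.
apply: le_trans (deviation_prob n0 v0 nF dv0 dvv) _.
rewrite lee_fin ler_pM2l// ler_expR lerN2 dv2 /v.
have -> : L ^+ 2 * (n%:R / t) / (8 * ((c1 + C' + 1) * (n%:R / t))) =
    L ^+ 2 / (8 * (c1 + C' + 1)).
  by field; rewrite !gt_eqF.
by [].
Qed.

(** The fit of a competing pair bounds the excess over the envelope by a constant times [l * L * d];
    the excess is more than half of [separation], which [large_gap] makes larger. *)
Lemma witness_incompatible (X : n.-tuple R) tau' C1 betaj :
  0 < tau' -> 0 < C1 -> beta <= betaj ->
  exceed X w != n%:R -> `|exceed X w - n%:R * (1 - F w)| <= deviation n t ->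
  special_ok X tau C T (tolerance n beta') ->
  special_ok X tau' C1 T (tolerance n beta') ->
  (forall m : nat, 1 + m%:R / n%:R <= 4 * scale n b ->
    grid_ok X tau' C1 betaj C' (1 + m%:R / n%:R)) -> False.
Proof.
move=> t'0 C10 bbj wn wd S S' G.
have /andP[e0 e1] := tolerance_bounds b0 H bb'.
pose eta := 54 * (B + 1) * (tolerance n beta' * L) + (B + 1) / n%:R.
have dL : d <= rate n b by exact: rate_le.
have nd : n%:R^-1 <= d by exact: invn_le_rate.
have etaE : eta <= (54 * (B + 1) * (l * L) + (B + 1)) * d.
  have -> : (54 * (B + 1) * (l * L) + (B + 1)) * d =
    54 * (B + 1) * (tolerance n beta' * L) + (B + 1) * d.
    by rewrite /tolerance -/d; ring.
  by rewrite lerD2l ler_pM2l//; move: B0; lra.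
have lL1 : 1 <= l * L.
  by have := large_lnln H; have := large_ln H; nra.
have c540 : 0 <= 54 * (B + 1) * (l * L) + (B + 1).
  have : 0 <= (B + 1) * (l * L) by rewrite mulr_ge0//; move: B0 lL1; lra.
  by move: B0; lra.
have eta2 : eta <= 1 / 2.
  apply: le_trans etaE _; apply: le_trans (large_eta H).
  by rewrite ler_wpM2l.
have lnC : `|ln C| <= L.
  have : ln c0 <= ln C by rewrite ler_ln ?posrE.
  have : ln C <= ln c1 by rewrite ler_ln ?posrE//; exact: lt_le_trans Cc1.
  have := large_lnc0 H; have := large_lnc1 H.
  by rewrite ler_norml => *; apply/andP; split; lra.
have tCT : t <= C * T / 4.
  apply: le_trans witness_scale _; rewrite mulrAC ler_pM2r//.
  apply: (@le_trans _ _ (c0 / 4)); first by rewrite ge_min lexx orbT.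
  by rewrite ler_pM2r.
have eps1 : 0 <= tolerance n beta' <= 1 / 40 by rewrite (ltW e0) e1.
have beta0 : 0 < beta by exact: lt_le_trans bb.
have G3 (m : nat) : 1 + m%:R / n%:R <= 3 * T ->
    grid_ok X tau' C1 betaj C' (1 + m%:R / n%:R).
  move=> mT; apply: G; apply: le_trans mT _.
  have : T <= scale n b by exact: scale_le.
  by move: T0; lra.
have := special_grid_bound n0 t0 C0 t'0 C10 C'0 beta0 bbj bB' eps1 lnC (large_ln H)
  (ln_scale n0 b'0) T0 (lexx eta) eta2 w0 tE t1 witness_le_scale tCT wn wd S S' G3.
apply/negP; rewrite -ltNge; apply: le_lt_trans W.
rewrite -addrA lerD2l.
have nt0 : 0 < n%:R / t by rewrite divr_gt0.
(* The left side is [L * sqrt (t / n)], and [t <= T] with [T / n = d^2]. *)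
have dev : t / n%:R * deviation n t <= L * d.
  rewrite /deviation mulrCA ler_pM2l//.
  have x0 : 0 < Num.sqrt (n%:R / t) by rewrite sqrtr_gt0.
  have xd : d^-1 <= Num.sqrt (n%:R / t).
    rewrite -[leLHS]gtr0_norm ?invr_gt0// -sqrtr_sqr ler_sqrt ?(ltW nt0)//.
    rewrite exprVn -div_rate ler_pM2l// lef_pV2 ?posrE//.
    exact: witness_le_scale.
  have -> : t / n%:R * Num.sqrt (n%:R / t) = (Num.sqrt (n%:R / t))^-1.
    have -> : t / n%:R = (Num.sqrt (n%:R / t) ^+ 2)^-1.
      by rewrite sqr_sqrtr ?(ltW nt0)// invf_div.
    by field; rewrite gt_eqF.
  by rewrite -[leRHS]invrK lef_pV2 ?posrE ?invr_gt0.
have eta3 : eta <= 55 * (B + 1) * (l * L * d).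
  apply: le_trans etaE _.
  have -> : 55 * (B + 1) * (l * L * d) = (54 * (B + 1) * (l * L) + (B + 1) * (l * L)) * d.
    by ring.
  rewrite ler_pM2r// lerD2l ler_peMr//; move: B0; lra.
have CC : 0 <= C + C' by rewrite addr_ge0// ltW.
have H1 : 2 * eta * (C + C') <= 110 * (B + 1) * (c1 + C') * (l * L * d).
  apply: (@le_trans _ _ (2 * (55 * (B + 1) * (l * L * d)) * (C + C'))).
    by rewrite ler_wpM2r// ler_pM2l.
  have -> : 110 * (B + 1) * (c1 + C') * (l * L * d) =
    2 * (55 * (B + 1) * (l * L * d)) * (c1 + C') by ring.
  rewrite ler_wpM2l ?lerD2r// !mulr_ge0//; [move: B0; lra|exact: ltW..].
have H2 : 3 * (L * d) <= 3 * (l * L * d).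
  rewrite ler_pM2l// -mulrA ler_peMl ?mulr_ge0 ?(ltW L0) ?(ltW d0)//.
  by have := large_lnln H; lra.
rewrite /separation -/d.
have := large_gap H; rewrite -(ler_pM2r (mulr_gt0 L0 d0)).
lra.
Qed.

End witness.
End error_bound.

(** * Error of the estimator *)

Section estimator_error.
Context {R : realType}.
Context (alpha b B C' xi c0 c1 : R) (n : nat).
Context (b0 : 0 < b) (bB : b < B) (C'0 : 0 < C') (xi0 : 0 < xi) (c00 : 0 < c0).
Context (c01 : c0 <= c1).
Context (H : large_enough alpha b B C' xi c0 c1 n).
Implicit Types (F : @distribution_function R) (tau C beta s t w : R).

Local Notation L := (ln (n%:R : R)).
Local Notation l := (ln (ln (n%:R : R))).
Local Notation M := (nb_classes xi n).
Local Notation beta_ := (beta_grid b B xi n).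

Let n0 : (0 < n)%N := large_n H.
Let n0' : 0 < n%:R :> R. Proof. by rewrite ltr0n n0. Qed.
Let L0 : 0 < L. Proof. exact: lt_le_trans (large_ln H). Qed.

Let fit_error := M.+1%:R * (4 * expR (- (l ^+ 2 / 128))) +
    (5 * n ^ 2)%:R * (2 * expR (- (L ^+ 2 / (8 * (c1 + C' + 1))))).
Let witness_error := expR (- L) + 2 * expR (- (L ^+ 2 / (8 * (c1 + C' + 1)))).

(** [l >= 256] gives [l^2 / 128 >= 2 * l], hence a failure of order [L^(-2)] per level against about
    [L / xi] levels. [large_dev] gives [n^(-4)] per grid point against [5 * n^2] points. In units of
    [1 / L] the sum is [4 / xi + 17], with [17 = 4 + 10 + 1 + 2]. *)
Lemma total_error_le : fit_error + witness_error <= alpha.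
Proof.
have K0 : 0 < c1 + C' + 1 by move: c00 c01 C'0; lra.
have enL : expR (- L) = n%:R^-1 by rewrite expRN lnK.
have L1 := large_ln H; have l256 := large_lnln H.
have E1 : expR (- (l ^+ 2 / 128)) <= L^-1 ^+ 2.
  have -> : L^-1 ^+ 2 = expR (2%:R * - l).
    by rewrite expRM_natl expRN lnK.
  by rewrite ler_expR mulrN lerN2 ler_pdivlMr// expr2; nra.
have E2 : expR (- (L ^+ 2 / (8 * (c1 + C' + 1)))) <= n%:R^-1 ^+ 4.
  have -> : n%:R^-1 ^+ 4 = expR (4%:R * - L) by rewrite expRM_natl enL.
  rewrite ler_expR mulrN lerN2 ler_pdivlMr ?mulr_gt0//.
  by have := large_dev H; nra.
have nL : n%:R^-1 <= L^-1.
  rewrite lef_pV2 ?posrE// -[leRHS]lnK ?posrE//.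
  by apply: le_trans (expR_ge1Dx _); rewrite lerDr.
have n1 : n%:R^-1 <= 1 :> R by rewrite invf_le1// ler1n.
have ni0 : 0 < n%:R^-1 :> R by rewrite invr_gt0.
have M1 : M.+1%:R <= L / xi + 1 by rewrite -natr1 lerD2r (nb_classes_le xi0 H).
have Li0 : 0 < L^-1 by rewrite invr_gt0.
have P1 : M.+1%:R * (4 * expR (- (l ^+ 2 / 128))) <= (4 / xi + 4) * L^-1.
  apply: (@le_trans _ _ ((L / xi + 1) * (4 * L^-1 ^+ 2))).
    by apply: ler_pM => //; rewrite ?mulr_ge0 ?expR_ge0// ler_pM2l.
  have -> : (L / xi + 1) * (4 * L^-1 ^+ 2) = (4 / xi + 4 * L^-1) * L^-1.
    by field; rewrite !gt_eqF.
  rewrite ler_pM2r// lerD2l ler_piMr// invf_le1//.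
have n2 : (5 * n ^ 2)%:R = 5 * n%:R ^+ 2 :> R by rewrite natrM natrX.
have P2 : (5 * n ^ 2)%:R * (2 * expR (- (L ^+ 2 / (8 * (c1 + C' + 1))))) <= 10 * L^-1.
  apply: (@le_trans _ _ (5 * n%:R ^+ 2 * (2 * n%:R^-1 ^+ 4))).
    by rewrite n2; apply: ler_wpM2l; [rewrite mulr_ge0 ?sqr_ge0|rewrite ler_pM2l].
  have -> : 5 * n%:R ^+ 2 * (2 * n%:R^-1 ^+ 4) = 10 * (n%:R^-1 * n%:R^-1) :> R.
    by field; rewrite gt_eqF.
  rewrite ler_pM2l//; apply: le_trans nL; rewrite ler_piMr// ltW.
have P3 : 2 * expR (- (L ^+ 2 / (8 * (c1 + C' + 1)))) <= 2 * L^-1.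
  rewrite ler_pM2l//; apply: le_trans E2 _; apply: le_trans nL.
  by rewrite exprS ler_piMr ?(ltW ni0)// exprn_ile1// ltW.
have := large_alpha H; rewrite -ler_pdivrMr//.
apply: le_trans; rewrite /fit_error /witness_error enL mulrDl mulrDl in P1 *.
rewrite mulrDl; lra.
Qed.

Let threshold := 4 * xi * ((B - b) / L).

Lemma two_steps_lt : 2 * (B - b) / M%:R < threshold.
Proof.
have M0 : 0 < M%:R :> R by rewrite ltr0n (nb_classes_gt0 xi0 H).
have -> : threshold = 2 * (B - b) / (L / (2 * xi)).
  by rewrite /threshold; field; rewrite !gt_eqF.
rewrite ltr_pM2l; last by rewrite mulr_gt0// subr_gt0.
by rewrite ltf_pV2 ?posrE ?divr_gt0 ?mulr_gt0// (nb_classes_gt xi0 H).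
Qed.

Let measurable_miss (s : R) : measurable [set X : n.-tuple (measurableTypeR R) |
  threshold <= `|beta_hat b B C' xi X - s|].
Proof.
have mf : measurable_fun setT (fun X : n.-tuple (measurableTypeR R) =>
    `|beta_hat b B C' xi X - s|).
  apply: measurableT_comp => //; apply: measurable_funB => //.
  exact: measurable_beta_hat.
have := mf measurableT _ (measurable_itv `[threshold, +oo[).
rewrite setTI; congr measurable; apply/seteqP; split => X /=;
  by rewrite in_itv/= andbT.
Qed.

(** In the top class index [0] is accepted and there is no error. Otherwise both the estimate and
    [beta_star] lie between [beta_ i.+2] and [beta_ i], two grid steps apart. *)
Lemma estimator_prob (I1 I2 : set R) F :
  I1 `<=` [set x | 0 < x] -> I2 `<=` [set x | c0 <= x <= c1] ->
  model I1 I2 b B C' xi (@separation R) n F ->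
  (sample_prob F n [set X | (threshold <= `|beta_hat b B C' xi X - beta_star b B C' F|)%R]
    <= alpha%:E)%E.
Proof.
move=> I1pos I2b [tau /I1pos/= t0 [C /I2b/= /andP[c0C Cc1] FM]].
have M0 := nb_classes_gt0 xi0 H.
have C0 : 0 < C by exact: lt_le_trans c0C.
have eps0 : 0 <= witness_error.
  by rewrite addr_ge0 ?mulr_ge0 ?expR_ge0.
have beta0 : beta_ 0 = B by rewrite /beta_grid !mul0r subr0.
case: FM => [FB|[i /= iM FS]].
  have FB0 : pareto_class tau (beta_ 0) C C' F by rewrite beta0.
  apply: (@le_trans _ _ (fit_error)%:E); last first.
    by rewrite lee_fin; apply: le_trans total_error_le; rewrite lerDl.
  apply: le_trans (fitting_prob b0 bB C'0 xi0 c00 H t0 c0C Cc1 (leq0n _) FB0).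
  apply: le_measure; rewrite ?inE //.
    by apply: measurableU; apply: measurableC;
      [exact: measurable_specials|exact: measurable_grids].
  move=> X /= miss; apply: contrapT => /not_orP[/contrapT A /contrapT G].
  have acc := fitting_accepted b0 bB xi0 c00 H t0 c0C (leq0n _) A G.
  have [|j [/andP[_ j0] E]] := @first_hitP _ _ R _ beta_ M.+1 0 X 0 0 (leqnn _)
    (leqnn _) (ltn0Sn _) acc; first by move=> j.
  move: miss; rewrite /beta_hat E (beta_star_top b0 (ltW bB) t0 C0 FB).
  have -> : j = 0%N by apply/eqP; rewrite -leqn0.
  rewrite beta0 subrr normr0 leNgt => /negP; apply.
  apply: le_lt_trans two_steps_lt.
  by rewrite divr_ge0 ?mulr_ge0 ?subr_ge0 ?(ltW bB).
have i2M : (i.+2 <= M)%N by rewrite -addn2.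
have FS' : separated_class tau (beta_ i.+2) (beta_ i) C C' (separation n (beta_ i.+2)) F.
  by move: FS; rewrite addn2.
have rho0 := separation_gt0 H (beta_ i.+2).
have /andP[bi2 Bi2] := beta_grid_bounds bB M0 i2M.
have iM' : (i <= M)%N by apply: leq_trans i2M; rewrite -addn2 leq_addr.
have /andP[bi Bi] := beta_grid_bounds bB M0 iM'.
have bii : beta_ i.+2 <= beta_ i by apply: beta_grid_le => //; rewrite -addn2 leq_addr.
have bi0 : 0 < beta_ i by exact: lt_le_trans bi.
have [w [t [w0 tE t1 Fw W]]] := separated_witness t0 bi0 bii C0 C'0 rho0 FS'.
have FC := FS'.1.
have /andP[bs1 bs2] := beta_star_separated b0 bi2 bii Bi t0 C0 C'0 rho0 FS'.
pose A := [set X : n.-tuple (measurableTypeR R) | forall k, (i.+2 <= k <= M)%N ->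
    special_ok X tau C (scale n (beta_ k)) (tolerance n (beta_ k))].
pose G := [set X : n.-tuple (measurableTypeR R) | forall m : nat,
    1 + m%:R / n%:R <= 4 * scale n b ->
    grid_ok X tau C (beta_ i.+2) C' (1 + m%:R / n%:R)].
pose W1 := [set X : n.-tuple (measurableTypeR R) | exceed X w = n%:R].
pose W2 := [set X : n.-tuple (measurableTypeR R) |
  deviation n t < `|exceed X w - n%:R * (1 - F w)|].
have mAG : measurable (~` A `|` ~` G).
  by apply: measurableU; apply: measurableC;
    [exact: measurable_specials|exact: measurable_grids].
have mW1 : measurable W1 by exact: measurable_exceed_eq.
have mW2 : measurable W2 by exact: measurable_exceed_dev.
have mW : measurable (W1 `|` W2) by exact: measurableU.
apply: (@le_trans _ _ (sample_prob F n ((~` A `|` ~` G) `|` (W1 `|` W2)))).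
  apply: le_measure; rewrite ?inE //; first exact: measurableU.
  move=> X /= miss; apply: contrapT => /not_orP[/not_orP[/contrapT AX /contrapT GX]].
  move=> /not_orP[/eqP wn /negP]; rewrite -leNgt => wd.
  have acc := fitting_accepted b0 bB xi0 c00 H t0 c0C i2M AX GX.
  (* Every index up to [i] is rejected. Index [i + 1] is left undecided, which the two-step error
     allows. *)
  have rej j : (0 <= j < i.+1)%N -> ~ accepted b B C' xi j X.
    move=> /andP[_ ji] [r1 [r2 [r10 r20 [S2 G2]]]].
    have ji2 : (j <= i.+2 <= M)%N by rewrite i2M andbT (leq_trans (ltnW ji)).
    have bij : beta_ i <= beta_ j by apply: beta_grid_le.
    apply: (witness_incompatible b0 bB C'0 c00 H t0 c0C Cc1 bi2 bii Bi FC w0 tE t1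
      Fw W r10 r20 bij wn wd _ (S2 _ ji2) G2).
    by apply: AX; rewrite leqnn.
  have [j [/andP[ij ji] E]] := @first_hitP _ _ R _ beta_ M.+1 0 X i.+1 i.+2 (leq0n _)
    (leqnSn _) (i2M : (i.+2 < 0 + M.+1)%N) acc rej.
  move: miss; rewrite /beta_hat E leNgt => /negP; apply.
  apply: le_lt_trans two_steps_lt.
  have b1 : beta_ i.+2 <= beta_ j by apply: beta_grid_le.
  have b2 : beta_ j <= beta_ i by apply: beta_grid_le => //; exact: ltnW.
  have gap : beta_ i - beta_ i.+2 = 2 * (B - b) / M%:R.
    by rewrite /beta_grid -[i.+2]addn2 natrD; ring.
  by rewrite -gap ler_norml; apply/andP; split; lra.
apply: le_trans (measureU2 _ mAG mW) _.
apply: (@le_trans _ _ (fit_error + witness_error)%:E); last first.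
  by rewrite lee_fin total_error_le.
rewrite EFinD; apply: leeD.
  exact: (fitting_prob b0 bB C'0 xi0 c00 H t0 c0C Cc1 i2M FC).
apply: le_trans (measureU2 _ mW1 mW2) _.
rewrite EFinD; apply: leeD.
  exact: (witness_all_prob b0 C'0 c00 H bi2 bii Bi FC w0 tE t1 Fw W).
exact: (witness_deviation_prob b0 C'0 c00 H c0C Cc1 bi2 bii Bi FC w0 tE t1 Fw W).
Qed.

End estimator_error.

(** * Asymptotics *)

Section asymptotics.
Context {R : realType}.

Lemma ln_nat_ge (A : R) : \forall n \near \oo, A <= ln (n%:R : R).
Proof.
have := @nbhs_infty_ger R (expR A); apply: filterS => n An.
by rewrite -ler_expR lnK// posrE (lt_le_trans (expR_gt0 A)).
Qed.

Lemma lnln_nat_ge (A : R) : \forall n \near \oo, A <= ln (ln (n%:R : R)).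
Proof.
have := ln_nat_ge (expR A); apply: filterS => n An.
by rewrite -ler_expR lnK// posrE (lt_le_trans (expR_gt0 A)).
Qed.

(** The rate is [expR (- p * ln n)], and the cubic term of the exponential already beats the square
    of the logarithm. *)
Lemma sqr_ln_rate (b e : R) : 0 < b -> 0 < e ->
  \forall n \near \oo, ln n%:R ^+ 2 * rate n b <= e.
Proof.
move=> b0 e0; pose p := b / (2 * b + 1).
have p0 : 0 < p by rewrite divr_gt0//; lra.
near=> n.
have L1 : 1 <= ln (n%:R : R) by near: n; exact: ln_nat_ge.
have Le : 6 / (p ^+ 3 * e) <= ln (n%:R : R) by near: n; exact: ln_nat_ge.
have n0 : (0 < n)%N.
  by rewrite lt0n; apply/eqP => n0; move: L1; rewrite n0 ln0// leNgt ltr01.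
have -> : rate n b = (expR (p * ln n%:R))^-1.
  by rewrite /rate powRN /powR gt_eqF// ltr0n.
set L := ln _ in L1 Le *.
have L0 : 0 < L by exact: lt_le_trans L1.
rewrite ler_pdivrMr ?expR_gt0//.
have := @expR_ge1Dxn R (p * L) 2 (ltW (mulr_gt0 p0 L0)).
have -> : 3`!%:R = 6 :> R by [].
move=> E3; have : e * ((p * L) ^+ 3 / 6) <= e * expR (p * L).
  by rewrite ler_pM2l//; lra.
apply: le_trans; rewrite exprMn.
have -> : e * (p ^+ 3 * L ^+ 3 / 6) = L ^+ 2 * (L * (p ^+ 3 * e / 6)) by ring.
rewrite ler_peMr ?sqr_ge0//.
have pe0 : 0 < p ^+ 3 * e by rewrite mulr_gt0 ?exprn_gt0.
by move: Le; rewrite ler_pdivrMr// => Le; rewrite mulrA ler_pdivlMr// mul1r.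
Unshelve. all: by end_near. Qed.

Lemma eventually_large (alpha b B C' xi c0 c1 : R) :
  0 < alpha -> 0 < b -> b < B -> 0 < C' -> 0 < xi -> 0 < c0 -> c0 <= c1 ->
  \forall n \near \oo, large_enough alpha b B C' xi c0 c1 n.
Proof.
move=> a0 b0 bB C'0 xi0 c00 c01.
pose K1 := (Num.min 1 (c0 / 4)) `^ (- B).
pose K3 := 2 * (110 * (B + 1) * (c1 + C') + 3).
have B0 : 0 < B by exact: lt_trans bB.
have K30 : 0 <= K3.
  have : 0 <= (B + 1) * (c1 + C') by rewrite mulr_ge0//; lra.
  by rewrite /K3; lra.
(* Chosen so that [55 * (B + 1) * e = 1 / 2], as [large_eta] demands. *)
pose e := (2 * (55 * (B + 1)))^-1.
have e0 : 0 < e by rewrite invr_gt0; lra.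
near=> n.
have L1 : 1 <= ln (n%:R : R) by near: n; exact: ln_nat_ge.
have n0 : (0 < n)%N.
  by rewrite lt0n; apply/eqP => n0; move: L1; rewrite n0 ln0// leNgt ltr01.
have l256 : 256 <= ln (ln (n%:R : R)) by near: n; exact: lnln_nat_ge.
have Ld1 : ln n%:R ^+ 2 * rate n b <= 1 / 40 by near: n; apply: sqr_ln_rate; lra.
have Ld2 : ln n%:R ^+ 2 * rate n b <= 1 / 4 by lra.
have Ld3 : ln n%:R ^+ 2 * rate n b <= e by near: n; exact: sqr_ln_rate.
have d0 : 0 < rate n b by exact: rate_gt0.
have d1 : rate n b <= 1 by exact: rate_le1.
have lL : ln (ln (n%:R : R)) <= ln n%:R.
  rewrite -ler_expR lnK ?posrE ?(lt_le_trans ltr01)//.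
  by apply: le_trans (expR_ge1Dx _); rewrite lerDr.
have LL : ln (n%:R : R) <= ln n%:R ^+ 2 by rewrite expr2 ler_peMl//; lra.
have l3 : 1 <= ln (ln (n%:R : R)) `^ (3 / 2).
  by apply: le_trans (le1r_powR _ _); lra.
split => //.
- apply: le_trans Ld1; rewrite ler_pM2r//; lra.
- rewrite -/K1 -ler_pdivrMl//; near: n; exact: lnln_nat_ge.
- have : (2 * B + 1) * (4 / c0) <= ln (n%:R : R) by near: n; exact: ln_nat_ge.
  rewrite -ler_pdivlMl; last lra.
  rewrite ler_pdivrMr// => H; rewrite mulrC; apply: le_trans H _.
  rewrite ler_pM2r// /scale /powR gt_eqF ?ltr0n//.
  by apply: le_trans (expR_ge1Dx _); rewrite lerDr.
- have : rate n b ^+ 2 <= rate n b by rewrite expr2 ler_piMr// ltW.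
  move=> /(ler_wpM2l (sqr_ge0 (ln n%:R))) H; rewrite -mulrA; lra.
- by rewrite lerNl; near: n; exact: ln_nat_ge.
- by near: n; exact: ln_nat_ge.
- apply: (@le_trans _ _ (55 * (B + 1) * (ln n%:R ^+ 2 * rate n b))).
    rewrite [leRHS]mulrA ler_pM2r//.
    have : ln (ln n%:R) * ln n%:R <= ln (n%:R : R) ^+ 2.
      by rewrite expr2 ler_pM2r//; lra.
    have B1 : 0 <= B + 1 by lra.
    move=> /(ler_wpM2l B1) H1.
    have := ler_wpM2l B1 (le_trans L1 LL).
    lra.
  apply: (@le_trans _ _ (55 * (B + 1) * e)).
    by rewrite ler_pM2l//; lra.
  by rewrite /e le_eqVlt; apply/orP; left; apply/eqP; field; lra.
- rewrite -/K3.
  (* [l^(3/2)] is [sqrt l * l], so the constant only has to be below [sqrt l]. *)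
  have lK : K3 ^+ 2 <= ln (ln (n%:R : R)) by near: n; exact: lnln_nat_ge.
  set l := ln (ln _) in l256 lK *.
  have l0 : 0 < l by lra.
  have -> : l `^ (3 / 2) = Num.sqrt l * l.
    have -> : 3 / 2 = 2^-1 + 1 :> R by field.
    rewrite powRD; last by rewrite (gt_eqF l0) implybT.
    by rewrite powRr1 ?powR12_sqrt// ltW.
  by rewrite ler_pM2r// -[leLHS]ger0_norm// -sqrtr_sqr ler_sqrt// ltW.
- rewrite -/K1; have : 2 * C' * K1 <= ln (n%:R : R) by near: n; exact: ln_nat_ge.
  by move=> /le_trans; apply; rewrite ler_peMr//; lra.
- by near: n; exact: ln_nat_ge.
- by near: n; exact: ln_nat_ge.
- by rewrite -ler_pdivrMl//; near: n; exact: ln_nat_ge.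
Unshelve. all: by end_near. Qed.

Lemma limn_esup_le_near (u : nat -> \bar R) (a : \bar R) :
  (\forall n \near \oo, (u n <= a)%E) -> (limn_esup u <= a)%E.
Proof.
move=> ua; apply: (@le_trans _ _ (ereal_sup (u @` [set n | (u n <= a)%E]))).
  by apply: ereal_inf_lbound; exists [set n | (u n <= a)%E].
by apply: ge_ereal_sup => _ [n /= un <-].
Qed.

(** Equal to [1], or to [0] at [x = 0] by the convention for the inverse. The normalised [rho] is a
    product of two such terms, so it is at most [1] even for the small [n] where a logarithm
    degenerates. *)
Lemma mulVr_le1 (x : R) : x^-1 * x <= 1.
Proof. by have [->|x0] := eqVneq x 0; rewrite ?mulr0 ?ler01// mulVf. Qed.

Lemma mulVr_ge0 (x : R) : 0 <= x^-1 * x.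
Proof. by have [->|x0] := eqVneq x 0; rewrite ?mulr0 ?ler01// mulVf. Qed.

End asymptotics.

Theorem theorem3p4 (R : realType) (alpha b B C' xi : R) (I1 I2 : set R)
    (alpha_gt0 : 0 < alpha) (b_gt0 : 0 < b) (b_lt_B : b < B)
    (C'_gt0 : 0 < C') (xi_gt0 : 0 < xi)
    (I1_closed : closed I1) (I1_gt0 : I1 `<=` [set x | 0 < x])
    (I2_closed : closed I2) (I2_gt0 : I2 `<=` [set x | 0 < x])
    (I2_bounded : has_ubound I2) :
  exists rho : nat -> R -> R,
    [/\ forall n beta, 0 <= rho n beta,
        (limn_esup (fun n : nat => ereal_sup
          [set (let beta_i := beta_grid b B xi n i in
                rho n beta_i *
                  (n%:R `^ (beta_i / (2 * beta_i + 1)) /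
                   (ln n%:R * (ln (ln n%:R)) `^ (3 / 2))))%:E
          | i in [set i : nat | (i <= nb_classes xi n)%N]]) < +oo)%E
      & exists betahat : forall n : nat, n.-tuple (measurableTypeR R) -> R,
          (forall n, measurable_fun [set: n.-tuple (measurableTypeR R)]
                       (betahat n)) /\
          (limn_esup (fun n : nat => ereal_sup
            [set sample_prob F n
                   [set X | (4 * xi * ((B - b) / ln n%:R)
                             <= `|betahat n X - beta_star b B C' F|)%R]
            | F in model I1 I2 b B C' xi rho n]) <= alpha%:E)%E].
Proof.
exists (@separation R); split.
- move=> n beta; rewrite /separation !mulr_ge0 ?powR_ge0//.
  by case: n => [|n]; [rewrite ln0|rewrite ln_ge0// ler1n].
- apply: (@le_lt_trans _ _ 1%:E); last exact: ltry.
  apply: limn_esup_le_near; apply: nearW => n.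
  apply: ge_ereal_sup => _ [i _ <-]; rewrite lee_fin /separation /rate.
  set be := beta_grid _ _ _ _ _; set x := ln n%:R * _; rewrite powRN.
  set y := n%:R `^ _.
  have -> : x * y^-1 * (y / x) = (y^-1 * y) * (x^-1 * x) by ring.
  by rewrite mulr_ile1 ?mulVr_le1 ?mulVr_ge0.
(* [0] lies outside the closed set [I2], hence at a positive distance from it; [c0] and, below, the
   upper bound [c1] make all estimates uniform in [C]. *)
have [c0 c00 I2c0] : exists2 c0, 0 < c0 & forall C, I2 C -> c0 <= C.
  have oI : open (~` I2) by exact: closed_openC.
  have : nbhs (0 : R) (~` I2).
    by apply: open_nbhs_nbhs; split => // /I2_gt0/=; rewrite ltxx.
  move=> [e /= e0 He]; exists e => // C IC; rewrite leNgt; apply/negP => Ce.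
  have C0 := I2_gt0 _ IC; apply: (He C) => //=.
  by rewrite sub0r normrN gtr0_norm.
have [u Iu] := I2_bounded; pose c1 := Num.max c0 u.
have c01 : c0 <= c1 by rewrite le_max lexx.
have I2b : I2 `<=` [set x | c0 <= x <= c1].
  by move=> C IC /=; rewrite I2c0//= le_max (Iu _ IC) orbT.
exists (fun n => @beta_hat R b B C' xi n); split=> [n|].
  exact: measurable_beta_hat.
apply: limn_esup_le_near.
have := eventually_large alpha_gt0 b_gt0 b_lt_B C'_gt0 xi_gt0 c00 c01.
apply: filterS => n Hn; apply: ge_ereal_sup => _ [F FM <-].
exact: (estimator_prob b_gt0 b_lt_B C'_gt0 xi_gt0 c00 c01 Hn I1_gt0 I2b FM).
Qed.
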